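(* Let $x:M\rightarrow \mathbb{S}^3\times \mathbb{R}\subset\mathbb{E}^5$ be a hypersurface with nowhere vanishing $T$ and with three distinct principal curvatures $k_1,k_2,k_3$ (i.e. $k_i-k_j$ vanishes nowhere for $i\neq j$) satisfying $ST=k_1T$. Assume that there are functional relations $k_2=f_1(k_1)$ and $k_3=f_2(k_1)$ for some smooth functions $f_1$ and $f_2$. Then $M$ is locally congruent to a hypersurface of the form $$x(s,v,w)=\big(\cos(\alpha_1(s))\cos v,\ \cos(\alpha_1(s))\sin v,\ \sin(\alpha_1(s))\cos w,\ \sin(\alpha_1(s))\sin w,\ \alpha_2(s)\big),$$ where $\alpha_1,\alpha_2$ are smooth functions satisfying $\alpha_1'(s)^2+\alpha_2'(s)^2=1$ and $\cos(\alpha_1(s))>0$, $\sin(\alpha_1(s))>0$.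
   Context: $\mathbb{S}^3\times\mathbb{R}=\{(x_1,\dots,x_5)\in\mathbb{E}^5 : x_1^2+x_2^2+x_3^2+x_4^2=1\}$ with the metric induced from Euclidean space $\mathbb{E}^5$. $M$ is an oriented 3-dimensional hypersurface with unit normal vector field $N$ (in $\mathbb{S}^3\times\mathbb{R}$) and shape operator $SX=-\widetilde\nabla_XN$, where $\widetilde\nabla$ is the Levi-Civita connection of $\mathbb{S}^3\times\mathbb{R}$. The tangent vector field $T$ and the function $\sigma$ on $M$ are defined by $\frac{\partial}{\partial x_5}\big|_M=T+\sigma N$. Principal curvatures are the eigenvalues of $S$. ''Locally congruent'' means that each point of $M$ has a neighborhood which, up to an isometry of $\mathbb{S}^3\times\mathbb{R}$, can be parametrized in the stated form. *)

(* Defs.v *)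
From HB Require Import structures.
From mathcomp Require Import all_boot all_order all_algebra.
From mathcomp Require Import all_classical all_reals all_analysis.
Set Implicit Arguments.
Unset Strict Implicit.
Unset Printing Implicit Defensive.
Import Order.TTheory GRing.Theory Num.Theory.
Import numFieldNormedType.Exports.
Local Open Scope classical_set_scope.
Local Open Scope ring_scope.

Section Smooth.
Context {R : realType} {V W : normedModType R}.
Implicit Types (f : V -> W) (U A : set V).

(* Meaningful for U open.  In finite dimension, "differentiable with all
   directional derivatives of class C^k" is class C^(k+1). *)
Fixpoint class_C (k : nat) U f : Prop :=
  match k with
  | 0 => forall a, U a -> {for a, continuous f}
  | k'.+1 => (forall a, U a -> differentiable f a) /\
             (forall v, class_C k' U ('D_v f))
  end.

Definition smooth_on U f := forall k, class_C k U f.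

Definition local_extension A f (a : V) U (F : V -> W) :=
  [/\ open U, U a, smooth_on U F & forall b, U b -> A b -> F b = f b].

(* Smoothness along an arbitrary subset A, e.g. a submanifold: only the values
   of f on A matter. *)
Definition smooth_along A f :=
  forall a, A a -> exists U F, local_extension A f a U F.

End Smooth.

Record chart (R : realType) (n : nat) (M : topologicalType) := Chart {
  dom : set M ;
  coord : M -> 'rV[R]_n ;
  param : 'rV[R]_n -> M ;
  open_dom : open dom ;
  open_codom : open (coord @` dom) ;
  coordK : forall p, dom p -> param (coord p) = p ;
  coord_continuous : {within dom, continuous coord} ;
  param_continuous : {within coord @` dom, continuous param} }.

Definition codom_chart (R : realType) (n : nat) (M : topologicalType)
  (c : chart R n M) : set 'rV[R]_n := coord c @` dom c.

Definition compatible (R : realType) (n : nat) (M : topologicalType)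
    (c d : chart R n M) : Prop :=
  smooth_on (coord c @` (dom c `&` dom d)) (coord d \o param c) /\
  smooth_on (coord d @` (dom c `&` dom d)) (coord c \o param d).

(* The atlas is presented as a family of charts indexed by the points, the
   chart of index p being defined around p; it then gives a preferred
   identification of the tangent space at p with 'rV_n. *)
Record manifold (R : realType) (n : nat) := Manifold {
  points :> topologicalType ;
  hausdorff_points : hausdorff_space points ;
  second_countable_points : @second_countable points ;
  chart_at : points -> chart R n points ;
  mem_chart_at : forall p, dom (chart_at p) p ;
  chart_at_compatible : forall p q, compatible (chart_at p) (chart_at q) }.

Definition in_maximal_atlas (R : realType) (n : nat) (M : manifold R n)
  (c : chart R n M) := forall p : M, compatible c (chart_at p).

Section MapsFromManifold.
Context {R : realType} {n m : nat} {M : manifold R n}.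
Implicit Type F : M -> 'rV[R]_m.

Definition smooth_map F := forall p : M,
  smooth_on (codom_chart (chart_at p)) (F \o param (chart_at p)).

(* Row-vector convention: the tangent vector u : 'rV_n at p is sent to
   u *m differential F p. *)
Definition differential F (p : M) : 'M[R]_(n, m) :=
  jacobian (F \o param (chart_at p)) (coord (chart_at p) p).

Definition immersion F :=
  smooth_map F /\ forall p, row_free (differential F p).

End MapsFromManifold.

Section Ambient.
Context {R : realType}.
Implicit Types p u v : 'rV[R]_5.

Definition dot u v : R := \sum_i u 0 i * v 0 i.

(* The coordinates x_1, ..., x_5 are indexed by 0, ..., 4; the last one,
   of index ord_max, is the coordinate of the factor R. *)
Definition S3R : set 'rV[R]_5 :=
  [set p | \sum_(i < 5 | i != ord_max) p 0 i ^+ 2 = 1].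

Definition d_x5 : 'rV[R]_5 := delta_mx 0 ord_max.

(* (x_1, x_2, x_3, x_4, 0), the Euclidean unit normal of S^3 x R at p. *)
Definition S3R_normal p : 'rV[R]_5 := p - p 0 ord_max *: d_x5.

Definition S3R_tangent p : set 'rV[R]_5 := [set u | dot (S3R_normal p) u = 0].

(* Orthogonal projection of E^5 onto the tangent space of S^3 x R at p,
   acting on row vectors from the right. *)
Definition S3R_proj p : 'M[R]_5 := 1%:M - (S3R_normal p)^T *m S3R_normal p.

(* The value of the metric on differentials does not depend on the local
   extension F, since it is evaluated only at tangent vectors of S^3 x R. *)
Definition S3R_isometry (phi : 'rV[R]_5 -> 'rV[R]_5) :=
  [/\ set_bij S3R S3R phi,
      smooth_along S3R phi,
      exists psi : 'rV[R]_5 -> 'rV[R]_5,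
        smooth_along S3R psi /\ {in S3R, cancel phi psi} &
      forall p, S3R p -> exists U F, local_extension S3R phi p U F /\
        {in S3R_tangent p &, forall u v,
           dot ('d F p u) ('d F p v) = dot u v}].

End Ambient.

Section Hypersurfaces.
Context {R : realType} {M : manifold R 3}.
Implicit Types x N : M -> 'rV[R]_5.

Definition hypersurface x := immersion x /\ forall p, S3R (x p).

(* Such an N is the same datum as an orientation of M, because S^3 x R is
   oriented. *)
Definition unit_normal x N :=
  [/\ smooth_map N,
      forall p, S3R_tangent (x p) (N p),
      forall p (u : 'rV[R]_3), dot (u *m differential x p) (N p) = 0 &
      forall p, dot (N p) (N p) = 1].

(* For a vector field Y of S^3 x R along x and a tangent vector u of M at p,
   u *m levi_civita x Y p is the covariant derivative of Y in the direction u: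
   the Levi-Civita connection of the induced metric is the tangential part of
   the derivative in E^5. *)
Definition levi_civita x (Y : M -> 'rV[R]_5) p : 'M[R]_(3, 5) :=
  differential Y p *m S3R_proj (x p).

(* S p acts on row vectors: the image of X is X *m S p.  The field S p is
   determined by this equation because x is an immersion. *)
Definition shape_operator x N (S : M -> 'M[R]_3) :=
  forall p (X : 'rV[R]_3),
    (X *m S p) *m differential x p = - (X *m levi_civita x N p).

Definition d_x5_decomposition x N (T : M -> 'rV[R]_3) (sigma : M -> R) :=
  forall p, d_x5 = T p *m differential x p + sigma p *: N p.

End Hypersurfaces.

Section Model.
Context {R : realType}.

Definition model (a1 a2 : R -> R) (s v w : R) : 'rV[R]_5 :=
  \row_(i < 5) [:: cos (a1 s) * cos v; cos (a1 s) * sin v;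
                   sin (a1 s) * cos w; sin (a1 s) * sin w; a2 s]`_i.

(* The functions a1 and a2 are defined on the open interval ]l, r[. *)
Definition profile (l r : R) (a1 a2 : R -> R) :=
  [/\ smooth_on `]l, r[%classic a1, smooth_on `]l, r[%classic a2 &
      forall s, l < s < r ->
        [/\ derive1 a1 s ^+ 2 + derive1 a2 s ^+ 2 = 1,
            0 < cos (a1 s) & 0 < sin (a1 s)]].

(* Around each point of M there are coordinates y = (s, v, w) in which
   phi \o x has the stated form. *)
Definition locally_congruent_to_model (M : manifold R 3)
    (x : M -> 'rV[R]_5) :=
  forall p : M, exists (phi : 'rV[R]_5 -> 'rV[R]_5) (c : chart R 3 M)
      (l r : R) (a1 a2 : R -> R),
    [/\ S3R_isometry phi,
        in_maximal_atlas c, dom c p,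
        profile l r a1 a2 &
        forall y : 'rV[R]_3, codom_chart c y ->
          l < y 0 0 < r /\
          phi (x (param c y)) = model a1 a2 (y 0 0) (y 0 1) (y 0 2)].

End Model.

(* Main.v *)
Require Import Defs.
From HB Require Import structures.
From mathcomp Require Import all_boot all_order all_algebra.
From mathcomp Require Import all_classical all_reals all_analysis.
From mathcomp Require Import ring lra.
Import Order.TTheory GRing.Theory Num.Theory.
Import numFieldNormedType.Exports.
Local Open Scope classical_set_scope.
Local Open Scope ring_scope.

(** Work in a chart and let h be the height x_5, n the unit normal of S^3 x R
    (the first four coordinates of the point), sigma the fifth coordinate of N
    and tau = sqrt (1 - sigma^2), which is positive because T does not vanish.
    The vectors n, nu = (N - sigma d_x5) / tau, the unit principal directions
    z2 and z3 of k2 and k3, and d_x5 form an orthonormal moving frame of E^5;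
    write omega_ij for the inner product of the differential of the vector i
    with the vector j, the indices running from 0 to 4 in this order.  Then
    omega_i4 = 0, omega_12 = - l omega_02 and omega_13 = - m omega_03 with
    l = k2 / tau and m = k3 / tau, and omega_01 = - (sigma / tau) dh.

    Since S T = k1 T, one has d sigma = - k1 dh; hence k1 is smooth, and
    differentiating once more shows that dk1 is proportional to dh
    ([smooth_k1]).  By the functional relations the same holds for k2 and k3,
    hence for l and m: along the slices of constant height, the surface of S^3
    traced there has constant principal curvatures l and m.  This is the
    situation of isoparametric surfaces, and Cartan's argument applies: the
    Codazzi equations, evaluated on the principal directions, give
    omega_23 = 0 and dl = (1 + l^2) omega_01, dm = (1 + m^2) omega_01, after
    which the structure equation of omega_23 becomes the Gauss equation of a
    flat torus, l m = - 1 ([cartan_identity]).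

    Exchanging k2 and k3 if necessary, m < 0.  Put theta = atan (- m), so that
    d theta = - omega_01.  In the rotated frame
    (cos theta n + sin theta nu, z3, sin theta n - cos theta nu, z2, d_x5) the
    connection forms between the first two vectors and the next two vanish
    ([rotated_connection]), so that these pairs span two constant orthogonal
    planes ([plane_constant]).  In a basis adapted to these planes n has the
    coordinates (cos theta cos v, cos theta sin v, sin theta cos w,
    sin theta sin w, 0) ([adapted_coordinates]).

    Finally d theta = (sigma / tau) dh.  Both sigma and tau are functions of h,
    so ds = dh / tau defines a function s, for which
    (d theta / ds)^2 + (dh / ds)^2 = sigma^2 + tau^2 = 1.  By the inverse
    function theorem (s, v, w) are local coordinates ([arc_length_chart]), and
    they belong to the maximal atlas ([chart_reparametrization]).  The isometry
    of the conclusion is the orthogonal change of basis of E^4 adapted to the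
    two planes. *)

Set Implicit Arguments.
Unset Strict Implicit.
Unset Printing Implicit Defensive.

(** * Calculus of functions of class C^k *)

Section ClassC.
Context {R : realType}.
Implicit Types V W Z : normedModType R.

Lemma near_open (T : topologicalType) (U : set T) (a : T) :
  open U -> U a -> \forall b \near a, U b.
Proof. by move=> oU Ua; exact: open_nbhs_nbhs. Qed.

(** The epsilon form of differentiability, in which the estimates for the local
    inverse are obtained. *)
Lemma differentiable_eps V W (f : V -> W) (L : {linear V -> W}) a :
  continuous L ->
  (forall e : R, 0 < e ->
     \forall h \near 0, `|f (h + a) - (f a + L h)| <= e * `|h|) ->
  differentiable f a /\ 'd f a = L :> (V -> W).
Proof.
move=> cL fL; have H : f \o shift a = cst (f a) + L +o_ 0 id.
  by apply/eqaddoP => e e0; exact: fL.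
have dE : 'd f a = L :> (V -> W) by exact: diff_unique.
by split=> //; apply/diff_locallyP; rewrite dE.
Qed.

Lemma differentiable_epsE V W (f : V -> W) a : differentiable f a ->
  forall e : R, 0 < e ->
     \forall h \near 0, `|f (h + a) - (f a + 'd f a h)| <= e * `|h|.
Proof. by move=> /diff_locallyP[_ /eqaddoP H] e e0; exact: H. Qed.

Lemma near_eq_differentiable V W (f g : V -> W) a :
  (\forall b \near a, f b = g b) -> differentiable f a -> differentiable g a.
Proof.
move=> fg df; have fga : f a = g a by exact: nbhs_singleton fg.
have cd : continuous ('d f a) by exact: diff_continuous.
apply: (proj1 (differentiable_eps cd _)) => e e0.
have fg0 : \forall h \near (0 : V), f (h + a) = g (h + a).
  move: fg; rewrite (near_shift 0 a) subr0 => fg.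
  by near=> h; apply: (near fg h).
near=> h; rewrite -fga -(near fg0 h)//; near: h.
exact: differentiable_epsE.
Unshelve. all: by end_near. Qed.

Lemma class_C_sub k V W (U U' : set V) (f : V -> W) :
  U' `<=` U -> class_C k U f -> class_C k U' f.
Proof.
move=> sU; elim: k f => [|k IH] f /= Cf; first by move=> a /sU; exact: Cf.
by split=> [a /sU|v]; [case: Cf => + _; exact | apply/IH; case: Cf].
Qed.

Lemma class_C_eq k V W (U : set V) (f g : V -> W) :
  open U -> (forall a, U a -> f a = g a) -> class_C k U f -> class_C k U g.
Proof.
move=> oU; elim: k f g => [|k IH] f g fg /=.
  move=> Cf a Ua; have fga : \forall b \near a, f b = g b.
    by near=> b; apply: fg; near: b; exact: near_open.
  rewrite /prop_for /continuous_at -(fg a)//.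
  by apply: cvg_trans (Cf a Ua); apply: near_eq_cvg.
move=> [df Cf]; split=> [a Ua|v].
  apply: near_eq_differentiable (df a Ua).
  by near=> b; apply: fg; near: b; exact: near_open.
apply: IH (Cf v) => a Ua; apply: near_eq_derive.
by near=> b; apply: fg; near: b; exact: near_open.
Unshelve. all: by end_near. Qed.

Lemma class_CS k V W (U : set V) (f : V -> W) :
  class_C k.+1 U f -> class_C k U f.
Proof.
elim: k f => [|k IH] f [df Cf]; first by move=> a /df /differentiable_continuous.
by split=> // v; exact: IH (Cf v).
Qed.

Lemma class_C_cst k V W (U : set V) (b : W) : class_C k U (fun=> b).
Proof.
elim: k b => [|k IH] b /=; first by move=> a _; exact: cvg_cst.
split=> [a _|v]; first exact: differentiable_cst.
have -> : 'D_v (cst b) = (cst 0 : V -> W) by apply/funext => a; exact: derive_cst.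
exact: IH.
Qed.

Lemma class_CD k V W (U : set V) (f g : V -> W) : open U ->
  class_C k U f -> class_C k U g -> class_C k U (fun a => f a + g a).
Proof.
move=> oU; elim: k f g => [|k IH] f g /=.
  by move=> Cf Cg a Ua; apply: cvgD; [exact: Cf|exact: Cg].
move=> [df Cf] [dg Cg]; split=> [a Ua|v].
  by apply: differentiableD; [exact: df|exact: dg].
apply: class_C_eq (IH _ _ (Cf v) (Cg v)) => // a Ua.
by rewrite -deriveD//; apply: diff_derivable; [exact: df|exact: dg].
Qed.

Lemma class_C_lin_comp k V W W' (U : set V) (f : V -> W) (L : {linear W -> W'}) :
  open U -> continuous L -> class_C k U f -> class_C k U (fun a => L (f a)).
Proof.
move=> oU cL; elim: k f => [|k IH] f /=.
  by move=> Cf a Ua; apply: continuous_comp; [exact: Cf|exact: cL].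
move=> [df Cf]; have dLf a : U a -> differentiable (L \o f) a.
  by move=> Ua; apply: differentiable_comp; [exact: df|exact: linear_differentiable].
split=> [a Ua|v]; first exact: dLf.
apply: class_C_eq (IH _ (Cf v)) => // a Ua.
rewrite (deriveE v (df a Ua)) (deriveE v (dLf a Ua)).
by rewrite (diff_comp (df a Ua) (linear_differentiable _ cL))/= diff_lin.
Qed.

Lemma class_C_lin k V W (U : set V) (L : {linear V -> W}) :
  continuous L -> class_C k U L.
Proof.
move=> cL; case: k => [|k] /=; first by move=> a _; exact: cL.
split=> [a _|v]; first exact: linear_differentiable.
have -> : 'D_v L = cst (L v).
  apply/funext => a; rewrite deriveE; last exact: linear_differentiable.
  by rewrite diff_lin.
exact: class_C_cst.
Qed.

Lemma class_CM k V (U : set V) (f g : V -> R) : open U ->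
  class_C k U f -> class_C k U g -> class_C k U (fun a => f a * g a).
Proof.
move=> oU; elim: k f g => [|k IH] f g.
  by move=> /= Cf Cg a Ua; apply: cvgM; [exact: Cf|exact: Cg].
move=> Cf Cg; move: (class_CS Cf) (class_CS Cg) => Cf' Cg'.
case: Cf Cg => [df Cf] [dg Cg].
split=> [a Ua|v]; first by apply: differentiableM; [exact: df|exact: dg].
apply: (class_C_eq (f := fun a => f a * 'D_v g a + g a * 'D_v f a)) => //.
  move=> a Ua; rewrite -[RHS]/('D_v (f * g) a) deriveM//.
    by apply: diff_derivable; exact: df.
  by apply: diff_derivable; exact: dg.
by apply: class_CD => //; [exact: IH Cf' (Cg v)|exact: IH Cg' (Cf v)].
Qed.

Lemma class_CN k V W (U : set V) (f : V -> W) : open U ->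
  class_C k U f -> class_C k U (fun a => - f a).
Proof.
move=> oU; elim: k f => [|k IH] f /=.
  by move=> Cf a Ua; apply: cvgN; exact: Cf.
move=> [df Cf]; split=> [a Ua|v]; first by apply: differentiableN; exact: df.
apply: class_C_eq (IH _ (Cf v)) => // a Ua.
by rewrite -deriveN//; apply: diff_derivable; exact: df.
Qed.

Lemma class_CB k V W (U : set V) (f g : V -> W) : open U ->
  class_C k U f -> class_C k U g -> class_C k U (fun a => f a - g a).
Proof. by move=> oU Cf Cg; apply: class_CD => //; exact: class_CN. Qed.

Lemma class_CZl k V W (U : set V) (f : V -> R) (w : W) : open U ->
  class_C k U f -> class_C k U (fun a => f a *: w).
Proof.
move=> oU Cf; have lin : linear (fun r : R => r *: w).
  by move=> r s t; rewrite scalerDl scalerA.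
pose lM := GRing.isLinear.Build _ _ _ _ _ lin.
pose L : {linear R -> W} := HB.pack (fun r : R => r *: w) lM.
by apply: (@class_C_lin_comp _ _ _ _ _ _ L) => //; exact: scalel_continuous.
Qed.

Lemma class_C_sum k V W (U : set V) (I : Type) (r : seq I) (P : pred I)
    (f : I -> V -> W) : open U -> (forall i, P i -> class_C k U (f i)) ->
  class_C k U (fun a => \sum_(i <- r | P i) f i a).
Proof.
move=> oU Cf; elim: r => [|i r IH].
  apply: class_C_eq (class_C_cst k U (0 : W)) => // a _.
  by rewrite big_nil.
case: (boolP (P i)) => Pi.
  apply: class_C_eq (class_CD oU (Cf i Pi) IH) => // a _.
  by rewrite big_cons Pi.
by apply: class_C_eq IH => // a _; rewrite big_cons (negbTE Pi).
Qed.

Lemma class_C_prod k V (U : set V) (I : Type) (r : seq I) (P : pred I)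
    (f : I -> V -> R) : open U -> (forall i, P i -> class_C k U (f i)) ->
  class_C k U (fun a => \prod_(i <- r | P i) f i a).
Proof.
move=> oU Cf; elim: r => [|i r IH].
  apply: class_C_eq (class_C_cst k U (1 : R)) => // a _.
  by rewrite big_nil.
case: (boolP (P i)) => Pi.
  apply: class_C_eq (class_CM oU (Cf i Pi) IH) => // a _.
  by rewrite big_cons Pi.
by apply: class_C_eq IH => // a _; rewrite big_cons (negbTE Pi).
Qed.

Lemma class_C_coord k V (U : set V) m n (F : V -> 'M[R]_(m, n)) i j :
  open U -> class_C k U F -> class_C k U (fun a => F a i j).
Proof.
move=> oU CF; have @L : {linear 'M[R]_(m, n) -> R}.
  by exists (fun N : 'M[R]_(_, _) => N i j); do 2![eexists]; do ?[constructor];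
     rewrite ?mxE// => ? *; rewrite ?mxE//; move=> ?; rewrite !mxE.
have -> : (fun a => F a i j) = (fun a => L (F a)) by [].
by apply: class_C_lin_comp => //; exact: coord_continuous.
Qed.

Lemma class_C_mx k V (U : set V) m n (F : V -> 'M[R]_(m, n)) :
  open U -> (forall i j, class_C k U (fun a => F a i j)) -> class_C k U F.
Proof.
move=> oU CF.
apply: (class_C_eq (f := fun a => \sum_(i < m) \sum_(j < n) F a i j *: delta_mx i j)) => //.
  by move=> a _; rewrite -matrix_sum_delta.
by apply: class_C_sum => // i _; apply: class_C_sum => // j _; exact: class_CZl.
Qed.

Lemma derive_mx_coord V m n (F : V -> 'M[R]_(m, n)) a v i j :
  differentiable F a -> ('D_v F a) i j = 'D_v (fun b => F b i j) a.
Proof. by move=> dF; rewrite derive_mx ?mxE//; exact: diff_derivable. Qed.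

Lemma derive_is_diff V W (f df : V -> W) a v : is_diff a f df -> 'D_v f a = df v.
Proof. by move=> d; rewrite (deriveE v (@ex_diff _ _ _ _ _ _ _ d)) diff_val. Qed.

Lemma derive_comp V W Z (f : V -> W) (g : W -> Z) a v :
  differentiable f a -> differentiable g (f a) ->
  'D_v (g \o f) a = 'D_('D_v f a) g (f a).
Proof.
move=> df dg; rewrite deriveE; last exact: differentiable_comp.
by rewrite (diff_comp df dg)/= !deriveE.
Qed.

Lemma deriveZr V W (f : V -> W) a l v : differentiable f a ->
  'D_(l *: v) f a = l *: 'D_v f a.
Proof. by move=> df; rewrite !deriveE// linearZ. Qed.

Lemma derive_rV W n (g : 'rV[R]_n -> W) a v : differentiable g a ->
  'D_v g a = \sum_i v 0 i *: 'D_(delta_mx 0 i) g a.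
Proof.
move=> dg; rewrite {1}(row_sum_delta v) !deriveE// linear_sum /=.
by apply: eq_bigr => i _; rewrite linearZ/= !deriveE.
Qed.

Lemma derive_R (g : R -> R) t v : differentiable g t ->
  'D_v g t = v * 'D_1 g t.
Proof.
by move=> dg; rewrite !deriveE// -[v in LHS]mulr1 -[v * 1]/(v *: (1 : R)) linearZ.
Qed.

(** The derivatives of a composite are sums of products of derivatives of the
    inner function with derivatives of the outer one composed with the inner
    one, so that the induction on k goes through products and sums only. *)
Lemma class_C_comp_rV k V n (U : set V) (U' : set 'rV[R]_n)
    (f : V -> 'rV[R]_n) (g : 'rV[R]_n -> R) :
  open U -> (forall a, U a -> U' (f a)) ->
  class_C k U f -> class_C k U' g -> class_C k U (fun a => g (f a)).
Proof.
move=> oU + + +; elim: k f g => [|k IH] f g UU'.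
  move=> /= Cf Cg a Ua.
  by apply: (@continuous_comp _ _ _ f g); [exact: Cf|exact/Cg/UU'].
move=> Cf; move: (class_CS Cf) => Cf'; case: Cf => df Cf [dg Cg].
split=> [a Ua|v].
  by apply: (@differentiable_comp _ _ _ _ f g); [exact: df|exact/dg/UU'].
apply: (class_C_eq (f := fun a =>
    \sum_i ('D_v f a) 0 i * 'D_(delta_mx 0 i) g (f a))) => //.
  move=> a Ua; rewrite -[RHS]/('D_v (g \o f) a).
  rewrite (derive_comp v (df a Ua) (dg _ (UU' a Ua))).
  by rewrite derive_rV//; exact/dg/UU'.
apply: class_C_sum => // i _; apply: class_CM => //.
  exact: (class_C_coord 0 i oU (Cf v)).
exact: IH UU' Cf' (Cg _).
Qed.

Lemma class_C_comp_rV_mx k V n m p (U : set V) (U' : set 'rV[R]_n)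
    (f : V -> 'rV[R]_n) (g : 'rV[R]_n -> 'M[R]_(m, p)) :
  open U -> open U' -> (forall a, U a -> U' (f a)) ->
  class_C k U f -> class_C k U' g -> class_C k U (fun a => g (f a)).
Proof.
move=> oU oU' UU' Cf Cg; apply: class_C_mx => // i j.
exact: (class_C_comp_rV oU UU' Cf (class_C_coord i j oU' Cg)).
Qed.

Lemma class_C_comp1 k V (U : set V) (U' : set R) (f : V -> R) (g : R -> R) :
  open U -> (forall a, U a -> U' (f a)) ->
  class_C k U f -> class_C k U' g -> class_C k U (fun a => g (f a)).
Proof.
move=> oU + + +; elim: k f g => [|k IH] f g UU'.
  move=> /= Cf Cg a Ua.
  by apply: (@continuous_comp _ _ _ f g); [exact: Cf|exact/Cg/UU'].
move=> Cf; move: (class_CS Cf) => Cf'; case: Cf => df Cf [dg Cg].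
split=> [a Ua|v].
  by apply: (@differentiable_comp _ _ _ _ f g); [exact: df|exact/dg/UU'].
apply: (class_C_eq (f := fun a => 'D_v f a * 'D_1 g (f a))) => //.
  move=> a Ua; rewrite -[RHS]/('D_v (g \o f) a).
  rewrite (derive_comp v (df a Ua) (dg _ (UU' a Ua))).
  by rewrite [RHS](derive_R _ (dg _ (UU' a Ua))).
exact: class_CM oU (Cf v) (IH _ _ UU' Cf' (Cg 1)).
Qed.

(** Along R a directional derivative is a multiple of the derivative, hence one
    function controls all of them; the elementary functions are smooth because
    their derivatives are expressed by functions already known to be smooth. *)
Lemma class_CS1 k (U : set R) (g g' : R -> R) : open U ->
  (forall t, U t -> is_derive t (1 : R) g (g' t)) ->
  class_C k U g' -> class_C k.+1 U g.
Proof.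
move=> oU dg Cg'; have dfg t : U t -> differentiable g t.
  by move=> Ut; apply/derivable1_diffP; have [] := dg t Ut.
split=> [//|v]; apply: (class_C_eq (f := fun t => v * g' t)) => //.
  by move=> t Ut; rewrite [RHS](derive_R _ (dfg t Ut)); have [_ ->] := dg t Ut.
by apply: class_CM => //; exact: class_C_cst.
Qed.

Lemma smooth_is_derive1 (U : set R) (g g' : R -> R) : open U ->
  (forall t, U t -> is_derive t (1 : R) g (g' t)) ->
  smooth_on U g' -> smooth_on U g.
Proof. by move=> oU dg Cg' k; apply: class_CS; exact: class_CS1 dg (Cg' k). Qed.

Lemma smooth_inv : smooth_on [set t : R | t != 0] (fun t : R => t^-1).
Proof.
have oU : open [set t : R | t != 0].
  by rewrite (_ : mkset _ = ~` [set 0]) ?openC//; apply/seteqP; split=> t /eqP.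
elim=> [|k IH].
  by move=> t /= t0; apply: differentiable_continuous; exact: differentiable_Rinv.
apply: (class_CS1 (g' := fun t => - (t^-1 * t^-1))) => //.
  move=> t /= t0; apply: DeriveDef.
    by apply/derivable1_diffP; exact: differentiable_Rinv.
  rewrite (@deriveV _ _ id)//.
  by rewrite derive_id -[_ *: 1]/(_ * 1) mulr1 -invfM.
by apply: class_CN => //; exact: class_CM.
Qed.

Lemma class_CV k V (U : set V) (f : V -> R) : open U ->
  (forall a, U a -> f a != 0) ->
  class_C k U f -> class_C k U (fun a => (f a)^-1).
Proof. by move=> oU f0 Cf; apply: class_C_comp1 Cf (smooth_inv k). Qed.

Lemma smooth_sqrt : smooth_on [set t : R | 0 < t] (fun t : R => Num.sqrt t).
Proof.
have oU : open [set t : R | 0 < t] by exact: open_gt.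
elim=> [|k IH]; first by move=> t _; exact: sqrt_continuous.
apply: (class_CS1 (g' := fun t => (2 * Num.sqrt t)^-1) oU).
apply: class_CV => //; first by move=> t /= t0; rewrite mulf_neq0 ?gt_eqF ?sqrtr_gt0.
by apply: class_CM => //; exact: class_C_cst.
Qed.

Lemma smooth_atan : smooth_on setT (@atan R).
Proof.
apply: smooth_is_derive1; first exact: openT.
have id_C k : class_C k [set: R] (fun t : R => t).
  by apply: (@class_C_lin k R R setT idfun) => t; exact: cvg_id.
move=> k; apply: class_CV; first exact: openT.
  by move=> t _; rewrite gt_eqF// ltr_wpDr ?sqr_ge0.
apply: class_CD; [exact: openT|exact: class_C_cst|].
by apply: class_CM => //; exact: openT.
Qed.

Lemma smooth_cos_sin : smooth_on setT (@cos R) /\ smooth_on setT (@sin R).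
Proof.
suff H k : class_C k setT (@cos R) /\ class_C k setT (@sin R).
  by split=> k; have [] := H k.
elim: k => [|k [IHc IHs]].
  by split=> t _; [exact: continuous_cos|exact: continuous_sin].
split.
  apply: (class_CS1 (g' := fun t => - sin t)); first exact: openT.
  by apply: class_CN => //; exact: openT.
by apply: (class_CS1 (g' := cos)) => //; first exact: openT.
Qed.

End ClassC.

(** * The mean value theorem and the symmetry of second derivatives *)

Section MeanValue.
Context {R : realType}.
Implicit Types V W : normedModType R.

Lemma is_derive_line V W (f : V -> W) a v (t : R) :
  differentiable f (a + t *: v) ->
  is_derive t (1 : R) (fun s : R => f (a + s *: v)) ('D_v f (a + t *: v)).
Proof.
move=> df; have dl : is_diff t (fun s : R => a + s *: v) (fun s => s *: v).
  have := is_diffD (is_diff_cst a t) (is_diff_scalel t v).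
  rewrite (_ : 0 + _ = fun s => s *: v)//.
  by apply/funext => s; rewrite !fctE add0r.
have dlt := @ex_diff _ _ _ _ _ _ _ dl.
have dc : differentiable (f \o (fun s : R => a + s *: v)) t.
  exact: differentiable_comp.
apply: DeriveDef; first exact/derivable1_diffP.
rewrite (derive_comp _ dlt df).
by rewrite (deriveE _ dlt) (@diff_val _ _ _ _ _ _ _ dl) scale1r.
Qed.

Lemma mean_value V (f : V -> R) a v :
  (forall t : R, 0 <= t <= 1 -> differentiable f (a + t *: v)) ->
  exists2 t : R, 0 <= t <= 1 & f (a + v) - f a = 'D_v f (a + t *: v).
Proof.
move=> df; pose F s := f (a + s *: v).
have dF (t : R) : t \in `]0, 1[%R -> is_derive t (1 : R) F ('D_v f (a + t *: v)).
  by rewrite in_itv/= => /andP[t0 t1]; apply/is_derive_line/df; rewrite !ltW.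
have cF : {within `[0, 1]%classic, continuous F}.
  apply: derivable_within_continuous => t /[!in_itv]/= t01.
  by have [] := is_derive_line (df t t01).
have [t] := MVT_segment ler01 dF cF.
rewrite in_itv/= /F subr0 mulr1 scale1r scale0r addr0 => t01 ->; by exists t.
Qed.

(** Balls of a normed space are convex. *)
Lemma ball_segment V (a b c : V) r (t : R) : 0 <= t <= 1 ->
  ball a r b -> ball a r c -> ball a r (b + t *: (c - b)).
Proof.
move=> /andP[t0 t1]; rewrite -!ball_normE /= => ab ac.
have -> : a - (b + t *: (c - b)) = (1 - t) *: (a - b) + t *: (a - c).
  have -> : a - c = (a - b) - (c - b) by rewrite opprB addrA subrK.
  by rewrite [t *: (a - b - _)]scalerBr addrA -scalerDl subrK scale1r opprD addrA.
apply: le_lt_trans (ler_normD _ _) _; rewrite !normrZ !ger0_norm ?subr_ge0//.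
have [->|t0'] := eqVneq t 0; first by rewrite mul0r addr0 subr0 mul1r.
rewrite [ltRHS](_ : r = (1 - t) * r + t * r); last by rewrite -mulrDl subrK mul1r.
rewrite ler_ltD//.
  by rewrite ler_wpM2l ?subr_ge0// ltW.
by rewrite ltr_pM2l// lt0r t0'.
Qed.

Lemma zero_derivative_constant V (f : V -> R) a r :
  (forall b, ball a r b -> differentiable f b) ->
  (forall b v, ball a r b -> 'D_v f b = 0) ->
  forall b c, ball a r b -> ball a r c -> f b = f c.
Proof.
move=> df D0 b c ab ac; apply/eqP; rewrite eq_sym -subr_eq0.
have [t t01] := @mean_value V f b (c - b)
  (fun t t01 => df _ (ball_segment t01 ab ac)).
by rewrite (addrC b) subrK => ->; rewrite D0//; exact: ball_segment.
Qed.

Lemma eq_of_close_values V (A B : V -> R) a :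
  {for a, continuous A} -> {for a, continuous B} ->
  (forall d : R, 0 < d -> exists p q, [/\ ball a d p, ball a d q & A p = B q]) ->
  A a = B a.
Proof.
move=> cA cB H; apply/eqP; rewrite -subr_eq0 -normr_le0.
apply/ler_addgt0Pl => e e0; rewrite addr0.
have e20 : 0 < e / 2 by rewrite divr_gt0.
have /nbhs_ballP[d /= d0 dA] : \forall p \near a, `|A a - A p| < e / 2.
  by move/cvgrPdist_lt: cA; exact.
have /nbhs_ballP[d' /= d'0 dB] : \forall p \near a, `|B a - B p| < e / 2.
  by move/cvgrPdist_lt: cB; exact.
have dd0 : 0 < Num.min d d' by rewrite lt_min d0.
have [p [q [ap aq E]]] := H _ dd0.
have /dA Ap : ball a d p by apply: le_ball ap; rewrite ge_min lexx.
have /dB Bq : ball a d' q by apply: le_ball aq; rewrite ge_min lexx orbT.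
rewrite -(subrKA (A p)) {2}E.
rewrite (splitr e) (le_trans (ler_normD _ _))// ltW// ltrD//.
by rewrite distrC.
Qed.

(** The mean value theorem applied to x |-> f (x + s w) - f x along v, and
    then to the derivative along w. *)
Lemma second_difference V (U : set V) (f : V -> R) a v w (s : R) :
  class_C 2 U f -> 0 <= s ->
  (forall t u : R, 0 <= t <= s -> 0 <= u <= s -> U (a + t *: v + u *: w)) ->
  exists t u : R, [/\ 0 <= t <= s, 0 <= u <= s &
    f (a + s *: v + s *: w) - f (a + s *: v) - (f (a + s *: w) - f a) =
      s ^+ 2 * 'D_w ('D_v f) (a + t *: v + u *: w)].
Proof.
move=> [df /(_ v) [dDf _]] s0 HU.
have scl (t : R) : 0 <= t <= 1 -> 0 <= t * s <= s.
  by move=> /andP[t0 t1]; rewrite mulr_ge0//= ler_piMl.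
have sl (t : R) : 0 <= t <= s -> 0 <= t <= s by [].
have s0s : 0 <= (0 : R) <= s by rewrite lexx.
have sss : 0 <= s <= s by rewrite s0 lexx.
pose G x := f (x + s *: w) - f x.
have dsh (x : V) : is_diff x (fun y => y + s *: w) id.
  have := is_diffD (is_diff_id x) (is_diff_cst (s *: w) x).
  by rewrite addr0.
have Uat t : 0 <= t <= 1 -> U (a + t *: (s *: v)).
  move=> t01; have := HU _ 0 (scl t t01) s0s.
  by rewrite scale0r addr0 scalerA.
have Uats t : 0 <= t <= 1 -> U (a + t *: (s *: v) + s *: w).
  by move=> t01; have := HU _ s (scl t t01) sss; rewrite scalerA.
have dfs t : 0 <= t <= 1 -> differentiable (fun x => f (x + s *: w)) (a + t *: (s *: v)).
  move=> t01; apply: (@differentiable_comp _ _ _ _ (fun x => x + s *: w) f).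
    exact: ex_diff.
  exact/df/Uats.
have dG t : 0 <= t <= 1 -> differentiable G (a + t *: (s *: v)).
  by move=> t01; apply: differentiableB; [exact: dfs|exact/df/Uat].
have [t t01 Et] := mean_value dG.
have dDs u : 0 <= u <= 1 -> differentiable ('D_v f) (a + t *: (s *: v) + u *: (s *: w)).
  by move=> u01; apply: dDf; rewrite !scalerA; apply: HU; exact: scl.
have [u u01 Eu] := mean_value dDs.
exists (t * s), (u * s); split; rewrite ?scl//.
rewrite -/(G a) -[X in X - _]/(G (a + s *: v)) Et.
have -> : 'D_(s *: v) G (a + t *: (s *: v)) =
    'D_(s *: v) (f \o (fun x => x + s *: w)) (a + t *: (s *: v)) -
    'D_(s *: v) f (a + t *: (s *: v)).
  apply: deriveB; first exact/diff_derivable/dfs.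
  exact/diff_derivable/df/Uat.
rewrite (derive_comp _ (@ex_diff _ _ _ _ _ _ _ (dsh _)) (df _ (Uats t t01))).
rewrite (deriveE _ (@ex_diff _ _ _ _ _ _ _ (dsh _))) (@diff_val _ _ _ _ _ _ _ (dsh _)).
rewrite (deriveZr _ _ (df _ (Uats t t01))) (deriveZr _ _ (df _ (Uat t t01))).
rewrite -scalerBr Eu (deriveZr _ _ (dDs _ u01)).
by rewrite !scalerA expr2.
Qed.

(** The second difference of f along s v and s w is symmetric in v and w; by
    [second_difference] it is s^2 times a value of either mixed derivative at
    a point near a, and both derivatives are continuous. *)
Lemma derive_comm V (U : set V) (f : V -> R) a v w :
  open U -> U a -> class_C 2 U f -> 'D_v ('D_w f) a = 'D_w ('D_v f) a.
Proof.
move=> oU Ua Cf; have [df CDf] := Cf.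
apply: (@eq_of_close_values V ('D_v ('D_w f)) ('D_w ('D_v f)) a).
- by have [_ /(_ v)] := CDf w; exact.
- by have [_ /(_ w)] := CDf v; exact.
move=> d d0.
have /nbhs_ballP[e /= e0 eU] : nbhs a U by exact: open_nbhs_nbhs.
(* The parallelogram of sides s v and s w lies in the ball of radius m about a. *)
pose m := Num.min d e; pose s := m / 2 / (1 + `|v| + `|w|).
have m0 : 0 < m by rewrite lt_min d0.
have n0 : 0 < 1 + `|v| + `|w| by rewrite ltr_wpDr// ltr_wpDr.
have s0 : 0 < s by rewrite !divr_gt0.
have mb t u : 0 <= t <= s -> 0 <= u <= s -> ball a m (a + t *: v + u *: w).
  move=> /andP[t0 ts] /andP[u0 us].
  rewrite -ball_normE/= -addrA opprD addNKr normrN.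
  apply: (le_lt_trans (ler_normD _ _)); rewrite !normrZ !ger0_norm//.
  apply: (@le_lt_trans _ _ (s * (`|v| + `|w|))).
    by rewrite mulrDr lerD// ler_wpM2r.
  apply: (@lt_trans _ _ (s * (1 + `|v| + `|w|))).
    by rewrite ltr_pM2l// -addrA ltrDr.
  by rewrite divfK ?gt_eqF// ltr_pdivrMr// ltr_pMr// ltr1n.
have mU t u : 0 <= t <= s -> 0 <= u <= s -> U (a + t *: v + u *: w).
  by move=> ts us; apply: eU; apply: le_ball (mb t u ts us); rewrite ge_min lexx orbT.
have [t [u [ts us E1]]] := second_difference Cf (ltW s0) mU.
have [|t' [u' [ts' us' E2]]] := @second_difference V U f a w v s Cf (ltW s0).
  by move=> t' u' ts' us'; rewrite addrAC; exact: mU.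
exists (a + t' *: w + u' *: v), (a + t *: v + u *: w); split.
- by rewrite addrAC; apply: le_ball (mb _ _ us' ts'); rewrite ge_min lexx.
- by apply: le_ball (mb _ _ ts us); rewrite ge_min lexx.
have s20 : s ^+ 2 != 0 by rewrite expf_neq0// gt_eqF.
apply: (mulfI s20); apply: etrans (esym E2) _; apply: etrans _ E1.
rewrite (addrAC a).
by ring.
Qed.

End MeanValue.

(** * Ingredients of the inverse function theorem *)

(** Matrices over R form a complete normed space, as the fixed point theorem
    of [local_surjectivity] requires. *)
HB.instance Definition _ (R : realType) m n := Complete.on 'M[R]_(m, n).

Section InverseFunction.
Context {R : realType}.

Lemma normM_coord m n (A : 'M[R]_(m, n)) i j : `|A i j| <= `|A|.
Proof.
rewrite [leRHS]/Num.Def.normr/= mx_normrE.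
exact: (le_bigmax _ (fun ij : 'I_m * 'I_n => `|A ij.1 ij.2|) (i, j)).
Qed.

Lemma normM_le m n (A : 'M[R]_(m, n)) e :
  0 <= e -> (forall i j, `|A i j| <= e) -> `|A| <= e.
Proof.
move=> e0 Ae; rewrite [leLHS]/Num.Def.normr/= mx_normrE.
by apply: bigmax_le => // -[i j] _; exact: Ae.
Qed.

Lemma continuous_mulmxr m p q (B : 'M[R]_(p, q)) :
  continuous (mulmxr B : 'M[R]_(m, p) -> 'M[R]_(m, q)).
Proof.
move=> A; suff H : class_C 0 setT (mulmxr B : 'M[R]_(m, p) -> 'M[R]_(m, q)).
  exact: H.
apply: class_C_mx => [|i j]; first exact: openT.
apply: (class_C_eq (f := fun A : 'M[R]_(m, p) => \sum_k A i k * B k j)).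
- exact: openT.
- by move=> A' _; rewrite /= mxE.
apply: class_C_sum => [|k _]; first exact: openT.
apply: class_CM; [exact: openT| |exact: class_C_cst].
by move=> A' _; exact: coord_continuous.
Qed.

Lemma class_C_det k (V : normedModType R) (U : set V) n (F : V -> 'M[R]_n) :
  open U -> (forall i j, class_C k U (fun a => F a i j)) ->
  class_C k U (fun a => \det (F a)).
Proof.
move=> oU CF; apply: class_C_sum => // s _; apply: class_CM => //.
  exact: class_C_cst.
by apply: class_C_prod => // i _.
Qed.

Lemma class_C_invmx k (V : normedModType R) (U : set V) n (F : V -> 'M[R]_n) :
  open U -> (forall i j, class_C k U (fun a => F a i j)) ->
  (forall a, U a -> F a \in unitmx) ->
  forall i j, class_C k U (fun a => invmx (F a) i j).
Proof.
move=> oU CF uF i j.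
apply: (class_C_eq (f := fun a => (\det (F a))^-1 * cofactor (F a) j i)) => //.
  by move=> a Ua; rewrite /invmx uF// !mxE.
apply: class_CM => //.
  apply: class_CV; [exact: oU| |exact: class_C_det].
  by move=> a /uF; rewrite unitmxE unitfE.
apply: class_CM => //; first exact: class_C_cst.
apply: class_C_det => // i' j'.
by apply: class_C_eq (CF (lift j i') (lift i j')) => // a _; rewrite !mxE.
Qed.

Lemma jacobianE m n (f : 'rV[R]_m -> 'rV[R]_n) b i j : differentiable f b ->
  jacobian f b i j = ('D_(delta_mx 0 i) f b) 0 j.
Proof. by move=> df; rewrite mxE deriveE. Qed.

Lemma class_C_jacobian k m n (U : set 'rV[R]_m) (f : 'rV[R]_m -> 'rV[R]_n) i j :
  open U -> smooth_on U f -> class_C k U (fun b => jacobian f b i j).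
Proof.
move=> oU Cf; have [df /(_ (delta_mx 0 i)) CDf] := Cf k.+1.
apply: class_C_eq (class_C_coord 0 j oU CDf) => // b Ub.
by rewrite jacobianE//; exact: df.
Qed.

Lemma lipschitz_of_partials m n (f : 'rV[R]_m -> 'rV[R]_n) a r c : 0 <= c ->
  (forall b, ball a r b -> differentiable f b) ->
  (forall b i j, ball a r b -> `|('D_(delta_mx 0 i) f b) 0 j| <= c) ->
  forall u v, ball a r u -> ball a r v -> `|f u - f v| <= m%:R * c * `|u - v|.
Proof.
move=> c0 df Df u v au av; apply: normM_le; first by rewrite !mulr_ge0.
move=> i j; rewrite ord1 !mxE {i}.
have dfj b : ball a r b -> differentiable (fun x => f x 0 j) b.
  move=> ab; apply: (@differentiable_comp _ _ _ _ f (fun y : 'rV[R]_n => y 0 j)).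
    exact: df.
  exact: differentiable_coord.
have [t t01] := @mean_value R _ (fun x => f x 0 j) v (u - v)
  (fun t t01 => dfj _ (ball_segment t01 av au)).
have aw := ball_segment t01 av au.
rewrite (addrC v) subrK => ->.
rewrite -derive_mx_coord; last exact: df.
rewrite (derive_rV _ (df _ aw)) summxE (le_trans (ler_norm_sum _ _ _))//.
rewrite -mulrA mulr_natl -[X in _ *+ X]card_ord -sumr_const.
apply: ler_sum => i _; rewrite mxE normrM mulrC ler_pM//.
  exact: Df.
exact: normM_coord.
Qed.

(** The ball carries the inverse g, while O is the corresponding open set in the
    source; taking a ball on the side of the target makes the new coordinates
    range over a convex set. *)
Definition local_inverse n (f : 'rV[R]_n -> 'rV[R]_n) (O : set 'rV[R]_n) b r g :=
  [/\ forall u, O u -> g (f u) = u, forall u, O u -> ball b r (f u),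
      forall y, ball b r y -> O (g y) /\ f (g y) = y &
      smooth_on (ball b r) g].

(** The Jacobian matrix of u |-> u - f u *m (jacobian f a)^-1 vanishes at a, so
    that its entries are small near a and the map is Lipschitz with a small
    constant. *)
Lemma near_identity n (U : set 'rV[R]_n) (f : 'rV[R]_n -> 'rV[R]_n) a :
  open U -> U a -> smooth_on U f -> jacobian f a \in unitmx ->
  exists2 d : R, 0 < d & [/\ ball a d `<=` U,
    forall u, ball a d u -> jacobian f u \in unitmx &
    forall u v, ball a d u -> ball a d v ->
      `|(u - f u *m invmx (jacobian f a)) -
        (v - f v *m invmx (jacobian f a))| <= 2^-1 * `|u - v|].
Proof.
move=> oU Ua Cf uK; set K := jacobian f a.
pose phi u := u - f u *m invmx K.
have [df CDf] := Cf 1.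
have dphi b : U b -> is_diff b phi (fun v => v - 'd f b v *m invmx K).
  move=> Ub; have dfb := df b Ub.
  have dL : is_diff (f b) (mulmxr (invmx K)) (mulmxr (invmx K)).
    apply: DiffDef; first exact/linear_differentiable/continuous_mulmxr.
    by rewrite diff_lin//; exact: continuous_mulmxr.
  have := is_diffB (is_diff_id b) (is_diff_comp (differentiableP dfb) dL).
  exact.
have dphiE b v : U b -> 'D_v phi b = v - 'D_v f b *m invmx K.
  by move=> Ub; rewrite (derive_is_diff v (dphi b Ub)) (deriveE v (df b Ub)).
(* With partial derivatives at most (2 (n + 1))^-1 the Lipschitz constant is at
   most n / (2 (n + 1)); writing n + 1 covers dimension 0. *)
have near_small (ij : 'I_n * 'I_n) : \forall b \near a,
    `|('D_(delta_mx 0 ij.1) phi b) 0 ij.2| <= (2 * n.+1%:R)^-1.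
  case: ij => i j /=.
  pose q b : R := (delta_mx 0 i - 'D_(delta_mx 0 i) f b *m invmx K : 'rV[R]_n) 0 j.
  have qE b : U b -> 'D_(delta_mx 0 i) phi b 0 j = q b by move=> Ub; rewrite dphiE.
  have c k : class_C k U q.
    have [_ /(_ (delta_mx 0 i)) CDk] := Cf k.+1.
    have cL := class_C_lin_comp oU (@continuous_mulmxr 1 n n (invmx K)) CDk.
    exact: class_C_coord 0 j oU (class_CB oU (class_C_cst k U _) cL).
  have qa : q a = 0.
    by rewrite /q (deriveEjacobian _ (df a Ua)) mulmxK// subrr mxE.
  have e0 : 0 < (2 * n.+1%:R)^-1 :> R by rewrite invr_gt0 mulr_gt0.
  have /cvgrPdist_le/(_ _ e0) := c 0%N a Ua; rewrite qa => H.
  apply: filterS2 (near_open oU Ua) H => b Ub.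
  by rewrite qE// sub0r normrN.
have near_unit : \forall b \near a, jacobian f b \in unitmx.
  pose q b : R := \det (jacobian f b).
  have c k : class_C k U q by apply: class_C_det => // i j; exact: class_C_jacobian.
  have K0 : 0 < `|q a| by rewrite normr_gt0 -unitfE -unitmxE.
  have /cvgrPdist_lt/(_ _ K0) := c 0%N a Ua.
  apply: filterS => b qb; rewrite unitmxE unitfE -/(q b).
  by apply: contraTneq qb => ->; rewrite subr0 ltxx.
have {}near_small := filter_forall (nbhs_filter a) near_small.
have /nbhs_ballP[d /= d0 H] : \forall b \near a, [/\ U b, jacobian f b \in unitmx &
    forall ij : 'I_n * 'I_n,
    `|('D_(delta_mx 0 ij.1) phi b) 0 ij.2| <= (2 * n.+1%:R)^-1].
  by apply: filterS3 (near_open oU Ua) near_unit near_small => b.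
exists d; first exact: d0.
split=> [b /H[Ub _ _]|b /H[_ ub _]|u v au av]; [exact: Ub|exact: ub|].
have c0 : 0 <= (2 * n.+1%:R)^-1 :> R by rewrite invr_ge0 mulr_ge0.
apply: (le_trans (lipschitz_of_partials (f := phi) c0 _ _ au av)).
- by move=> b /H[Ub _ _]; exact: (@ex_diff _ _ _ _ _ _ _ (dphi b Ub)).
- by move=> b i j /H[_ _ sb]; exact: (sb (i, j)).
rewrite ler_wpM2r// invfM mulrCA ler_piMr ?invr_ge0// ler_pdivrMr// mul1r.
by rewrite ler_nat.
Qed.

(** A solution of f u = y is a fixed point of u |-> u - f u *m L + y *m L,
    which contracts a closed ball about a as soon as y is close to f a. *)
Lemma local_surjectivity n (f : 'rV[R]_n -> 'rV[R]_n) (a : 'rV[R]_n)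
    (L : 'M[R]_n) (d : R) : 0 < d -> L \in unitmx ->
  (forall u v, ball a d u -> ball a d v ->
      `|(u - f u *m L) - (v - f v *m L)| <= 2^-1 * `|u - v|) ->
  exists2 r : R, 0 < r &
    forall y, ball (f a) r y -> exists2 u, ball a d u & f u = y.
Proof.
move=> d0 uL cL.
pose d2 := d / 2; have d20 : 0 < d2 by rewrite divr_gt0.
have d2d : d2 < d by rewrite ltr_pdivrMr// ltr_pMr// ltr1n.
have [C C0 HC] := linear_lipschitz (@continuous_mulmxr 1 n n L).
exists (d2 / 2 / C); first by rewrite !divr_gt0.
move=> y; rewrite -ball_normE /= distrC => ya.
pose B := closed_ball_ (fun u => `|u|) a d2.
have BP u : B u = (`|a - u| <= d2) :> Prop by [].
have Bd u : B u -> ball a d u.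
  by rewrite BP -ball_normE/= => au; exact: le_lt_trans d2d.
pose Tm u := u - f u *m L + y *m L.
have TmE u v : Tm u - Tm v = (u - f u *m L) - (v - f v *m L).
  by rewrite /Tm opprD addrACA subrr addr0.
have aB : B a by rewrite BP subrr normr0 ltW.
have Tma : `|a - Tm a| <= d2 / 2.
  have -> : a - Tm a = - ((y - f a) *m L).
    by rewrite /Tm mulmxBl opprB -[a - _ + _]addrA opprD addrA subrr add0r opprD opprK.
  rewrite normrN (le_trans (HC _))// mulrC -ler_pdivlMr//.
  exact: ltW.
have TB : set_fun B B Tm.
  move=> u Bu; rewrite BP -(subrKA (Tm a)) (splitr d2).
  rewrite (le_trans (ler_normD _ _))// lerD// TmE.
  rewrite (le_trans (cL _ _ _ _))//; [exact: Bd|exact: Bd|].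
  by rewrite mulrC ler_wpM2r ?invr_ge0// -BP.
pose F := mkfun_fun TB.
have ctr : is_contraction F.
  exists (2^-1)%:nng; split; first by rewrite /= invf_lt1// ltr1n.
  move=> [u v] [/= Bu Bv]; rewrite /F /mkfun /= TmE.
  by apply: cL; exact: Bd.
have [|u Bu uE] := @banach_fixed_point R 'rV[R]_n B F ctr (@closed_closed_ball_ R _ a d2).
  by exists a.
exists u; first by rewrite (le_lt_trans _ d2d)// -BP.
move: uE; rewrite /F /mkfun /= /Tm => /eqP.
rewrite eq_sym -subr_eq0 => /eqP E.
have {}E : (y - f u) *m L = 0.
  by rewrite mulmxBl -[RHS]E [RHS]addrAC [u - _]addrC addrK [RHS]addrC.
apply/esym/eqP; rewrite -subr_eq0; apply/eqP.
by rewrite -[LHS](mulmxK uL) E mul0mx.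
Qed.

End InverseFunction.

(** * The inverse function theorem *)

Section InverseFunctionTheorem.
Context {R : realType}.

Lemma open_preimage (T : topologicalType) (V : topologicalType) (A : set T)
    (B : set V) (f : T -> V) :
  open A -> open B -> (forall a, A a -> {for a, continuous f}) ->
  open (A `&` f @^-1` B).
Proof.
move=> oA oB cf; rewrite openE => a [Aa Ba]; apply: filterI.
  exact: near_open.
by apply: cf => //; exact: open_nbhs_nbhs.
Qed.

(** A Lipschitz right inverse of a differentiable map is differentiable: with
    h = g (k + y) - g y, the error of the first order expansion of f at g y is
    small compared to h, hence to k. *)
Lemma differentiable_inverse n (f g : 'rV[R]_n -> 'rV[R]_n) (b : 'rV[R]_n) r C y :
  0 < C -> ball b r y ->
  (forall z z', ball b r z -> ball b r z' -> `|g z - g z'| <= C * `|z - z'|) ->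
  (forall z, ball b r z -> f (g z) = z) ->
  differentiable f (g y) -> jacobian f (g y) \in unitmx ->
  is_diff y g (mulmxr (invmx (jacobian f (g y)))).
Proof.
move=> C0 yb Lg fg df uJ; set A := jacobian f (g y).
have cA := @continuous_mulmxr R 1 n n (invmx A).
have [C' C'0 HC'] := linear_lipschitz cA.
suff [dg dgE] : differentiable g y /\ 'd g y = mulmxr (invmx A) :> ('rV[R]_n -> 'rV[R]_n).
  exact: DiffDef.
apply: differentiable_eps => // e e0.
pose e' := e / C' / C; have e'0 : 0 < e' by rewrite !divr_gt0.
have /nbhs_ballP[d /= d0 Hd] := differentiable_epsE df e'0.
have near_y : \forall k \near (0 : 'rV[R]_n), ball b r (k + y).
  have := near_open (ball_open b r) yb; rewrite (near_shift 0 y) subr0.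
  by apply: filterS => k.
have near_d : \forall k \near (0 : 'rV[R]_n), `|k| < d / C.
  apply/nbhs_ballP; exists (d / C); first by rewrite /= divr_gt0.
  by move=> k; rewrite -ball_normE /= sub0r normrN.
apply: filterS2 near_y near_d => k kb kd.
pose h := g (k + y) - g y.
have hk : `|h| <= C * `|k| by rewrite /h -[k in leRHS](addrK y); exact: Lg.
have hd : `|h| < d by rewrite (le_lt_trans hk)// mulrC -ltr_pdivlMr.
have /Hd : ball 0 d h by rewrite -ball_normE /= sub0r normrN.
rewrite /= /h subrK !fg//= opprD addrA addrK.
have -> : 'd f (g y) (g (k + y) - g y) = h *m A by rewrite mul_rV_lin1.
move=> E.
have -> : g (k + y) - (g y + k *m invmx A) = - ((k - h *m A) *m invmx A).
  by rewrite mulmxBl mulmxK// opprB opprD addrA.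
rewrite normrN (le_trans (HC' _))//= (le_trans (ler_wpM2l (ltW C'0) E))//.
rewrite (le_trans (ler_wpM2l (ltW C'0) (ler_wpM2l (ltW e'0) hk)))//.
by rewrite /e' le_eqVlt; apply/orP; left; apply/eqP; field; rewrite !gt_eqF.
Qed.

(** The inverse is Lipschitz by [near_identity], hence differentiable, and its
    derivative at y is the inverse of the Jacobian matrix of f at g y: if g is
    of class C^k, so is its derivative. *)
Theorem inverse_function n (U : set 'rV[R]_n) (f : 'rV[R]_n -> 'rV[R]_n) a :
  open U -> U a -> smooth_on U f -> jacobian f a \in unitmx ->
  exists (O : set 'rV[R]_n) (r : R) (g : 'rV[R]_n -> 'rV[R]_n),
    [/\ open O, O a, O `<=` U, 0 < r & local_inverse f O (f a) r g].
Proof.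
move=> oU Ua Cf uK; have [df _] := Cf 1.
have [d d0 [dU uJ cL]] := near_identity oU Ua Cf uK.
set L := invmx (jacobian f a) in cL.
have uL : L \in unitmx by rewrite unitmx_inv.
have [r r0 Hr] := local_surjectivity d0 uL cL.
have [C C0 HC] := linear_lipschitz (@continuous_mulmxr R 1 n n L).
pose g y := xget a [set u | ball a d u /\ f u = y].
have gP y : ball (f a) r y -> ball a d (g y) /\ f (g y) = y.
  move=> /Hr[u au fu]; rewrite /g; case: xgetP => [v _ //|/(_ u)[]//].
have Lg u v : ball a d u -> ball a d v -> `|u - v| <= 2 * C * `|f u - f v|.
  move=> au av; have cuv := cL u v au av.
  have E : u - v = (u - f u *m L - (v - f v *m L)) + (f u - f v) *m L.
    by rewrite mulmxBl addrAC subrKA opprB subrKA.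
  have := ler_normD (u - f u *m L - (v - f v *m L)) ((f u - f v) *m L).
  rewrite -E => Huv; have Cuv := HC (f u - f v); move: cuv Huv Cuv => /=.
  move: `|u - v| `|f u - f v| `|_ *m _| `|_ - (v - _)| => p q s t.
  by move=> *; lra.
have finj u v : ball a d u -> ball a d v -> f u = f v -> u = v.
  move=> au av fuv; have := Lg u v au av; rewrite fuv subrr normr0 mulr0.
  by rewrite normr_le0 subr_eq0 => /eqP.
exists (ball a d `&` f @^-1` ball (f a) r), r, g.
have aa : ball a d a by exact: ballxx.
split=> //.
- apply: open_preimage; [exact: ball_open|exact: ball_open|].
  by move=> u /dU /df; exact: differentiable_continuous.
- by split=> //; exact: ballxx.
- by move=> u [/dU].
split.
- move=> u [au fu]; have [ag fg] := gP _ fu; exact: finj.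
- by move=> u [].
- by move=> y yb; have [ag fg] := gP _ yb; split=> //; split=> //=; rewrite fg.
have dg y : ball (f a) r y -> is_diff y g (mulmxr (invmx (jacobian f (g y)))).
  move=> yb; have [ag _] := gP _ yb.
  have C20 : 0 < 2 * C by rewrite mulr_gt0.
  have Lg' z z' : ball (f a) r z -> ball (f a) r z' -> `|g z - g z'| <= 2 * C * `|z - z'|.
    move=> zb zb'; have [az fz] := gP _ zb; have [az' fz'] := gP _ zb'.
    by have := Lg _ _ az az'; rewrite fz fz'.
  have fg' z : ball (f a) r z -> f (g z) = z by move=> /gP[].
  exact: (differentiable_inverse C20 yb Lg' fg' (df _ (dU _ ag)) (uJ _ ag)).
have oB : open (ball (f a) r) by exact: ball_open.
elim=> [|k IH].
  move=> y yb; apply: differentiable_continuous.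
  exact: (@ex_diff _ _ _ _ _ _ _ (dg y yb)).
split=> [y yb|v]; first exact: (@ex_diff _ _ _ _ _ _ _ (dg y yb)).
apply: (class_C_eq (f := fun y => v *m invmx (jacobian f (g y)))) => //.
  by move=> y yb; rewrite (derive_is_diff v (dg y yb)).
apply: class_C_mx => // i j.
apply: (class_C_eq (f := fun y => \sum_k v i k * invmx (jacobian f (g y)) k j)) => //.
  by move=> y _; rewrite mxE.
apply: class_C_sum => // l _; apply: class_CM => //; first exact: class_C_cst.
have CJ i' j' : class_C k (ball (f a) r) (fun y => jacobian f (g y) i' j').
  apply: (class_C_comp_rV oB _ IH (class_C_jacobian k i' j' oU Cf)).
  by move=> y /gP[/dU].
have uJg y : ball (f a) r y -> jacobian f (g y) \in unitmx by move=> /gP[/uJ].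
exact: (class_C_invmx oB CJ uJg).
Qed.

End InverseFunctionTheorem.

(** * Moving frames and their structure equations *)

(* Inner products and derivatives are handled from now on through their laws
   only, never through their definitions. *)
#[local] Opaque derive.

Section Dot.
Context {R : realType}.
Implicit Types u v w : 'rV[R]_5.

Lemma dotC u v : dot u v = dot v u.
Proof. by apply: eq_bigr => i _; rewrite mulrC. Qed.
Lemma dotDl u v w : dot (u + v) w = dot u w + dot v w.
Proof. by rewrite -big_split; apply: eq_bigr => i _; rewrite mxE mulrDl. Qed.
Lemma dotZl (a : R) u w : dot (a *: u) w = a * dot u w.
Proof. by rewrite /dot mulr_sumr; apply: eq_bigr => i _; rewrite mxE mulrA. Qed.
Lemma dotNl u w : dot (- u) w = - dot u w.
Proof. by rewrite -scaleN1r dotZl mulN1r. Qed.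
Lemma dotBl u v w : dot (u - v) w = dot u w - dot v w.
Proof. by rewrite dotDl dotNl. Qed.
Lemma dotDr u v w : dot w (u + v) = dot w u + dot w v.
Proof. by rewrite !(dotC w) dotDl. Qed.
Lemma dotZr (a : R) u w : dot w (a *: u) = a * dot w u.
Proof. by rewrite !(dotC w) dotZl. Qed.
Lemma dotNr u w : dot w (- u) = - dot w u.
Proof. by rewrite !(dotC w) dotNl. Qed.
Lemma dotBr u v w : dot w (u - v) = dot w u - dot w v.
Proof. by rewrite dotDr dotNr. Qed.
Lemma dot0l u : dot 0 u = 0.
Proof. by rewrite /dot big1// => i _; rewrite mxE mul0r. Qed.
Lemma dot0r u : dot u 0 = 0.
Proof. by rewrite dotC dot0l. Qed.
Lemma dotE u v : dot u v = (u *m v^T) 0 0.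
Proof. by rewrite mxE; apply: eq_bigr => i _; rewrite mxE. Qed.
Lemma dot_mulmx u v (A : 'M[R]_5) : dot (u *m A) v = dot u (v *m A^T).
Proof. by rewrite !dotE trmx_mul trmxK mulmxA. Qed.
Lemma dot_d_x5 u : dot u d_x5 = u 0 ord_max.
Proof.
rewrite /dot (bigD1 ord_max)//= mxE !eqxx mulr1 big1 ?addr0// => i /negbTE io.
by rewrite mxE eqxx io mulr0.
Qed.
Lemma dot_ge0 u : 0 <= dot u u.
Proof. by apply: sumr_ge0 => i _; rewrite -expr2 sqr_ge0. Qed.
Lemma dot_eq0 u : (dot u u == 0) = (u == 0).
Proof.
apply/idP/idP => [|/eqP->]; last by rewrite dot0l.
rewrite psumr_eq0 => [/allP u0|i _]; last by rewrite -expr2 sqr_ge0.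
apply/eqP/rowP => i; rewrite mxE; apply/eqP.
by have := u0 i (mem_index_enum i); rewrite /= mulf_eq0 orbb.
Qed.

Lemma dotS u v : dot u v = \sum_i u 0 i * v 0 i.
Proof. by []. Qed.

Definition dot_lin := (dotDl, dotDr, dotNl, dotNr, dotZl, dotZr, dot0l, dot0r).

Definition orthonormal_family (F : 'I_5 -> 'rV[R]_5) :=
  forall i j, dot (F i) (F j) = (i == j)%:R.

Lemma orthonormal_expansion F u : orthonormal_family F ->
  u = \sum_k dot u (F k) *: F k.
Proof.
move=> onF; pose A : 'M[R]_5 := \matrix_k F k.
have AAT : A *m A^T = 1%:M.
  apply/matrixP => i j; rewrite !mxE -onF.
  by apply: eq_bigr => k _; rewrite !mxE.
have ATA := mulmx1C AAT.
rewrite -[LHS]mulmx1 -ATA mulmxA mulmx_sum_row.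
apply: eq_bigr => k _; rewrite rowK; congr (_ *: _).
by rewrite mxE; apply: eq_bigr => l _; rewrite !mxE.
Qed.

Lemma parseval F u v : orthonormal_family F ->
  dot u v = \sum_k dot u (F k) * dot v (F k).
Proof.
move=> onF; rewrite {1}(orthonormal_expansion u onF).
rewrite (big_morph (fun w => dot w v) (fun x y => dotDl x y v) (dot0l v)).
by apply: eq_bigr => k _; rewrite dotZl (dotC v).
Qed.

End Dot.

#[local] Opaque dot.

Section DotCalculus.
Context {R : realType}.

Lemma class_C_dot k (V : normedModType R) (U : set V) (F G : V -> 'rV[R]_5) : open U ->
  class_C k U F -> class_C k U G -> class_C k U (fun a => dot (F a) (G a)).
Proof.
move=> oU CF CG; under eq_fun do rewrite dotS; apply: class_C_sum => // i _.
by apply: class_CM => //; exact: class_C_coord.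
Qed.

Lemma differentiable_class_C (V W : normedModType R) (U : set V) (f : V -> W) a :
  U a -> smooth_on U f -> differentiable f a.
Proof. by move=> Ua Cf; have [df _] := Cf 1; exact: df. Qed.

Lemma smooth_derive (V W : normedModType R) (U : set V) (f : V -> W) v :
  smooth_on U f -> smooth_on U ('D_v f).
Proof. by move=> Cf k; have [_ CDf] := Cf k.+1; exact: CDf. Qed.

Lemma derive_dot (V : normedModType R) (F G : V -> 'rV[R]_5) a v :
  differentiable F a -> differentiable G a ->
  'D_v (fun b => dot (F b) (G b)) a = dot ('D_v F a) (G a) + dot (F a) ('D_v G a).
Proof.
move=> dF dG.
have dc (H : V -> 'rV[R]_5) i : differentiable H a -> derivable (fun b => H b 0 i) a v.
  move=> dH; apply: diff_derivable.
  apply: (@differentiable_comp _ _ _ _ H (fun y : 'rV[R]_5 => y 0 i)) => //.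
  exact: differentiable_coord.
have -> : (fun b => dot (F b) (G b)) =
    \sum_(i < 5) ((fun b => F b 0 i) * (fun b => G b 0 i)).
  by apply/funext => b; rewrite fct_sumE dotS.
rewrite derive_sum => [|i]; last by apply: derivableM; exact: dc.
rewrite !dotS -big_split; apply: eq_bigr => i _ /=.
rewrite deriveM; [|exact: dc|exact: dc].
by rewrite !derive_mx_coord// addrC; congr (_ + _); rewrite mulrC.
Qed.

Lemma derive_comm_rV (V : normedModType R) n (U : set V) (F : V -> 'rV[R]_n) u v w :
  open U -> U u -> smooth_on U F -> 'D_v ('D_w F) u = 'D_w ('D_v F) u.
Proof.
move=> oU Uu CF; apply/rowP => l.
have dF b : U b -> differentiable F b by move=> Ub; exact: differentiable_class_C CF.
have dDF x : differentiable ('D_x F) u.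
  exact: (differentiable_class_C Uu (smooth_derive x CF)).
have E x y : 'D_x ('D_y F) u 0 l = 'D_x ('D_y (fun b => F b 0 l)) u.
  rewrite derive_mx_coord//; apply: near_eq_derive.
  by apply: filterS (near_open oU Uu) => b /dF Fb; rewrite derive_mx_coord.
apply: etrans (E v w) _; apply: etrans _ (esym (E w v)).
exact: (derive_comm v w oU Uu (class_C_coord 0 l oU (CF 2))).
Qed.

End DotCalculus.

(** The connection form omega_ij of a moving frame, evaluated at the tangent
    vector v at u.  It is locked because an argument of this kind never needs
    to see the derivative inside, only the relations between the forms. *)
HB.lock Definition connection (R : realType) (V : normedModType R)
    (F : 'I_5 -> V -> 'rV[R]_5) (i j : 'I_5) (v u : V) : R :=
  dot ('D_v (F i) u) (F j u).

Section StructureEquations.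
Context {R : realType} {V : normedModType R}.

Definition frame_on (U : set V) (F : 'I_5 -> V -> 'rV[R]_5) :=
  (forall i, smooth_on U (F i)) /\
  (forall u, U u -> orthonormal_family (F ^~ u)).

Lemma connectionE (F : 'I_5 -> V -> 'rV[R]_5) i j v u :
  connection F i j v u = dot ('D_v (F i) u) (F j u).
Proof. by rewrite connection.unlock. Qed.

Lemma derive_const_on (W : normedModType R) (U : set V) (f : V -> W) c u v :
  open U -> U u -> (forall a, U a -> f a = c) -> 'D_v f u = 0.
Proof.
move=> oU Uu fc; rewrite -(derive_cst c u v); apply: near_eq_derive.
by apply: filterS (near_open oU Uu) => a /fc.
Qed.

(** The inner products of the vectors of the frame are constant. *)
Lemma connection_antisym U F : open U -> frame_on U F ->
  forall i j v u, U u -> connection F i j v u = - connection F j i v u.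
Proof.
move=> oU [CF onF] i j v u Uu.
have d l : differentiable (F l) u by exact: (differentiable_class_C Uu (CF l)).
have E := @derive_const_on _ U (fun a => dot (F i a) (F j a)) (i == j)%:R u v oU Uu
  (fun a Ua => onF a Ua i j).
have {}E := etrans (esym (derive_dot v (d i) (d j))) E.
rewrite !connectionE; apply/eqP; rewrite -addr_eq0; apply/eqP.
by apply: etrans E; congr (_ + _); exact: dotC.
Qed.

Lemma smooth_connection U F i j v : open U -> frame_on U F ->
  smooth_on U (connection F i j v).
Proof.
move=> oU [CF onF] k.
apply: class_C_eq (class_C_dot oU (smooth_derive v (CF i) k) (CF j k)) => // u _.
by rewrite connectionE.
Qed.

(** Cartan's structure equation d omega_ij = sum_k omega_ik /\ omega_kj, on a
    pair of constant vector fields v, w: the second derivatives of F i cancel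
    by symmetry, and the rest is expanded in the frame. *)
Lemma structure_equation U F : open U -> frame_on U F ->
  forall i j v w u, U u ->
  'D_v (connection F i j w) u - 'D_w (connection F i j v) u =
  \sum_k (connection F i k w u * connection F j k v u -
          connection F i k v u * connection F j k w u).
Proof.
move=> oU [CF onF] i j v w u Uu.
have d l : differentiable (F l) u by exact: (differentiable_class_C Uu (CF l)).
have dd l x : differentiable ('D_x (F l)) u.
  exact: (differentiable_class_C Uu (smooth_derive x (CF l))).
have A x y : 'D_x (connection F i j y) u =
    dot ('D_x ('D_y (F i)) u) (F j u) + dot ('D_y (F i) u) ('D_x (F j) u).
  apply: etrans _ (derive_dot x (dd i y) (d j)); congr ('D_x _ u).
  by apply/funext => b; rewrite connectionE.
have P x y := parseval ('D_x (F i) u) ('D_y (F j) u) (onF u Uu).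
have S : \sum_k (connection F i k w u * connection F j k v u -
      connection F i k v u * connection F j k w u) =
    dot ('D_w (F i) u) ('D_v (F j) u) - dot ('D_v (F i) u) ('D_w (F j) u).
  by rewrite sumrB; congr (_ - _); apply: etrans _ (esym (P _ _));
     apply: eq_bigr => k _; rewrite !connectionE.
apply: etrans (congr2 (fun x y : R => x - y) (A v w) (A w v)) _.
apply: etrans _ (esym S); have C := derive_comm_rV v w oU Uu (CF i).
apply: etrans (congr1 (fun x => dot x (F j u) + _ - _) C) _.
by rewrite opprD addrACA subrr add0r.
Qed.

End StructureEquations.

Section Cartan.
Context {R : realType} {V : normedModType R}.

Definition o1 : 'I_5 := @Ordinal 5 1 isT.
Definition o2 : 'I_5 := @Ordinal 5 2 isT.
Definition o3 : 'I_5 := @Ordinal 5 3 isT.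

Lemma sum5 (G : 'I_5 -> R) :
  \sum_k G k = G ord0 + G o1 + G o2 + G o3 + G ord_max.
Proof.
rewrite !big_ord_recr big_ord0 /= add0r.
by congr (G _ + G _ + G _ + G _ + G _); apply: val_inj.
Qed.

Lemma codazzi_algebra (a b a_v a_w r_v r_w P_v P_w Q_v Q_w f_v f_w Pvw Pwv Tvw Twv : R) :
  Pvw - Pwv = a * (r_w * P_v - r_v * P_w) + (Q_w * f_v - Q_v * f_w) ->
  Tvw - Twv = r_w * P_v - r_v * P_w - b * (Q_w * f_v - Q_v * f_w) ->
  Tvw = - (a_v * P_w + a * Pvw) -> Twv = - (a_w * P_v + a * Pwv) ->
  a_w * P_v - a_v * P_w = (1 + a ^+ 2) * (r_w * P_v - r_v * P_w) +
    (a - b) * (Q_w * f_v - Q_v * f_w).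
Proof.
move=> E0 E1 Ev Ew; have := congr1 (fun z => a * z) E0.
by move: E1; rewrite Ev Ew /= => E1 E0a; lra.
Qed.

(** Since omega_1p = - a omega_0p, one has
    d omega_1p + a d omega_0p = - da /\ omega_0p, and the structure equations
    express the left side by products of connection forms.  The
    indices p and q stand for 2 and 3 in either order, which yields the
    Codazzi equations of both principal curvatures. *)
Lemma codazzi_form (U : set V) F (a b : V -> R) (p q : 'I_5) :
  open U -> frame_on U F -> smooth_on U a ->
  (forall u, U u -> F ord_max u = d_x5) ->
  (forall G : 'I_5 -> R, \sum_k G k = G ord0 + G o1 + G p + G q + G ord_max) ->
  (forall u v, U u -> connection F o1 p v u = - a u * connection F ord0 p v u) ->
  (forall u v, U u -> connection F o1 q v u = - b u * connection F ord0 q v u) ->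
  forall u v w, U u ->
    'D_w a u * connection F ord0 p v u - 'D_v a u * connection F ord0 p w u =
    (1 + a u ^+ 2) * (connection F ord0 o1 w u * connection F ord0 p v u -
                      connection F ord0 o1 v u * connection F ord0 p w u) +
    (a u - b u) * (connection F ord0 q w u * connection F p q v u -
                   connection F ord0 q v u * connection F p q w u).
Proof.
move=> oU frF Ca F4 S5 Hp Hq u v w Uu.
have anti := connection_antisym oU frF.
have c0 i x : connection F i i x u = 0.
  by have := anti i i x u Uu; move: (connection _ _ _ _ _) => c; lra.
have c4 i x : connection F i ord_max x u = 0.
  rewrite anti// connectionE (@derive_const_on _ _ _ U _ d_x5)// dot0l.
  exact: oppr0.
have dc i j x : differentiable (connection F i j x) u.
  exact: (differentiable_class_C Uu (smooth_connection i j x oU frF)).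
have dp x y : 'D_x (connection F o1 p y) u =
    - ('D_x a u * connection F ord0 p y u + a u * 'D_x (connection F ord0 p y) u).
  have da : differentiable a u by exact: differentiable_class_C Ca.
  have E : 'D_x (connection F o1 p y) u = 'D_x (- (a * connection F ord0 p y)) u.
    apply: near_eq_derive; apply: filterS (near_open oU Uu) => z /Hp -> .
    by rewrite mulNr.
  apply: etrans E _.
  rewrite deriveN; last by apply/diff_derivable/differentiableM.
  rewrite deriveM; [|exact: diff_derivable|exact: diff_derivable].
  by rewrite addrC [_ *: 'D_x a u]mulrC.
have E0 := structure_equation oU frF ord0 p v w Uu.
have E1 := structure_equation oU frF o1 p v w Uu.
have {}E0 := etrans E0 (S5 _); have {}E1 := etrans E1 (S5 _).
apply: (codazzi_algebra _ _ (dp v w) (dp w v)).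
  apply: etrans E0 _.
  rewrite !(c0, c4) !(anti p o1 _ _ Uu) !(Hp _ _ Uu).
  move: (connection F p q v u) (connection F p q w u) (connection F ord0 o1 v u)
    (connection F ord0 o1 w u) (connection F ord0 p v u) (connection F ord0 p w u)
    (connection F ord0 q v u) (connection F ord0 q w u) (a u) => *; ring.
apply: etrans E1 _.
rewrite !(c0, c4) !(anti p ord0 _ _ Uu) !(anti o1 ord0 _ _ Uu) !(Hp _ _ Uu) !(Hq _ _ Uu).
move: (connection F p q v u) (connection F p q w u) (connection F ord0 o1 v u)
  (connection F ord0 o1 w u) (connection F ord0 p v u) (connection F ord0 p w u)
  (connection F ord0 q v u) (connection F ord0 q w u) (a u) (b u) => *; ring.
Qed.

End Cartan.

(** * Vanishing of the connection form of the two principal directions *)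

Section CartanIdentity.
Context {R : realType} {V : normedModType R}.

(** The letters l, m, r, P, Q, f, g with a suffix are the values at t, e2 or e3
    of dl, dm, omega_01, omega_02, omega_03, omega_23 and omega_32.  Each
    Codazzi equation reduces to the product of l - m, of P2 or Q3, and of one
    value of omega_23. *)
Lemma cartan_algebra (l m lt l2 l3 m2 m3 rt r2 r3 Pt P2 P3 Qt Q2 Q3 ft f2 f3 g2 g3 : R) :
  l != m -> P2 != 0 -> Q3 != 0 -> r2 = 0 -> r3 = 0 ->
  l2 = 0 -> l3 = 0 -> m2 = 0 -> m3 = 0 -> Pt = 0 -> P3 = 0 -> Qt = 0 -> Q2 = 0 ->
  g2 = - f2 -> g3 = - f3 ->
  l3 * P2 - l2 * P3 =
    (1 + l ^+ 2) * (r3 * P2 - r2 * P3) + (l - m) * (Q3 * f2 - Q2 * f3) ->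
  m3 * Q2 - m2 * Q3 =
    (1 + m ^+ 2) * (r3 * Q2 - r2 * Q3) + (m - l) * (P3 * g2 - P2 * g3) ->
  l3 * Pt - lt * P3 =
    (1 + l ^+ 2) * (r3 * Pt - rt * P3) + (l - m) * (Q3 * ft - Qt * f3) ->
  [/\ ft = 0, f2 = 0 & f3 = 0].
Proof.
move=> lm P0 Q0 -> -> -> -> -> -> -> -> -> -> -> -> E1 E2 E3.
have lm0 : l - m != 0 by rewrite subr_eq0.
split.
- by apply: (mulfI (mulf_neq0 lm0 Q0)); rewrite mulr0; lra.
- by apply: (mulfI (mulf_neq0 lm0 Q0)); rewrite mulr0; lra.
- by apply: (mulfI (mulf_neq0 lm0 P0)); rewrite mulr0; lra.
Qed.

Lemma cartan_algebra_derivative (l m lv l2 rv r2 Pv P2 Qv Q2 fv f2 : R) :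
  P2 != 0 -> l2 = 0 -> r2 = 0 -> fv = 0 -> f2 = 0 ->
  l2 * Pv - lv * P2 =
    (1 + l ^+ 2) * (r2 * Pv - rv * P2) + (l - m) * (Q2 * fv - Qv * f2) ->
  lv = (1 + l ^+ 2) * rv.
Proof. by move=> P0 -> -> -> -> E; apply: (mulIf P0); lra. Qed.

(** With omega_23 = 0 the structure equation of omega_23 reads
    0 = (1 + l m) omega_02 /\ omega_03. *)
Lemma gauss_algebra (l m P2 P3 Q2 Q3 : R) : P2 != 0 -> Q3 != 0 -> P3 = 0 -> Q2 = 0 ->
  0 = - P3 * - Q2 - - P2 * - Q3 +
    (- (- l * P3) * - (- m * Q2) - - (- l * P2) * - (- m * Q3)) ->
  l * m = -1.
Proof. by move=> P0 Q0 -> -> E; apply: (mulIf (mulf_neq0 P0 Q0)); lra. Qed.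

Lemma dot_lincomb (a b c : R) (x y z w : 'rV[R]_5) :
  dot (a *: x + b *: y + c *: z) w = a * dot x w + b * dot y w + c * dot z w.
Proof. by rewrite !dot_lin. Qed.

Lemma connection_linear (U : set V) F i j (a b c : R) (t v w u : V) :
  frame_on U F -> U u ->
  connection F i j (a *: t + b *: v + c *: w) u =
  a * connection F i j t u + b * connection F i j v u + c * connection F i j w u.
Proof.
move=> [CF _] Uu.
have dF : differentiable (F i) u by exact: (differentiable_class_C Uu (CF i)).
have E : 'D_(a *: t + b *: v + c *: w) (F i) u =
    a *: 'D_t (F i) u + b *: 'D_v (F i) u + c *: 'D_w (F i) u.
  by rewrite !(deriveE _ dF) !linearD !linearZ.
rewrite !connectionE.
exact: etrans (congr1 (fun X => dot X (F j u)) E) (dot_lincomb _ _ _ _ _ _ _).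
Qed.

(** The forms dl, dm and omega_01 are multiples of dh, which vanishes on e2 and
    e3, and omega_02 and omega_03 are diagonal on the basis.  Hence the Codazzi
    equations on the pairs (e2, e3) and (t, e3) leave only the terms with
    omega_23, which therefore vanishes; those on the pairs (v, e2) and (v, e3)
    then give dl and dm. *)
Lemma cartan_identity (U : set V) F (l m : V -> R) (dh : V -> V -> R) :
  open U -> frame_on U F -> smooth_on U l -> smooth_on U m ->
  (forall u, U u -> F ord_max u = d_x5) ->
  (forall u, U u -> l u != m u) ->
  (forall u v, U u -> connection F o1 o2 v u = - l u * connection F ord0 o2 v u) ->
  (forall u v, U u -> connection F o1 o3 v u = - m u * connection F ord0 o3 v u) ->
  (forall u, U u -> exists r, forall v, connection F ord0 o1 v u = r * dh u v) ->
  (forall u, U u -> exists r, forall v, 'D_v l u = r * dh u v) ->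
  (forall u, U u -> exists r, forall v, 'D_v m u = r * dh u v) ->
  (forall u, U u -> exists t e2 e3,
    [/\ dh u e2 = 0 /\ dh u e3 = 0,
        connection F ord0 o2 t u = 0 /\ connection F ord0 o2 e3 u = 0,
        connection F ord0 o3 t u = 0 /\ connection F ord0 o3 e2 u = 0,
        connection F ord0 o2 e2 u != 0 /\ connection F ord0 o3 e3 u != 0 &
        forall v, exists a b c, v = a *: t + b *: e2 + c *: e3]) ->
  forall u, U u ->
    [/\ forall v, connection F o2 o3 v u = 0,
        forall v, 'D_v l u = (1 + l u ^+ 2) * connection F ord0 o1 v u,
        forall v, 'D_v m u = (1 + m u ^+ 2) * connection F ord0 o1 v u &
        l u * m u = -1].
Proof.
move=> oU frF Cl Cm F4 lm H2 H3 Hr Hl Hm Hb.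
have S23 (G : 'I_5 -> R) : \sum_k G k = G ord0 + G o1 + G o2 + G o3 + G ord_max.
  exact: sum5.
have S32 (G : 'I_5 -> R) : \sum_k G k = G ord0 + G o1 + G o3 + G o2 + G ord_max.
  by rewrite sum5 (addrAC (G ord0 + G o1)).
have E2 := codazzi_form oU frF Cl F4 S23 H2 H3.
have E3 := codazzi_form oU frF Cm F4 S32 H3 H2.
have anti := connection_antisym oU frF.
have [CF _] := frF.
have phi0 u v : U u -> connection F o2 o3 v u = 0.
  move=> Uu; have [t [e2 [e3 [[h2 h3] [w2t w23] [w3t w32] [w22 w33] span]]]] := Hb u Uu.
  have [r rE] := Hr u Uu; have [l' lE] := Hl u Uu; have [m' mE] := Hm u Uu.
  have r2 : connection F ord0 o1 e2 u = 0 by rewrite rE h2 mulr0.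
  have r3 : connection F ord0 o1 e3 u = 0 by rewrite rE h3 mulr0.
  have l2 : 'D_e2 l u = 0 by apply: etrans (lE e2) _; rewrite h2 mulr0.
  have l3 : 'D_e3 l u = 0 by apply: etrans (lE e3) _; rewrite h3 mulr0.
  have m2 : 'D_e2 m u = 0 by apply: etrans (mE e2) _; rewrite h2 mulr0.
  have m3 : 'D_e3 m u = 0 by apply: etrans (mE e3) _; rewrite h3 mulr0.
  have [ft f2 f3] := cartan_algebra (lm u Uu) w22 w33 r2 r3 l2 l3 m2 m3 w2t w23 w3t w32
    (anti o3 o2 e2 u Uu) (anti o3 o2 e3 u Uu)
    (E2 u e2 e3 Uu) (E3 u e2 e3 Uu) (E2 u t e3 Uu).
  have [a [b [c ->]]] := span v.
  by rewrite (connection_linear _ _ _ _ _ _ _ _ frF Uu) ft f2 f3 !mulr0 !addr0.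
move=> u Uu; have [t [e2 [e3 [[h2 h3] [w2t w23] [w3t w32] [w22 w33] span]]]] := Hb u Uu.
have [r rE] := Hr u Uu; have [l' lE] := Hl u Uu; have [m' mE] := Hm u Uu.
have r2 : connection F ord0 o1 e2 u = 0 by rewrite rE h2 mulr0.
have r3 : connection F ord0 o1 e3 u = 0 by rewrite rE h3 mulr0.
have l2 : 'D_e2 l u = 0 by apply: etrans (lE e2) _; rewrite h2 mulr0.
have m3 : 'D_e3 m u = 0 by apply: etrans (mE e3) _; rewrite h3 mulr0.
have phi0' v : connection F o3 o2 v u = 0 by rewrite anti// phi0// oppr0.
split=> [v|v|v|]; first exact: phi0.
- exact: (cartan_algebra_derivative w22 l2 r2 (phi0 u v Uu) (phi0 u e2 Uu) (E2 u v e2 Uu)).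
- exact: (cartan_algebra_derivative w33 m3 r3 (phi0' v) (phi0' e3) (E3 u v e3 Uu)).
have D0 x y : 'D_x (connection F o2 o3 y) u = 0.
  by apply: (derive_const_on _ oU Uu) => a; exact: phi0.
have S := structure_equation oU frF o2 o3 e2 e3 Uu.
have {}S := etrans (esym (congr2 (fun x y : R => x - y) (D0 e2 e3) (D0 e3 e2))) S.
have c4 i x : connection F i ord_max x u = 0.
  rewrite anti// connectionE (@derive_const_on _ _ _ U _ d_x5)// dot0l.
  exact: oppr0.
apply: (gauss_algebra w22 w33 w23 w32).
rewrite -[LHS](subrr 0); apply: etrans S _; apply: etrans (sum5 _) _.
rewrite !(anti o2 ord0 _ u Uu) !(anti o3 ord0 _ u Uu) !(anti o2 o1 _ u Uu)
  !(anti o3 o1 _ u Uu) !(H2 u _ Uu) !(H3 u _ Uu) !c4 !phi0' !(phi0 u _ Uu).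
by rewrite !(mulr0, mul0r) !subrr !addr0.
Qed.

End CartanIdentity.

(** * The rotated frame *)

Section Rotation.
Context {R : realType} {V : normedModType R}.

Lemma all5 (P : 'I_5 -> Prop) :
  P ord0 -> P o1 -> P o2 -> P o3 -> P ord_max -> forall i, P i.
Proof.
move=> P0 P1 P2 P3 P4 [[|[|[|[|[|//]]]]] i].
- by rewrite (_ : Ordinal i = ord0)//; apply: val_inj.
- by rewrite (_ : Ordinal i = o1)//; apply: val_inj.
- by rewrite (_ : Ordinal i = o2)//; apply: val_inj.
- by rewrite (_ : Ordinal i = o3)//; apply: val_inj.
- by rewrite (_ : Ordinal i = ord_max)//; apply: val_inj.
Qed.

(** The frame is rotated in the plane of its first two vectors and reordered,
    so that the vectors 0, 1 and the vectors 2, 3 span the two planes which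
    turn out to be constant. *)
Definition rotated_frame (th : V -> R) (F : 'I_5 -> V -> 'rV[R]_5) (k : 'I_5) (u : V) :
    'rV[R]_5 :=
  [:: cos (th u) *: F ord0 u + sin (th u) *: F o1 u; F o3 u;
      sin (th u) *: F ord0 u + (- cos (th u)) *: F o1 u; F o2 u; F ord_max u]`_k.

Lemma smooth_cos_comp (U : set V) (th : V -> R) : open U -> smooth_on U th ->
  smooth_on U (fun u => cos (th u)).
Proof.
move=> oU Ct k; have [Cc _] := @smooth_cos_sin R.
by apply: (class_C_comp1 oU _ (Ct k) (Cc k)).
Qed.

Lemma smooth_sin_comp (U : set V) (th : V -> R) : open U -> smooth_on U th ->
  smooth_on U (fun u => sin (th u)).
Proof.
move=> oU Ct k; have [_ Cs] := @smooth_cos_sin R.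
by apply: (class_C_comp1 oU _ (Ct k) (Cs k)).
Qed.

Lemma class_CZ_rV k (U : set V) (f : V -> R) n (g : V -> 'rV[R]_n) : open U ->
  class_C k U f -> class_C k U g -> class_C k U (fun a => f a *: g a).
Proof.
move=> oU Cf Cg; apply: class_C_mx => // i j.
apply: class_C_eq (class_CM oU Cf (class_C_coord i j oU Cg)) => // a _.
by rewrite mxE.
Qed.

Lemma rotated_frame_on (U : set V) th F : open U -> smooth_on U th ->
  frame_on U F -> frame_on U (rotated_frame th F).
Proof.
move=> oU Ct [CF onF]; have Cc := smooth_cos_comp oU Ct.
have Cs := smooth_sin_comp oU Ct; split.
  apply: all5 => k; rewrite /rotated_frame /=.
  - exact: class_CD oU (class_CZ_rV oU (Cc k) (CF ord0 k)) (class_CZ_rV oU (Cs k) (CF o1 k)).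
  - exact: CF.
  - exact: class_CD oU (class_CZ_rV oU (Cs k) (CF ord0 k))
      (class_CZ_rV oU (class_CN oU (Cc k)) (CF o1 k)).
  - exact: CF.
  - exact: CF.
move=> u Uu; have onu := onF u Uu.
have cs : cos (th u) ^+ 2 + sin (th u) ^+ 2 = 1 by exact: cos2Dsin2.
by apply: all5; apply: all5; rewrite /rotated_frame /= ?dot_lin !onu /=; lra.
Qed.

Lemma derive_scale (U : set V) (f : V -> R) (g : V -> 'rV[R]_5) u v :
  open U -> U u -> smooth_on U f -> smooth_on U g ->
  'D_v (fun a => f a *: g a) u = 'D_v f u *: g u + f u *: 'D_v g u.
Proof.
move=> oU Uu Cf Cg; have df := differentiable_class_C Uu Cf.
have dg := differentiable_class_C Uu Cg.
have dfg : differentiable (fun a => f a *: g a) u.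
  by apply: (differentiable_class_C Uu) => k; exact: class_CZ_rV.
apply/rowP => i; rewrite derive_mx_coord// !mxE.
have dgi : differentiable (fun a => g a 0 i) u.
  by apply: (differentiable_class_C Uu) => k; exact: (class_C_coord 0 i oU (Cg k)).
have E : 'D_v (fun a => (f a *: g a) 0 i) u = 'D_v (f * (fun a => g a 0 i)) u.
  by congr ('D_v _ u); apply/funext => a; rewrite mxE.
apply: etrans E _.
rewrite deriveM; [|exact: diff_derivable|exact: diff_derivable].
by rewrite addrC derive_mx_coord// -[_ *: 'D_v f u]/(_ * _) mulrC.
Qed.

Lemma derive_cos_comp (U : set V) (th : V -> R) u v : U u -> smooth_on U th ->
  'D_v (fun a => cos (th a)) u = 'D_v th u * - sin (th u).
Proof.
move=> Uu Ct; have dt := differentiable_class_C Uu Ct.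
have dc : differentiable (@cos R) (th u).
  by apply/derivable1_diffP; exact: derivable_cos.
have := derive_comp v dt dc => E; apply: etrans E _.
rewrite derive_R//; congr (_ * _); exact: derive_val.
Qed.

Lemma derive_sin_comp (U : set V) (th : V -> R) u v : U u -> smooth_on U th ->
  'D_v (fun a => sin (th a)) u = 'D_v th u * cos (th u).
Proof.
move=> Uu Ct; have dt := differentiable_class_C Uu Ct.
have dc : differentiable (@sin R) (th u).
  by apply/derivable1_diffP; exact: derivable_sin.
have := derive_comp v dt dc => E; apply: etrans E _.
rewrite derive_R//; congr (_ * _); exact: derive_val.
Qed.

Lemma dot_derive_combination (U : set V) (f g : V -> R) (n nu : V -> 'rV[R]_5) z u v :
  open U -> U u -> smooth_on U f -> smooth_on U g -> smooth_on U n -> smooth_on U nu ->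
  dot ('D_v (fun a => f a *: n a + g a *: nu a) u) z =
    'D_v f u * dot (n u) z + f u * dot ('D_v n u) z +
    ('D_v g u * dot (nu u) z + g u * dot ('D_v nu u) z).
Proof.
move=> oU Uu Cf Cg Cn Cnu.
have E : 'D_v (fun a => f a *: n a + g a *: nu a) u =
    ('D_v f u *: n u + f u *: 'D_v n u) + ('D_v g u *: nu u + g u *: 'D_v nu u).
  apply: etrans (congr2 +%R (derive_scale v oU Uu Cf Cn) (derive_scale v oU Uu Cg Cnu)).
  apply: deriveD; apply: diff_derivable; apply: (differentiable_class_C Uu) => k;
    exact: class_CZ_rV.
have algebra (a b c d : R) (x y p q : 'rV[R]_5) :
    dot (a *: x + b *: y + (c *: p + d *: q)) z =
    a * dot x z + b * dot y z + (c * dot p z + d * dot q z) by rewrite !dot_lin.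
exact: etrans (congr1 (fun x => dot x z) E) (algebra _ _ _ _ _ _ _ _).
Qed.

(** The rotation angle satisfies d th = - omega_01, which cancels the connection
    form between the two rotated vectors; since tan th = - m = 1 / l, the
    component of the first one along z2 and that of the second one along z3
    cancel too. *)
Lemma rotated_connection (U : set V) th F (l m : V -> R) :
  open U -> smooth_on U th -> frame_on U F ->
  (forall u, U u -> F ord_max u = d_x5) ->
  (forall u v, U u -> connection F o1 o2 v u = - l u * connection F ord0 o2 v u) ->
  (forall u v, U u -> connection F o1 o3 v u = - m u * connection F ord0 o3 v u) ->
  (forall u v, U u -> connection F o2 o3 v u = 0) ->
  (forall u, U u -> l u * m u = -1) ->
  (forall u, U u -> sin (th u) = - m u * cos (th u)) ->
  (forall u v, U u -> 'D_v th u = - connection F ord0 o1 v u) ->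
  let G := rotated_frame th F in
  forall u v, U u ->
    [/\ connection G ord0 o2 v u = 0 /\ connection G ord0 o3 v u = 0,
        connection G o1 o2 v u = 0 /\ connection G o1 o3 v u = 0 &
        forall i, connection G i ord_max v u = 0].
Proof.
move=> oU Ct frF F4 H2 H3 H23 lm sc Dt G u v Uu.
have frG : frame_on U G by exact: rotated_frame_on.
have anti := connection_antisym oU frF.
have antiG := connection_antisym oU frG.
have [CF onF] := frF; have onu := onF u Uu.
have Cc := smooth_cos_comp oU Ct; have Cs := smooth_sin_comp oU Ct.
have CNc : smooth_on U (fun u => - cos (th u)) by move=> k; exact: class_CN oU (Cc k).
have Dc : 'D_v (fun a => cos (th a)) u = connection F ord0 o1 v u * sin (th u).
  by rewrite (derive_cos_comp v Uu Ct) Dt// mulrNN.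
have Ds : 'D_v (fun a => sin (th a)) u = - connection F ord0 o1 v u * cos (th u).
  by rewrite (derive_sin_comp v Uu Ct) Dt.
have DNc : 'D_v (fun a => - cos (th a)) u = - (connection F ord0 o1 v u * sin (th u)).
  rewrite -Dc; apply: deriveN; apply: diff_derivable.
  exact: (differentiable_class_C Uu Cc).
have DG0 z := dot_derive_combination z v oU Uu Cc Cs (CF ord0) (CF o1).
have DG2 z := dot_derive_combination z v oU Uu Cs CNc (CF ord0) (CF o1).
have c0 i x : connection F i i x u = 0.
  by have := anti i i x u Uu; move: (connection _ _ _ _ _) => c; lra.
have cs : cos (th u) ^+ 2 + sin (th u) ^+ 2 = 1 by exact: cos2Dsin2.
have lc : cos (th u) - sin (th u) * l u = 0.
  by rewrite sc// mulrAC mulNr [m u * _]mulrC lm// opprK mul1r subrr.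
have onE i j : dot (F i u) (F j u) = (i == j)%:R by exact: onu.
have K i j : dot ('D_v (F i) u) (F j u) = connection F i j v u by rewrite connectionE.
have combr (z x y : 'rV[R]_5) (a b : R) : dot z (a *: x + b *: y) = a * dot z x + b * dot z y.
  by rewrite dotDr !dotZr.
have e1 : dot (F ord0 u) (G o2 u) = sin (th u).
  by apply: etrans (combr _ _ _ _ _) _; rewrite !onE /= mulr1 mulr0 addr0.
have e2 : dot (F o1 u) (G o2 u) = - cos (th u).
  by apply: etrans (combr _ _ _ _ _) _; rewrite !onE /= mulr1 mulr0 add0r.
have e3 : dot ('D_v (F ord0) u) (G o2 u) = - (cos (th u) * connection F ord0 o1 v u).
  by apply: etrans (combr _ _ _ _ _) _; rewrite (K ord0 ord0) (K ord0 o1) c0 mulr0 add0r mulNr.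
have e4 : dot ('D_v (F o1) u) (G o2 u) = - (sin (th u) * connection F ord0 o1 v u).
  apply: etrans (combr _ _ _ _ _) _; rewrite (K o1 ord0) (K o1 o1) c0 mulr0 addr0.
  by rewrite anti// mulrN.
split.
- split; rewrite connectionE; apply: etrans (DG0 _) _; rewrite Dc Ds.
    by rewrite e1 e2 e3 e4; ring.
  rewrite (onE ord0 o2) (onE o1 o2) (K ord0 o2) (K o1 o2) H2//= !mulr0 !add0r.
  by rewrite mulrA -mulrDl mulrN lc mul0r.
- split.
    rewrite antiG// connectionE; apply/eqP; rewrite oppr_eq0; apply/eqP.
    apply: etrans (DG2 _) _; rewrite Ds DNc.
    rewrite (onE ord0 o3) (onE o1 o3) (K ord0 o3) (K o1 o3) H3//= !mulr0 !add0r.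
    by rewrite sc//; ring.
  by rewrite connectionE /G /rotated_frame /= -connectionE anti// H23// oppr0.
move=> i; rewrite antiG// connectionE (@derive_const_on _ _ _ U _ d_x5)// dot0l.
exact: oppr0.
Qed.

End Rotation.

(** * Two fixed orthogonal planes *)

Section Splitting.
Context {R : realType} {V : normedModType R}.

Lemma smooth_dot_cst (U : set V) (G : V -> 'rV[R]_5) a : open U -> smooth_on U G ->
  smooth_on U (fun u => dot (G u) a).
Proof. by move=> oU CG k; exact: class_C_dot oU (CG k) (class_C_cst k U a). Qed.

Lemma derive_dot_cst (U : set V) (G : V -> 'rV[R]_5) a u v : U u -> smooth_on U G ->
  'D_v (fun b => dot (G b) a) u = dot ('D_v G u) a.
Proof.
move=> Uu CG; have dG := differentiable_class_C Uu CG.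
have dc : differentiable (cst a : V -> 'rV[R]_5) u by exact: differentiable_cst.
apply: etrans (derive_dot v dG dc) _.
by rewrite derive_cst dot0r addr0.
Qed.

(** The squared length of the projection of a on the plane of the first two
    vectors has zero derivative, because the connection preserves that plane
    and acts on it by an antisymmetric matrix. *)
Lemma plane_constant (u0 : V) r (G : 'I_5 -> V -> 'rV[R]_5) :
  frame_on (ball u0 r) G ->
  (forall u v, ball u0 r u ->
    [/\ connection G ord0 o2 v u = 0 /\ connection G ord0 o3 v u = 0,
        connection G o1 o2 v u = 0 /\ connection G o1 o3 v u = 0 &
        forall i, connection G i ord_max v u = 0]) ->
  forall a u, ball u0 r u -> ball u0 r u0 ->
    dot (G ord0 u) a ^+ 2 + dot (G o1 u) a ^+ 2 =
    dot (G ord0 u0) a ^+ 2 + dot (G o1 u0) a ^+ 2.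
Proof.
move=> frG H a u bu bu0; have oB : open (ball u0 r) by exact: ball_open.
have antiG := connection_antisym oB frG; have [CG onG] := frG.
pose q i b : R := dot (G i b) a.
have Cq i : smooth_on (ball u0 r) (q i) by exact: smooth_dot_cst.
pose phi b : R := q ord0 b * q ord0 b + q o1 b * q o1 b.
have Cphi : smooth_on (ball u0 r) phi.
  by move=> k; exact: class_CD oB (class_CM oB (Cq ord0 k) (Cq ord0 k))
    (class_CM oB (Cq o1 k) (Cq o1 k)).
have Dq i b v : ball u0 r b -> 'D_v (q i) b = \sum_k connection G i k v b * q k b.
  move=> bb; apply: etrans (derive_dot_cst a v bb (CG i)) _.
  apply: etrans (parseval _ _ (onG b bb)) _; apply: eq_bigr => k _.
  by rewrite connectionE /q (dotC a).
have Dphi b v : ball u0 r b -> 'D_v phi b = 0.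
  move=> bb; have dq i := differentiable_class_C bb (Cq i).
  have dd i : derivable (q i) b v by exact: diff_derivable.
  have E : 'D_v phi b = (q ord0 b *: 'D_v (q ord0) b + q ord0 b *: 'D_v (q ord0) b) +
      (q o1 b *: 'D_v (q o1) b + q o1 b *: 'D_v (q o1) b).
    apply: etrans (congr2 +%R (deriveM (dd ord0) (dd ord0)) (deriveM (dd o1) (dd o1))).
    by apply: deriveD; apply: derivableM.
  apply: etrans E _; rewrite !Dq// !sum5.
  have [[-> ->] [-> ->] c4] := H b v bb; rewrite !c4 (antiG o1 ord0)//.
  have c0 i : connection G i i v b = 0.
    by have := antiG i i v b bb; move: (connection _ _ _ _ _) => c; lra.
  rewrite !c0; move: (connection G ord0 o1 v b) (q ord0 b) (q o1 b) => x y z.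
  by rewrite -![_ *: _]/(_ * _); ring.
have := zero_derivative_constant (fun b bb => differentiable_class_C bb Cphi)
  (fun b v bb => Dphi b v bb) bu bu0.
by rewrite /phi /q !expr2.
Qed.

Lemma cos_sin_atan_ratio (b0 b1 : R) : 0 < b0 -> b0 ^+ 2 + b1 ^+ 2 = 1 ->
  cos (atan (b1 / b0)) = b0 /\ sin (atan (b1 / b0)) = b1.
Proof.
move=> b0_gt0 b01; have b0n : b0 != 0 by rewrite gt_eqF.
have c : cos (atan (b1 / b0)) = b0.
  rewrite cos_atan (_ : 1 + _ = (b0^-1) ^+ 2); last first.
    by rewrite exprMn -[1](mulfV (expf_neq0 2 b0n)) -exprVn -mulrDl b01 mul1r.
  by rewrite sqrtr_sqr ger0_norm ?invrK// invr_ge0 ltW.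
split=> //; have := atanK (b1 / b0); rewrite /tan c => /eqP.
by rewrite (inj_eq (mulIf _)) ?invr_eq0// => /eqP.
Qed.

Lemma sum_sq_eq0 (x y : R) : x ^+ 2 + y ^+ 2 = 0 -> x = 0 /\ y = 0.
Proof.
move=> /eqP; rewrite paddr_eq0 ?sqr_ge0// !sqrf_eq0.
by move=> /andP[/eqP-> /eqP->].
Qed.

(** The hypothesis says that the first two vectors of G and those of p span the
    same plane, so that the matrix of inner products is block diagonal. *)
Lemma orthonormal_block (p G : 'I_5 -> 'rV[R]_5) :
  orthonormal_family p -> orthonormal_family G ->
  p ord_max = d_x5 -> G ord_max = d_x5 ->
  (forall a, dot (G ord0) a ^+ 2 + dot (G o1) a ^+ 2 =
             dot (p ord0) a ^+ 2 + dot (p o1) a ^+ 2) ->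
  [/\ dot (G ord0) (p o2) = 0 /\ dot (G ord0) (p o3) = 0,
      dot (G o2) (p ord0) = 0 /\ dot (G o2) (p o1) = 0,
      dot (G ord0) (p ord0) ^+ 2 + dot (G ord0) (p o1) ^+ 2 = 1,
      dot (G o2) (p o2) ^+ 2 + dot (G o2) (p o3) ^+ 2 = 1 &
      dot (G ord0) d_x5 = 0 /\ dot (G o2) d_x5 = 0].
Proof.
move=> onp onG p4 G4 E.
have G0d : dot (G ord0) d_x5 = 0 by rewrite -G4 onG.
have G2d : dot (G o2) d_x5 = 0 by rewrite -G4 onG.
have z j : dot (p ord0) (p j) = 0 -> dot (p o1) (p j) = 0 -> dot (G ord0) (p j) = 0.
  move=> e0 e1; have := E (p j); rewrite e0 e1 expr0n addr0 => /sum_sq_eq0.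
  by case.
have G02 : dot (G ord0) (p o2) = 0 by apply: z; rewrite onp.
have G03 : dot (G ord0) (p o3) = 0 by apply: z; rewrite onp.
have z' j : dot (p ord0) (p j) ^+ 2 + dot (p o1) (p j) ^+ 2 = 1 -> dot (G o2) (p j) = 0.
  move=> e; have := parseval (p j) (p j) onG; rewrite sum5 onp eqxx/= -!expr2.
  rewrite !(dotC (p j)) E e.
  have := sqr_ge0 (dot (G o2) (p j)); have := sqr_ge0 (dot (G o3) (p j)).
  have := sqr_ge0 (dot (G ord_max) (p j)).
  move=> h1 h2 h3 h4; apply/eqP; rewrite -sqrf_eq0; apply/eqP.
  by move: h1 h2 h3 h4; move: (_ ^+ 2) (_ ^+ 2) (_ ^+ 2) => x y t; lra.
have G20 : dot (G o2) (p ord0) = 0.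
  by apply: z'; rewrite !onp /= expr1n expr0n addr0.
have G21 : dot (G o2) (p o1) = 0.
  by apply: z'; rewrite !onp /= expr1n expr0n add0r.
split=> //.
- have := parseval (G ord0) (G ord0) onp.
  by rewrite sum5 onG eqxx/= -!expr2 G02 G03 p4 G0d expr0n /= !addr0 => <-.
have := parseval (G o2) (G o2) onp.
by rewrite sum5 onG eqxx/= -!expr2 G20 G21 p4 G2d expr0n /= !addr0 !add0r => <-.
Qed.

End Splitting.

(** * Angular coordinates *)

Section AdaptedCoordinates.
Context {R : realType} {V : normedModType R}.

Lemma smooth_atan_comp (U : set V) (f : V -> R) : open U -> smooth_on U f ->
  smooth_on U (fun u => atan (f u)).
Proof.
move=> oU Cf k; by apply: (class_C_comp1 oU _ (Cf k) (@smooth_atan R k)).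
Qed.

Lemma derive_atan_comp (U : set V) (f : V -> R) u v : U u -> smooth_on U f ->
  'D_v (fun a => atan (f a)) u = 'D_v f u * (1 + f u ^+ 2)^-1.
Proof.
move=> Uu Ct; have dt := differentiable_class_C Uu Ct.
have dc : differentiable (@atan R) (f u).
  by apply/derivable1_diffP; exact: derivable_atan.
have := derive_comp v dt dc => E; apply: etrans E _.
rewrite derive_R//; congr (_ * _); exact: derive_val.
Qed.

Lemma smooth_ratio (U : set V) (f g : V -> R) : open U ->
  (forall u, U u -> g u != 0) -> smooth_on U f -> smooth_on U g ->
  smooth_on U (fun u => f u / g u).
Proof. by move=> oU g0 Cf Cg k; exact: class_CM oU (Cf k) (class_CV oU g0 (Cg k)). Qed.

Lemma smooth_sub (W : normedModType R) (U U' : set V) (f : V -> W) :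
  U' `<=` U -> smooth_on U f -> smooth_on U' f.
Proof. by move=> UU' Cf k; exact: class_C_sub UU' (Cf k). Qed.

Lemma frame_on_sub (U U' : set V) F : U' `<=` U -> frame_on U F -> frame_on U' F.
Proof.
move=> UU' [CF onF]; split=> [i|u /UU']; last exact: onF.
exact: smooth_sub UU' (CF i).
Qed.

Lemma near_pos (U : set V) (f : V -> R) u : open U -> U u -> smooth_on U f ->
  0 < f u -> \forall b \near u, 0 < f b.
Proof.
move=> oU Uu Cf fu; have /cvgrPdist_lt/(_ _ fu) := Cf 0%N u Uu.
apply: filterS => b; rewrite ltr_norml => /andP[_]; lra.
Qed.

(** The angles v and w are those of the rotated frame with respect to its value
    at u0 in each of the two constant planes.  Near u0 the relevant cosines are
    positive, hence the angles are given by arctangents and are smooth. *)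
Lemma adapted_coordinates (U : set V) F (l m : V -> R) u0 :
  open U -> U u0 -> frame_on U F -> smooth_on U m ->
  (forall u, U u -> F ord_max u = d_x5) ->
  (forall u v, U u -> connection F o1 o2 v u = - l u * connection F ord0 o2 v u) ->
  (forall u v, U u -> connection F o1 o3 v u = - m u * connection F ord0 o3 v u) ->
  (forall u v, U u -> connection F o2 o3 v u = 0) ->
  (forall u, U u -> l u * m u = -1) ->
  (forall u, U u -> m u < 0) ->
  (forall u v, U u -> 'D_v m u = (1 + m u ^+ 2) * connection F ord0 o1 v u) ->
  exists (r : R) (p : 'I_5 -> 'rV[R]_5) (th v w : V -> R),
    [/\ 0 < r, ball u0 r `<=` U, orthonormal_family p, p ord_max = d_x5 &
    [/\ smooth_on (ball u0 r) th, smooth_on (ball u0 r) v, smooth_on (ball u0 r) w &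
      forall u, ball u0 r u ->
        [/\ 0 < cos (th u), 0 < sin (th u),
          forall x, 'D_x th u = - connection F ord0 o1 x u &
          forall i, dot (F ord0 u) (p i) =
            [:: cos (th u) * cos (v u); cos (th u) * sin (v u);
                sin (th u) * cos (w u); sin (th u) * sin (w u); 0]`_i]]].
Proof.
move=> oU Uu0 frF Cm F4 H2 H3 H23 lm mneg Dm.
pose th u := atan (- m u).
have CNm : smooth_on U (fun u => - m u) by move=> k; exact: class_CN oU (Cm k).
have Cth : smooth_on U th by exact: smooth_atan_comp.
have Dth u v : U u -> 'D_v th u = - connection F ord0 o1 v u.
  move=> Uu; apply: etrans (derive_atan_comp v Uu CNm) _.
  have E : 'D_v (fun u => - m u) u = - 'D_v m u.
    by apply: deriveN; apply: diff_derivable; exact: (differentiable_class_C Uu Cm).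
  rewrite E Dm// sqrrN mulNr mulrAC mulfV ?mul1r//.
  by rewrite gt_eqF// ltr_wpDr ?sqr_ge0.
have cth u : 0 < cos (th u).
  by apply: cos_gt0_pihalf; rewrite atan_gtNpi2 atan_ltpi2.
have sth u : U u -> sin (th u) = - m u * cos (th u).
  move=> Uu; have := atanK (- m u); rewrite /tan -/(th u) => <-.
  by rewrite divfK// gt_eqF.
have sth0 u : U u -> 0 < sin (th u).
  by move=> Uu; rewrite sth// mulr_gt0// oppr_gt0 mneg.
pose G := rotated_frame th F.
have frG : frame_on U G by exact: rotated_frame_on.
have conG := rotated_connection oU Cth frF F4 H2 H3 H23 lm sth Dth.
pose p i := G i u0.
have onp : orthonormal_family p by case: frG => _ onG; exact: onG.
pose b i j u := dot (G i u) (p j).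
have [CG onG] := frG.
have Cb i j : smooth_on U (b i j) by exact: smooth_dot_cst (CG i).
have b1 i : b i i u0 = 1 by have := onp i i; rewrite eqxx.
have n0 : \forall u \near u0, 0 < b ord0 ord0 u.
  by apply: near_pos (Cb ord0 ord0) _ => //; rewrite b1 ltr01.
have n2 : \forall u \near u0, 0 < b o2 o2 u.
  by apply: near_pos (Cb o2 o2) _ => //; rewrite b1 ltr01.
have /nbhs_ballP[r /= r0 Hr] : \forall u \near u0,
    [/\ U u, 0 < b ord0 ord0 u & 0 < b o2 o2 u].
  by apply: filterS3 (near_open oU Uu0) n0 n2 => u.
have bU : ball u0 r `<=` U by move=> u /Hr[].
have bu0 : ball u0 r u0 by exact: ballxx.
exists r, p, th, (fun u => atan (b ord0 o1 u / b ord0 ord0 u)),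
  (fun u => atan (b o2 o3 u / b o2 o2 u)).
have oB : open (ball u0 r) by exact: ball_open.
have p4 : p ord_max = d_x5 by rewrite /p /G /rotated_frame /= F4.
split=> //; split; first exact: smooth_sub Cth.
- apply: smooth_atan_comp => //; apply: smooth_ratio => //.
  + by move=> u /Hr[_ ? _]; rewrite gt_eqF.
  + exact: smooth_sub (Cb _ _).
  + exact: smooth_sub (Cb _ _).
- apply: smooth_atan_comp => //; apply: smooth_ratio => //.
  + by move=> u /Hr[_ _ ?]; rewrite gt_eqF.
  + exact: smooth_sub (Cb _ _).
  + exact: smooth_sub (Cb _ _).
move=> u bu; have [Uu b0 b2] := Hr u bu.
split; [exact: cth|exact: sth0|by move=> x; exact: Dth|].
have E a := plane_constant (frame_on_sub bU frG)
  (fun u v bu => conG u v (bU u bu)) a bu bu0.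
have G4 : G ord_max u = d_x5 by rewrite /G /rotated_frame /= F4.
have [[e02 e03] [e20 e21] s0 s2 [e0d e2d]] := orthonormal_block onp (onG u Uu) p4 G4 E.
have [cv sv] := cos_sin_atan_ratio b0 s0.
have [cw sw] := cos_sin_atan_ratio b2 s2.
have cs := cos2Dsin2 (th u).
(* The rotation is an involution: it also expresses n by the rotated vectors. *)
have nE : F ord0 u = cos (th u) *: G ord0 u + sin (th u) *: G o2 u.
  rewrite /G /rotated_frame /= !scalerDr !scalerA addrACA -!scalerDl.
  rewrite -!expr2 cs scale1r mulrN [sin _ * cos _]mulrC subrr scale0r addr0.
  by [].
have comb z : dot (F ord0 u) z = cos (th u) * dot (G ord0 u) z + sin (th u) * dot (G o2 u) z.
  by rewrite nE dotDl !dotZl.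
apply: all5; rewrite comb /= ?p4 ?e0d ?e2d ?e02 ?e03 ?e20 ?e21 ?cv ?sv ?cw ?sw
  ?mulr0 ?addr0 ?add0r//.
Qed.

End AdaptedCoordinates.

(** * Linear algebra of the principal directions at a point *)

Section HorizontalPart.
Context {R : realType}.
Implicit Types n nu w a : 'rV[R]_5.

Definition horizontal_part n nu w : 'rV[R]_5 :=
  w - dot w n *: n - dot w nu *: nu - dot w d_x5 *: d_x5.

Lemma dot_d_x5_d_x5 : dot d_x5 d_x5 = 1 :> R.
Proof. by rewrite dot_d_x5 mxE !eqxx. Qed.

Lemma horizontal_part_perp n nu w : dot n n = 1 -> dot nu nu = 1 -> dot nu n = 0 ->
  dot n d_x5 = 0 -> dot nu d_x5 = 0 ->
  [/\ dot (horizontal_part n nu w) n = 0, dot (horizontal_part n nu w) nu = 0 &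
      dot (horizontal_part n nu w) d_x5 = 0].
Proof.
move=> nn nunu nun nd nud.
by rewrite !dotBl !dotZl nn nunu dot_d_x5_d_x5 (dotC n nu) (dotC d_x5 n) (dotC d_x5 nu)
  nun nd nud; split; ring.
Qed.

Lemma dot_horizontal_part n nu w a : dot a n = 0 -> dot a nu = 0 -> dot a d_x5 = 0 ->
  dot (horizontal_part n nu w) a = dot w a.
Proof.
rewrite !(dotC a) => an anu ad.
by rewrite !dotBl !dotZl an anu ad !mulr0 !subr0.
Qed.

Lemma horizontal_part_id n nu w c : dot n n = 1 -> dot nu n = 0 -> dot n d_x5 = 0 ->
  dot w n = 0 -> dot w nu = 0 -> dot w d_x5 = 0 ->
  horizontal_part n nu (c *: n + w) = w.
Proof.
move=> nn nun nd wn wnu wd; rewrite /horizontal_part !dotDl !dotZl nn nd (dotC n nu) nun.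
by rewrite wn wnu wd mulr1 !mulr0 !addr0 !scale0r !subr0 addrAC subrr add0r.
Qed.

End HorizontalPart.

Section PointwiseShape.
Context {R : realType} {V : lmodType R}.
Context (A B : {linear V -> 'rV[R]_5}) (n N : 'rV[R]_5).

(** The data at one point of a hypersurface: A is the differential of the
    immersion, B that of the unit normal N, and n is the unit normal of
    S^3 x R.  The symmetry of B with respect to A is that of the second
    fundamental form. *)
Definition shape_datum :=
  [/\ [/\ dot n n = 1, dot N N = 1, dot n N = 0 & dot n d_x5 = 0],
      [/\ forall v, dot (A v) n = 0, forall v, dot (A v) N = 0 &
          forall v, dot (B v) N = 0],
      forall v w, dot (B v) (A w) = dot (B w) (A v) &
      forall v, A v = 0 -> v = 0].

Definition principal (k : R) (e : V) :=
  B e *m (1%:M - n^T *m n) = - k *: A e.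

Hypothesis AB : shape_datum.

Lemma dot_normal_projection u v : dot v n = 0 ->
  dot (u *m (1%:M - n^T *m n)) v = dot u v.
Proof.
move=> vn; rewrite mulmxBr mulmx1 dotBl dot_mulmx trmx_mul trmxK mulmxA.
suff -> : v *m n^T = 0 by rewrite mul0mx dot0r subr0.
by apply/matrixP => i j; rewrite !ord1 -dotE vn mxE.
Qed.

Lemma principal_dot k e : principal k e ->
  forall v, dot (B v) (A e) = - k * dot (A v) (A e).
Proof.
move=> ke v; have [_ [An _ _] sym _] := AB.
by rewrite sym -dot_normal_projection// ke dotZl dotC.
Qed.

Lemma principal_orthogonal k k' e e' : principal k e -> principal k' e' -> k != k' ->
  dot (A e) (A e') = 0.
Proof.
move=> ke ke' kk'; have [_ _ sym _] := AB.
have := principal_dot ke e'; rewrite sym (principal_dot ke' e) dotC.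
move=> /eqP; rewrite -subr_eq0 -mulrBl mulf_eq0 opprK addrC subr_eq0 (negbTE kk') /=.
by rewrite dotC => /eqP.
Qed.

Lemma dot_A_gt0 e : e != 0 -> 0 < dot (A e) (A e).
Proof.
move=> e0; have [_ _ _ inj] := AB; rewrite lt0r dot_ge0 andbT dot_eq0.
by apply: contraNneq e0 => /inj ->.
Qed.

Context (t e2 e3 : V) (s k1 k2 k3 : R).
Hypothesis d5E : d_x5 = A t + s *: N.
Hypotheses (t0 : t != 0) (e20 : e2 != 0) (e30 : e3 != 0).
Hypotheses (k1t : principal k1 t) (k2e : principal k2 e2) (k3e : principal k3 e3).
Hypotheses (k12 : k1 != k2) (k13 : k1 != k3) (k23 : k2 != k3).

Lemma angle_normal : dot N d_x5 = s.
Proof.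
have [[_ NN _ _] [_ AN _] _ _] := AB.
by rewrite d5E dotDr dotZr NN mulr1 dotC AN add0r.
Qed.

Lemma height_A v : dot (A v) d_x5 = dot (A v) (A t).
Proof. by have [_ [_ AN _] _ _] := AB; rewrite d5E dotDr dotZr AN mulr0 addr0. Qed.

(** This is d sigma = - k1 dh: the pairing with d_x5 of a vector orthogonal to N
    is its pairing with A t, and t is principal. *)
Lemma height_B v : dot (B v) d_x5 = - k1 * dot (A v) d_x5.
Proof.
have [_ [_ _ BN] _ _] := AB.
by rewrite height_A -(principal_dot k1t) d5E dotDr dotZr BN mulr0 addr0.
Qed.

Lemma height_t : dot (A t) d_x5 = 1 - dot N d_x5 ^+ 2.
Proof.
have [[_ NN _ _] [_ AN _] _ _] := AB.
have d1 : dot d_x5 d_x5 = 1 :> R by rewrite dot_d_x5 mxE !eqxx.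
have : dot d_x5 d_x5 = dot (A t) d_x5 + s * dot N d_x5.
  by rewrite {1}d5E dotDl dotZl.
by rewrite angle_normal d1 expr2 => ->; rewrite addrK.
Qed.

Lemma height_t_gt0 : 0 < 1 - dot N d_x5 ^+ 2.
Proof. by rewrite -height_t height_A; exact: dot_A_gt0. Qed.

(** The principal directions e2 and e3 are orthogonal to t, hence tangent to the
    slices of constant height. *)
Lemma height_principal : dot (A e2) d_x5 = 0 /\ dot (A e3) d_x5 = 0.
Proof.
rewrite !height_A; split; apply: principal_orthogonal; try eassumption;
  by rewrite eq_sym.
Qed.

Let tau := Num.sqrt (1 - dot N d_x5 ^+ 2).
Let nu := tau^-1 *: (N - dot N d_x5 *: d_x5).

Lemma nu_facts :
  [/\ dot nu nu = 1, dot nu n = 0, dot nu d_x5 = 0 & dot nu (A e2) = 0 /\ dot nu (A e3) = 0].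
Proof.
have [[nn NN nN nd] [An AN _] _ _] := AB.
have d1 : dot d_x5 d_x5 = 1 :> R by rewrite dot_d_x5 mxE !eqxx.
have [h2 h3] := height_principal.
have tau2 : tau ^+ 2 = 1 - dot N d_x5 ^+ 2 by rewrite sqr_sqrtr// ltW// height_t_gt0.
have tau0 : tau != 0 by rewrite gt_eqF// sqrtr_gt0 height_t_gt0.
have perp a : dot N a = 0 -> dot d_x5 a = 0 -> dot nu a = 0.
  by move=> Na da; rewrite dotZl dotBl dotZl Na da mulr0 subrr mulr0.
split.
- rewrite dotZl dotZr dotBl !dotBr !dotZl !dotZr NN d1 (dotC d_x5 N).
  rewrite mulrA -invfM -expr2 tau2.
  have -> : 1 - dot N d_x5 * dot N d_x5 -
      (dot N d_x5 * dot N d_x5 - dot N d_x5 * (dot N d_x5 * 1)) =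
     1 - dot N d_x5 ^+ 2 by ring.
  by rewrite mulVf// -tau2 expf_neq0.
- by apply: perp; rewrite dotC.
- by rewrite dotZl dotBl dotZl d1 mulr1 subrr mulr0.
- by split; apply: perp; rewrite dotC.
Qed.

Lemma adapted_orthonormal_family (a b : 'rV[R]_5) : dot a a = 1 -> dot b b = 1 -> dot a b = 0 ->
  dot n a = 0 -> dot n b = 0 -> dot nu a = 0 -> dot nu b = 0 ->
  dot a d_x5 = 0 -> dot b d_x5 = 0 ->
  orthonormal_family (fun i : 'I_5 => [:: n; nu; a; b; d_x5]`_i).
Proof.
move=> aa bb ab na nb nua nub ad bd.
have [[nn NN nN nd] [An AN _] _ _] := AB; have [nunu nun nud _] := nu_facts.
have d1 : dot d_x5 d_x5 = 1 :> R by rewrite dot_d_x5 mxE !eqxx.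
apply: all5; apply: all5; rewrite /= ?(dotC b a) ?(dotC a n) ?(dotC b n) ?(dotC a nu)
  ?(dotC b nu) ?(dotC d_x5) ?(dotC n nu) ?nn ?nunu ?aa ?bb ?d1//.
Qed.

Let u2 := (Num.sqrt (dot (A e2) (A e2)))^-1 *: A e2.
Let u3 := (Num.sqrt (dot (A e3) (A e3)))^-1 *: A e3.

Lemma principal_frame :
  orthonormal_family (fun i : 'I_5 => [:: n; nu; u2; u3; d_x5]`_i).
Proof.
have [_ [An AN _] _ _] := AB; have [_ _ _ [nu2 nu3]] := nu_facts.
have [h2 h3] := height_principal.
have unit e : e != 0 -> dot ((Num.sqrt (dot (A e) (A e)))^-1 *: A e)
    ((Num.sqrt (dot (A e) (A e)))^-1 *: A e) = 1.
  move=> e0; have Ae := dot_A_gt0 e0.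
  rewrite dotZl dotZr mulrA -invfM -expr2 sqr_sqrtr; last exact: ltW.
  by rewrite mulVf// gt_eqF.
apply: adapted_orthonormal_family; rewrite ?unit//.
- by rewrite dotZl dotZr (principal_orthogonal k2e k3e k23) !mulr0.
- by rewrite dotZr dotC An mulr0.
- by rewrite dotZr dotC An mulr0.
- by rewrite dotZr nu2 mulr0.
- by rewrite dotZr nu3 mulr0.
- by rewrite dotZl h2 mulr0.
- by rewrite dotZl h3 mulr0.
Qed.

(** Modulo n, the operator B + k3 A annihilates e3 and multiplies e2 by k3 - k2;
    taking the horizontal part discards the component along t. *)
Lemma horizontal_part_parallel v :
  exists b, horizontal_part n nu (B v + k3 *: A v) = b *: A e2.
Proof.
have [[nn _ _ nd] [An AN _] _ _] := AB; have [nunu nun nud [nu2 nu3]] := nu_facts.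
set z := horizontal_part _ _ _.
have [zn znu zd] := horizontal_part_perp (B v + k3 *: A v) nn nunu nun nd nud.
have [h2 h3] := height_principal.
have ze3 : dot z (A e3) = 0.
  have e3nu : dot (A e3) nu = 0 by rewrite dotC.
  rewrite (dot_horizontal_part _ (An e3) e3nu h3).
  by rewrite dotDl dotZl (principal_dot k3e) mulNr addrC subrr.
have zu3 : dot z u3 = 0 by rewrite dotZr ze3 mulr0.
exists (dot z u2 * (Num.sqrt (dot (A e2) (A e2)))^-1).
rewrite {1}(orthonormal_expansion z principal_frame) !big_ord_recl big_ord0 /=.
by rewrite zn znu zu3 zd !scale0r !add0r !addr0 scalerA.
Qed.

Lemma horizontal_part_e2 :
  horizontal_part n nu (B e2 + k3 *: A e2) = (k3 - k2) *: A e2.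
Proof.
have [[nn _ _ nd] [An AN _] _ _] := AB; have [_ nun nud [nu2 nu3]] := nu_facts.
have [h2 h3] := height_principal.
have Be : B e2 = dot (B e2) n *: n - k2 *: A e2.
  move: k2e; rewrite /principal mulmxBr mulmx1 mulmxA => /eqP.
  rewrite subr_eq addrC scaleNr => /eqP {1}->; congr (_ - _).
  by apply/rowP => i; rewrite !mxE big_ord1 -dotE.
have W : B e2 + k3 *: A e2 = dot (B e2) n *: n + (k3 - k2) *: A e2.
  by rewrite {1}Be scalerBl addrAC addrA addrAC.
rewrite W; apply: horizontal_part_id => //; rewrite dotZl ?An ?h2 ?mulr0//.
by rewrite dotC nu2 mulr0.
Qed.

(** The unit vectors z2 and z3 are given beforehand, as members of smooth vector
    fields, while the eigenvectors e2 and e3 are chosen at the point only. *)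
Lemma unit_principal_frame (b2 b3 : R) (z2 z3 : 'rV[R]_5) :
  z2 = b2 *: A e2 -> z3 = b3 *: A e3 -> dot z2 z2 = 1 -> dot z3 z3 = 1 ->
  [/\ orthonormal_family (fun i : 'I_5 => [:: n; nu; z2; z3; d_x5]`_i),
      forall v, dot (B v) z2 = - k2 * dot (A v) z2,
      forall v, dot (B v) z3 = - k3 * dot (A v) z3 &
      [/\ [/\ dot (A t) z2 = 0, dot (A e3) z2 = 0, dot (A t) z3 = 0 & dot (A e2) z3 = 0],
          dot (A e2) z2 != 0, dot (A e3) z3 != 0 &
          forall v, exists a b c, v = a *: t + b *: e2 + c *: e3]].
Proof.
move=> z2E z3E z22 z33.
have [[nn NN nN nd] [An AN BN] _ inj] := AB; have [nunu nun nud [nu2 nu3]] := nu_facts.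
have [h2 h3] := height_principal.
have orth k k' e e' : principal k e -> principal k' e' -> k != k' -> forall b,
    dot (A e) (b *: A e') = 0.
  by move=> pe pe' kk' b; rewrite dotZr (principal_orthogonal pe pe' kk') mulr0.
have onF : orthonormal_family (fun i : 'I_5 => [:: n; nu; z2; z3; d_x5]`_i).
  apply: adapted_orthonormal_family => //; rewrite ?z2E ?z3E.
  - by rewrite dotZl (orth k2 k3) ?mulr0.
  - by rewrite dotZr dotC An mulr0.
  - by rewrite dotZr dotC An mulr0.
  - by rewrite dotZr nu2 mulr0.
  - by rewrite dotZr nu3 mulr0.
  - by rewrite dotZl h2 mulr0.
  - by rewrite dotZl h3 mulr0.
have t2 : dot (A t) z2 = 0 by rewrite z2E (orth k1 k2).
have t3 : dot (A t) z3 = 0 by rewrite z3E (orth k1 k3).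
have e32 : dot (A e3) z2 = 0 by rewrite z2E (orth k3 k2)// eq_sym.
have e23 : dot (A e2) z3 = 0 by rewrite z3E (orth k2 k3).
have nz e b z : z = b *: A e -> dot z z = 1 -> dot (A e) z != 0.
  move=> zE zz; apply: contra_eq_neq zz => Aez.
  by rewrite {1}zE dotZl Aez mulr0 eq_sym oner_neq0.
have e22 := nz _ _ _ z2E z22; have e33 := nz _ _ _ z3E z33.
split=> //.
- by move=> v; rewrite z2E !dotZr (principal_dot k2e) mulrCA.
- by move=> v; rewrite z3E !dotZr (principal_dot k3e) mulrCA.
split=> // v.
have ht : dot (A t) d_x5 != 0 by rewrite height_t gt_eqF// height_t_gt0.
pose a := dot (A v) d_x5 / dot (A t) d_x5.
pose b := dot (A v) z2 / dot (A e2) z2.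
pose c := dot (A v) z3 / dot (A e3) z3.
exists a, b, c; apply/eqP; rewrite -subr_eq0; apply/eqP/inj.
set w := v - _.
have Aw z : dot (A w) z =
    dot (A v) z - (a * dot (A t) z + b * dot (A e2) z + c * dot (A e3) z).
  have -> : A w = A v - (a *: A t + b *: A e2 + c *: A e3).
    by rewrite /w raddfB /= !raddfD /= !linearZ.
  by rewrite dotBl !dotDl !dotZl.
have wd : dot (A w) d_x5 = 0 by rewrite Aw h2 h3 !mulr0 !addr0 divfK// subrr.
have w2 : dot (A w) z2 = 0 by rewrite Aw t2 e32 !mulr0 addr0 add0r divfK// subrr.
have w3 : dot (A w) z3 = 0 by rewrite Aw t3 e23 !mulr0 !add0r divfK// subrr.
have wnu : dot (A w) nu = 0 by rewrite dotZr dotBr dotZr AN wd mulr0 subrr mulr0.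
rewrite (orthonormal_expansion (A w) onF) !big_ord_recl big_ord0 /=.
by rewrite An wd w2 w3 wnu !scale0r !addr0.
Qed.

End PointwiseShape.

(** * Hypersurfaces in a local parametrization *)

Section LocalHypersurface.
Context {R : realType} {V : normedModType R}.
Implicit Types (U : set V) (X N : V -> 'rV[R]_5).

Definition height X (u : V) : R := dot (X u) d_x5.

(** The horizontal part of the position vector, which is the unit normal of
    S^3 x R at X u. *)
Definition foot X (u : V) : 'rV[R]_5 := X u - height X u *: d_x5.

Definition local_hypersurface U X N :=
  [/\ open U, smooth_on U X, smooth_on U N &
   forall u, U u ->
    [/\ dot (foot X u) (foot X u) = 1, forall v, dot ('D_v X u) (N u) = 0,
        dot (foot X u) (N u) = 0, dot (N u) (N u) = 1 &
        forall v, 'D_v X u = 0 -> v = 0]].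

Definition principal_at X N u k e :=
  @principal R V ('d X u) ('d N u) (foot X u) k e.

Definition local_principal U X N (k1 k2 k3 : V -> R) :=
  forall u, U u ->
    [/\ k1 u != k2 u, k1 u != k3 u, k2 u != k3 u &
     exists t e2 e3 s,
      [/\ d_x5 = 'd X u t + s *: N u, [/\ t != 0, e2 != 0 & e3 != 0],
          principal_at X N u (k1 u) t, principal_at X N u (k2 u) e2 &
          principal_at X N u (k3 u) e3]].

Lemma smooth_height U X : open U -> smooth_on U X -> smooth_on U (height X).
Proof. by move=> oU CX; exact: smooth_dot_cst. Qed.

Lemma derive_height U X u v : U u -> smooth_on U X ->
  'D_v (height X) u = dot ('D_v X u) d_x5.
Proof. by move=> Uu CX; exact: (derive_dot_cst d_x5 v Uu CX). Qed.

Lemma smooth_foot U X : open U -> smooth_on U X -> smooth_on U (foot X).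
Proof.
move=> oU CX k.
exact: class_CB oU (CX k) (class_CZl _ oU (smooth_height oU CX k)).
Qed.

Lemma derive_foot U X u v : open U -> U u -> smooth_on U X ->
  'D_v (foot X) u = 'D_v X u - dot ('D_v X u) d_x5 *: d_x5.
Proof.
move=> oU Uu CX; have Ch := smooth_height oU CX.
have dX := @diff_derivable _ _ _ _ _ v (differentiable_class_C Uu CX).
have dh : differentiable (height X) u := differentiable_class_C Uu Ch.
have E : 'D_v (fun a => height X a *: d_x5) u = 'D_v (height X) u *: d_x5.
  rewrite !deriveE//; last exact: differentiableZl.
  by rewrite diffZl.
have dhd : derivable (fun a => height X a *: (d_x5 : 'rV[R]_5)) u v.
  by apply/diff_derivable/differentiableZl.
apply: etrans (deriveB dX dhd) _; congr (_ - _); apply: etrans E _.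
by congr (_ *: _); exact: derive_height CX.
Qed.

Lemma foot_d_x5 X u : dot (foot X u) d_x5 = 0.
Proof. by rewrite dotBl dotZl dot_d_x5_d_x5 mulr1 subrr. Qed.

Lemma derive_dot_const U (F G : V -> 'rV[R]_5) c u v : open U -> U u ->
  smooth_on U F -> smooth_on U G -> (forall a, U a -> dot (F a) (G a) = c) ->
  dot ('D_v F u) (G u) + dot (F u) ('D_v G u) = 0.
Proof.
move=> oU Uu CF CG E; have dF := differentiable_class_C Uu CF.
have dG := differentiable_class_C Uu CG.
apply: etrans (esym (derive_dot v dF dG)) _.
exact: (derive_const_on v oU Uu E).
Qed.

Lemma shape_datum_at U X N u : local_hypersurface U X N -> U u ->
  @shape_datum R V ('d X u) ('d N u) (foot X u) (N u).
Proof.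
move=> [oU CX CN H] Uu; have [ff XN fN NN imm] := H u Uu.
have dX : differentiable X u := differentiable_class_C Uu CX.
have dN : differentiable N u := differentiable_class_C Uu CN.
have fd := foot_d_x5 X u.
split.
- by split.
- split=> v.
  + rewrite -deriveE//.
    have := derive_dot_const v oU Uu (smooth_foot oU CX) (smooth_foot oU CX)
      (fun a Ua => let: And5 e _ _ _ _ := H a Ua in e).
    rewrite [X in _ + X]dotC => /eqP; rewrite -mulr2n mulrn_eq0 /= => /eqP.
    by rewrite (derive_foot v oU Uu CX) dotBl dotZl (dotC d_x5) fd mulr0 subr0.
  + by rewrite -deriveE.
  + rewrite -deriveE//.
    have := derive_dot_const v oU Uu CN CN (fun a Ua => let: And5 _ _ _ e _ := H a Ua in e).
    by rewrite [X in _ + X]dotC => /eqP; rewrite -mulr2n mulrn_eq0 /= => /eqP.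
- move=> v w.
  apply: etrans (congr2 dot (esym (deriveE v dN)) (esym (deriveE w dX))) _.
  apply: etrans _ (congr2 dot (deriveE w dN) (deriveE v dX)).
  have E x y : dot ('D_x ('D_y X) u) (N u) + dot ('D_y X u) ('D_x N u) = 0.
    exact: (derive_dot_const x oU Uu (smooth_derive y CX) CN
      (fun a Ua => let: And5 _ e _ _ _ := H a Ua in e y)).
  have Evw := E v w; have Ewv := E w v.
  have {}Evw := etrans (esym (congr1 (fun x => dot x (N u) + _) (derive_comm_rV v w oU Uu CX))) Evw.
  rewrite (dotC ('D_v N u)) (dotC ('D_w N u)).
  have := etrans Evw (esym Ewv) => /eqP; rewrite (inj_eq (addrI _)) => /eqP.
  exact.
- by move=> v; rewrite -(deriveE v dX); exact: imm.
Qed.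

Lemma local_hypersurface_sub U U' X N : open U' -> U' `<=` U ->
  local_hypersurface U X N -> local_hypersurface U' X N.
Proof.
move=> oU' UU' [oU CX CN H]; split => //; [exact: smooth_sub CX|exact: smooth_sub CN|].
by move=> u /UU'; exact: H.
Qed.

(** The differential of f is a multiple of that of h at each point: the
    infinitesimal form of the assertion that f is a function of h. *)
Definition follows U (h f : V -> R) :=
  forall u, U u -> exists r, forall v, 'D_v f u = r * 'D_v h u.

Lemma follows_comp1 U (W : set R) (h f : V -> R) (g : R -> R) :
  (forall u, U u -> W (f u)) -> smooth_on U f -> smooth_on W g ->
  follows U h f -> follows U h (fun u => g (f u)).
Proof.
move=> UW Cf Cg H u Uu; have [r E] := H u Uu; exists (r * 'D_1 g (f u)) => v.
have df := differentiable_class_C Uu Cf.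
have dg := differentiable_class_C (UW u Uu) Cg.
apply: etrans (derive_comp v df dg) _.
by apply: etrans (derive_R _ dg) _; rewrite E mulrAC.
Qed.

Lemma followsM U (h f g : V -> R) : smooth_on U f -> smooth_on U g ->
  follows U h f -> follows U h g -> follows U h (fun u => f u * g u).
Proof.
move=> Cf Cg Hf Hg u Uu; have [r E] := Hf u Uu; have [s E'] := Hg u Uu.
exists (f u * s + g u * r) => v.
have df := @diff_derivable _ _ _ _ _ v (differentiable_class_C Uu Cf).
have dg := @diff_derivable _ _ _ _ _ v (differentiable_class_C Uu Cg).
apply: etrans (deriveM df dg) _; rewrite E E' mulrDl -![_ *: _]/(_ * _).
by rewrite !mulrA.
Qed.

Lemma follows_eq U (h f g : V -> R) : open U -> (forall u, U u -> f u = g u) ->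
  follows U h f -> follows U h g.
Proof.
move=> oU fg Hf u Uu; have [r E] := Hf u Uu; exists r => v; rewrite -E.
by apply: near_eq_derive; apply: filterS (near_open oU Uu) => a /fg.
Qed.

(** The function sigma of the decomposition of d_x5. *)
Definition angle N (u : V) : R := dot (N u) d_x5.

Lemma derive_angle U X N k1 k2 k3 u v : local_hypersurface U X N ->
  local_principal U X N k1 k2 k3 -> U u ->
  'D_v (angle N) u = - k1 u * 'D_v (height X) u.
Proof.
move=> LH LP Uu; have [oU CX CN _] := LH.
have [_ _ _ [t [e2 [e3 [s [dE [t0 _ _] pt _ _]]]]]] := LP u Uu.
have dX := differentiable_class_C Uu CX; have dN := differentiable_class_C Uu CN.
rewrite (derive_height v Uu CX); apply: etrans (derive_dot_cst d_x5 v Uu CN) _.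
rewrite !deriveE//.
exact: (height_B (shape_datum_at LH Uu) dE pt).
Qed.

(** The principal curvature k1 is only given as an eigenvalue.  The relation
    d sigma = - k1 dh expresses it as a quotient of smooth functions, because dh
    does not vanish on T; and the symmetry of the second derivatives of sigma
    and h in this relation gives dk1 /\ dh = 0. *)
Lemma smooth_k1 U X N k1 k2 k3 u0 : local_hypersurface U X N ->
  local_principal U X N k1 k2 k3 -> U u0 ->
  exists U', [/\ open U', U' u0, U' `<=` U, smooth_on U' k1 & follows U' (height X) k1].
Proof.
move=> LH LP Uu0; have [oU CX CN _] := LH.
have [_ _ _ [t [e2 [e3 [s [dE [t0 _ _] pt _ _]]]]]] := LP u0 Uu0.
have Ch := smooth_height oU CX.
have Ca : smooth_on U (angle N) by exact: smooth_dot_cst.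
have Da v u : U u -> 'D_v (angle N) u = - k1 u * 'D_v (height X) u.
  by move=> Uu; exact: derive_angle LH LP Uu.
have AB := shape_datum_at LH Uu0.
have ht0 : 0 < 'D_t (height X) u0.
  rewrite (derive_height t Uu0 CX) deriveE; last exact: (differentiable_class_C Uu0 CX).
  by rewrite (height_t AB dE); exact: (height_t_gt0 AB dE t0).
have Cht := smooth_derive t Ch; have Cat := smooth_derive t Ca.
have n0 := near_pos oU Uu0 Cht ht0.
pose U' := U `&` (fun u => 'D_t (height X) u) @^-1` [set x | 0 < x].
have oU' : open U'.
  apply: open_preimage => //.
  by move=> a Ua; exact: (Cht 0%N a Ua).
have U'U : U' `<=` U by move=> u [].
have h0 u : U' u -> 'D_t (height X) u != 0 by move=> [_ /= ?]; rewrite gt_eqF.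
have Ck : smooth_on U' k1.
  move=> k; apply: (class_C_eq (f := fun u => - ('D_t (angle N) u / 'D_t (height X) u))) => //.
    move=> u U'u; rewrite Da; last exact: U'U.
    by rewrite mulfK ?opprK//; exact: h0.
  apply: class_CN => //; apply: (smooth_ratio (f := 'D_t (angle N))) => //.
    exact: smooth_sub Cat.
  exact: smooth_sub Cht.
exists U'; split=> // u U'u; exists ('D_t k1 u / 'D_t (height X) u) => v.
have Uu := U'U u U'u.
have dk : differentiable k1 u := differentiable_class_C U'u Ck.
have E x y : 'D_x ('D_y (angle N)) u =
    - ('D_x k1 u * 'D_y (height X) u + k1 u * 'D_x ('D_y (height X)) u).
  have dhy : differentiable ('D_y (height X)) u.
    exact: (differentiable_class_C Uu (smooth_derive y Ch)).
  have E1 : 'D_x ('D_y (angle N)) u = 'D_x (- (k1 * 'D_y (height X))) u.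
    apply: near_eq_derive; apply: filterS (near_open oU Uu) => z /Da ->.
    by rewrite mulNr.
  apply: etrans E1 _; apply: etrans (deriveN (derivableM _ _)) _; try exact: diff_derivable.
  congr (- _); apply: etrans (deriveM _ _) _; try exact: diff_derivable.
  by rewrite addrC; congr (_ + _); rewrite mulrC.
have Sa := derive_comm v t oU Uu (Ca 2); have Sh := derive_comm v t oU Uu (Ch 2).
have := etrans (etrans (esym (E v t)) Sa) (E t v).
have alg (a b c d k p q : R) : b != 0 -> p = q ->
    - (a * b + k * p) = - (c * d + k * q) -> a = c / b * d.
  move=> b0 -> /oppr_inj/addIr abcd; apply: (mulIf b0).
  by rewrite abcd mulrAC divfK.
by apply: alg Sh; exact: h0.
Qed.

End LocalHypersurface.

(** * A smooth principal frame *)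

Section LocalFrame.
Context {R : realType} {V : normedModType R}.
Implicit Types (U : set V) (X N : V -> 'rV[R]_5).

Definition slope N (u : V) : R := Num.sqrt (1 - angle N u ^+ 2).

Definition conormal N (u : V) : 'rV[R]_5 :=
  (slope N u)^-1 *: (N u - angle N u *: d_x5).

(** For k = k3 this is a multiple of the principal direction of k2, and for
    k = k2 one of the principal direction of k3.  Eigenvectors chosen point by
    point need not depend smoothly on the point; the present formula does, with
    a fixed vector x. *)
Definition axis X N (k : V -> R) (x u : V) : 'rV[R]_5 :=
  horizontal_part (foot X u) (conormal N u) ('D_x N u + k u *: 'D_x X u).

Definition unit_vector (w : 'rV[R]_5) : 'rV[R]_5 := (Num.sqrt (dot w w))^-1 *: w.

Lemma unit_vector_unit w : 0 < dot w w -> dot (unit_vector w) (unit_vector w) = 1.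
Proof.
move=> w0; rewrite dotZl dotZr mulrA -invfM -expr2 sqr_sqrtr; last exact: ltW.
by rewrite mulVf// gt_eqF.
Qed.

Lemma smoothD (W : normedModType R) U (f g : V -> W) : open U ->
  smooth_on U f -> smooth_on U g -> smooth_on U (fun u => f u + g u).
Proof. by move=> oU Cf Cg k; exact: class_CD oU (Cf k) (Cg k). Qed.

Lemma smoothB (W : normedModType R) U (f g : V -> W) : open U ->
  smooth_on U f -> smooth_on U g -> smooth_on U (fun u => f u - g u).
Proof. by move=> oU Cf Cg k; exact: class_CB oU (Cf k) (Cg k). Qed.

Lemma smoothZ U (f : V -> R) (g : V -> 'rV[R]_5) : open U ->
  smooth_on U f -> smooth_on U g -> smooth_on U (fun u => f u *: g u).
Proof. by move=> oU Cf Cg k; exact: class_CZ_rV oU (Cf k) (Cg k). Qed.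

Lemma smooth_dot U (f g : V -> 'rV[R]_5) : open U ->
  smooth_on U f -> smooth_on U g -> smooth_on U (fun u => dot (f u) (g u)).
Proof. by move=> oU Cf Cg k; exact: class_C_dot oU (Cf k) (Cg k). Qed.

Lemma smooth_cst (W : normedModType R) U (c : W) : smooth_on U (fun=> c : W).
Proof. by move=> k; exact: class_C_cst. Qed.

Lemma smooth_invsqrt U (f : V -> R) : open U -> (forall u, U u -> 0 < f u) ->
  smooth_on U f -> smooth_on U (fun u => (Num.sqrt (f u))^-1).
Proof.
move=> oU f0 Cf k.
have Cs : class_C k U (fun u => Num.sqrt (f u)).
  exact: (class_C_comp1 oU f0 (Cf k) (@smooth_sqrt R k)).
by apply: (class_CV oU _ Cs) => u /f0 fu; rewrite gt_eqF// sqrtr_gt0.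
Qed.

Lemma smooth_unit_vector U (f : V -> 'rV[R]_5) : open U ->
  (forall u, U u -> 0 < dot (f u) (f u)) ->
  smooth_on U f -> smooth_on U (fun u => unit_vector (f u)).
Proof.
move=> oU f0 Cf; apply: smoothZ => //.
by apply: smooth_invsqrt => //; exact: smooth_dot.
Qed.

End LocalFrame.

Section Frame.
Context {R : realType} {V : normedModType R}.
Variables (U : set V) (X N : V -> 'rV[R]_5) (k1 k2 k3 : V -> R).
Hypotheses (LH : local_hypersurface U X N) (LP : local_principal U X N k1 k2 k3).

Let oU : open U. Proof. by case: LH. Qed.
Let CX : smooth_on U X. Proof. by case: LH. Qed.
Let CN : smooth_on U N. Proof. by case: LH. Qed.

Lemma smooth_angle : smooth_on U (angle N).
Proof. exact: smooth_dot_cst. Qed.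

Lemma slope2_gt0 u : U u -> 0 < 1 - angle N u ^+ 2.
Proof.
move=> Uu; have [_ _ _ [t [e2 [e3 [s [dE [t0 _ _] _ _ _]]]]]] := LP Uu.
exact: (height_t_gt0 (shape_datum_at LH Uu) dE t0).
Qed.

Lemma smooth_inv_slope : smooth_on U (fun u => (slope N u)^-1).
Proof.
apply: smooth_invsqrt => //; first exact: slope2_gt0.
apply: smoothB => //; first exact: smooth_cst.
by move=> k; exact: class_CM oU (smooth_angle k) (smooth_angle k).
Qed.

Lemma smooth_conormal : smooth_on U (conormal N).
Proof.
apply: smoothZ => //; first exact: smooth_inv_slope.
apply: smoothB => //; apply: smoothZ => //; [exact: smooth_angle|exact: smooth_cst].
Qed.

Lemma smooth_axis (k : V -> R) x : smooth_on U k -> smooth_on U (axis X N k x).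
Proof.
move=> Ck; have Cw : smooth_on U (fun u => 'D_x N u + k u *: 'D_x X u).
  apply: smoothD => //; first exact: smooth_derive.
  by apply: smoothZ => //; exact: smooth_derive.
have Cf := smooth_foot oU CX; have Cn := smooth_conormal.
have Cd : smooth_on U (fun=> d_x5 : 'rV[R]_5) by exact: smooth_cst.
by do 3! [apply: smoothB => //; last (apply: smoothZ => //; exact: smooth_dot)].
Qed.

(** The derivative of the factor 1 / tau multiplies N - sigma d_x5, which is
    orthogonal to z, and the derivative of sigma multiplies d_x5. *)
Lemma derive_conormal_dot z u v : U u ->
  dot (N u) z = 0 -> dot d_x5 z = 0 ->
  dot ('D_v (conormal N) u) z = (slope N u)^-1 * dot ('D_v N u) z.
Proof.
move=> Uu Nz dz.
have Cdz : smooth_on U (fun u => angle N u *: (d_x5 : 'rV[R]_5)).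
  by apply: smoothZ => //; [exact: smooth_angle|exact: smooth_cst].
have CNd := smoothB oU CN Cdz.
have Ddz : 'D_v (fun u => angle N u *: (d_x5 : 'rV[R]_5)) u =
    'D_v (angle N) u *: d_x5 + angle N u *: 'D_v (fun=> d_x5) u.
  exact: (derive_scale v oU Uu smooth_angle (@smooth_cst _ _ _ U d_x5)).
have D1 : 'D_v (fun u => N u - angle N u *: d_x5) u =
    'D_v N u - 'D_v (fun u => angle N u *: (d_x5 : 'rV[R]_5)) u.
  by apply: deriveB; apply: diff_derivable; [exact: (differentiable_class_C Uu CN)
    |exact: (differentiable_class_C Uu Cdz)].
have E := derive_scale v oU Uu smooth_inv_slope CNd.
have alg (a b c e : R) (n dN dc : 'rV[R]_5) : dot n z = 0 -> dc = 0 ->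
    dot (a *: (n - c *: d_x5) + b *: (dN - (e *: d_x5 + c *: dc))) z = b * dot dN z.
  by move=> nz ->; rewrite !dot_lin nz dz; ring.
have dcst : 'D_v (fun=> d_x5 : 'rV[R]_5) u = 0 by exact: derive_cst.
apply: etrans (congr1 (fun w => dot w z) E) _.
apply: etrans (congr1 (fun w => dot (_ + _ *: w) z) D1) _.
apply: etrans (congr1 (fun w => dot (_ + _ *: (_ - w)) z) Ddz) _.
exact: alg Nz dcst.
Qed.

(** The axes have the direction of the differential of X at e2, resp. e3, at
    every point, and they do not vanish where x is that eigenvector itself. *)
Lemma axis_directions x u : U u -> forall t e2 e3 s,
  d_x5 = 'd X u t + s *: N u -> [/\ t != 0, e2 != 0 & e3 != 0] ->
  principal_at X N u (k1 u) t -> principal_at X N u (k2 u) e2 ->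
  principal_at X N u (k3 u) e3 ->
  [/\ exists b, axis X N k3 x u = b *: 'd X u e2,
      exists b, axis X N k2 x u = b *: 'd X u e3,
      0 < dot (axis X N k3 e2 u) (axis X N k3 e2 u) &
      0 < dot (axis X N k2 e3 u) (axis X N k2 e3 u)].
Proof.
move=> Uu t e2 e3 s dE [t0 e20 e30] p1 p2 p3; have AB := shape_datum_at LH Uu.
have [k12 k13 k23 _] := LP Uu.
have k32 : k3 u != k2 u by rewrite eq_sym.
have AE k y : axis X N k y u =
    horizontal_part (foot X u) (conormal N u) ('d N u y + k u *: 'd X u y).
  exact: (congr2 (fun a b => horizontal_part (foot X u) (conormal N u) (a + k u *: b))
    (deriveE y (differentiable_class_C Uu CN)) (deriveE y (differentiable_class_C Uu CX))).
split; rewrite ?AE.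
- exact: (horizontal_part_parallel AB dE t0 e20 e30 p1 p2 p3 k12 k13 k23).
- exact: (horizontal_part_parallel AB dE t0 e30 e20 p1 p3 p2 k13 k12 k32).
- have E : horizontal_part (foot X u) (conormal N u) ('d N u e2 + k3 u *: 'd X u e2) =
      (k3 u - k2 u) *: 'd X u e2 := horizontal_part_e2 AB dE t0 p1 p2 p3 k12 k13.
  rewrite E dotZl dotZr mulrA pmulr_lgt0 ?(dot_A_gt0 AB)// -expr2 lt0r sqr_ge0 andbT.
  by rewrite sqrf_eq0 subr_eq0.
- have E : horizontal_part (foot X u) (conormal N u) ('d N u e3 + k2 u *: 'd X u e3) =
      (k2 u - k3 u) *: 'd X u e3 := horizontal_part_e2 AB dE t0 p1 p3 p2 k13 k12.
  rewrite E dotZl dotZr mulrA pmulr_lgt0 ?(dot_A_gt0 AB)// -expr2 lt0r sqr_ge0 andbT.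
  by rewrite sqrf_eq0 subr_eq0.
Qed.

Hypotheses (Ck2 : smooth_on U k2) (Ck3 : smooth_on U k3).
Hypotheses (Fk2 : follows U (height X) k2) (Fk3 : follows U (height X) k3).

(** The relation d sigma = - k1 dh makes every smooth function of sigma follow
    the height. *)
Lemma follows_inv_slope : follows U (height X) (fun u => (slope N u)^-1).
Proof.
have Fa : follows U (height X) (angle N).
  by move=> u Uu; exists (- k1 u) => v; exact: derive_angle LH LP Uu.
have Ca := smooth_angle.
have Faa := followsM Ca Ca Fa Fa.
have Caa : smooth_on U (fun u => angle N u * angle N u).
  by move=> k; exact: class_CM oU (Ca k) (Ca k).
apply: (follows_comp1 (W := [set x | x < 1]) (g := fun x => (Num.sqrt (1 - x))^-1) _ Caa _ Faa).
  by move=> u Uu /=; rewrite -expr2 -subr_gt0; exact: slope2_gt0.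
have oW : open [set x : R | x < 1] by exact: open_lt.
apply: (smooth_invsqrt (f := fun x : R => 1 - x)) => //.
  by move=> x /= x1; rewrite subr_gt0.
apply: smoothB => //; first exact: smooth_cst.
by move=> k; apply: (@class_C_lin _ k R R _ idfun) => x; exact: cvg_id.
Qed.

(** The frame (n, nu, z2, z3, d_x5), with z2 and z3 the normalized axes, on a
    neighbourhood where these do not vanish; it satisfies the hypotheses of
    [cartan_identity]. *)
Lemma local_frame u0 : U u0 ->
  exists U' (F : 'I_5 -> V -> 'rV[R]_5),
  let l u := k2 u * (slope N u)^-1 in let m u := k3 u * (slope N u)^-1 in
  [/\ [/\ open U', U' u0 & U' `<=` U], frame_on U' F, F ord0 = foot X,
      smooth_on U' m &
   forall u, U' u -> [/\ F ord_max u = d_x5,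
    forall v, connection F o1 o2 v u = - l u * connection F ord0 o2 v u /\
              connection F o1 o3 v u = - m u * connection F ord0 o3 v u,
    forall v, connection F o2 o3 v u = 0 /\
              'D_v m u = (1 + m u ^+ 2) * connection F ord0 o1 v u,
    l u * m u = -1 &
    forall v, connection F ord0 o1 v u =
              - (angle N u * (slope N u)^-1) * 'D_v (height X) u]].
Proof.
move=> Uu0; have [_ _ _ [x1 [x2 [x3 [s0 [dE0 x0 p10 p20 p30]]]]]] := LP Uu0.
have [_ _ q20 q30] := axis_directions x1 Uu0 dE0 x0 p10 p20 p30.
pose Z2 := axis X N k3 x2; pose Z3 := axis X N k2 x3.
have CZ2 : smooth_on U Z2 by exact: smooth_axis.
have CZ3 : smooth_on U Z3 by exact: smooth_axis.
have Cq2 := smooth_dot oU CZ2 CZ2; have Cq3 := smooth_dot oU CZ3 CZ3.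
pose U1 := U `&` (fun u => dot (Z2 u) (Z2 u)) @^-1` [set x | 0 < x].
have oU1 : open U1.
  by apply: open_preimage => // a Ua; exact: (Cq2 0%N a Ua).
pose U' := U1 `&` (fun u => dot (Z3 u) (Z3 u)) @^-1` [set x | 0 < x].
have oU' : open U'.
  by apply: open_preimage => // a [Ua _]; exact: (Cq3 0%N a Ua).
have U'u0 : U' u0 := conj (conj Uu0 q20) q30.
have U'U : U' `<=` U by move=> u [[]].
have sub (W : normedModType R) (f : V -> W) : smooth_on U f -> smooth_on U' f.
  exact: smooth_sub.
pose F (i : 'I_5) (u : V) : 'rV[R]_5 :=
  [:: foot X u; conormal N u; unit_vector (Z2 u); unit_vector (Z3 u); d_x5]`_i.
have Cz2 : smooth_on U' (fun u => unit_vector (Z2 u)).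
  exact: (smooth_unit_vector oU' (fun u U'u => proj2 (proj1 U'u)) (sub _ _ CZ2)).
have Cz3 : smooth_on U' (fun u => unit_vector (Z3 u)).
  exact: (smooth_unit_vector oU' (fun u U'u => proj2 U'u) (sub _ _ CZ3)).
(* At each point the eigenvectors t, e2, e3 supply the directions on which the
   connection forms are evaluated. *)
have pointwise u : U' u -> exists t e2 e3,
    [/\ orthonormal_family (F ^~ u),
      forall v, dot ('d N u v) (F o2 u) = - k2 u * dot ('d X u v) (F o2 u),
      forall v, dot ('d N u v) (F o3 u) = - k3 u * dot ('d X u v) (F o3 u),
      [/\ [/\ dot ('d X u t) (F o2 u) = 0, dot ('d X u e3) (F o2 u) = 0,
               dot ('d X u t) (F o3 u) = 0 & dot ('d X u e2) (F o3 u) = 0],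
          dot ('d X u e2) (F o2 u) != 0, dot ('d X u e3) (F o3 u) != 0 &
          forall v, exists a b c, v = a *: t + b *: e2 + c *: e3] &
      dot ('d X u e2) d_x5 = 0 /\ dot ('d X u e3) d_x5 = 0].
  move=> U'u; have Uu := U'U u U'u; have AB := shape_datum_at LH Uu.
  have [k12 k13 k23 [t [e2 [e3 [s [dE e0 p1 p2 p3]]]]]] := LP Uu.
  have [[b2 E2] _ _ _] := axis_directions x2 Uu dE e0 p1 p2 p3.
  have [_ [b3 E3] _ _] := axis_directions x3 Uu dE e0 p1 p2 p3.
  have [t0 e20 e30] := e0.
  exists t, e2, e3.
  have z2E : unit_vector (Z2 u) = ((Num.sqrt (dot (Z2 u) (Z2 u)))^-1 * b2) *: 'd X u e2.
    by rewrite -scalerA -E2.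
  have z3E : unit_vector (Z3 u) = ((Num.sqrt (dot (Z3 u) (Z3 u)))^-1 * b3) *: 'd X u e3.
    by rewrite -scalerA -E3.
  have [[_ z20] z30] := U'u.
  have [onF B2 B3 H] := unit_principal_frame AB dE t0 p1 p2 p3 k12 k13 k23 z2E z3E
    (unit_vector_unit z20) (unit_vector_unit z30).
  split; [exact: onF|exact: B2|exact: B3|exact: H|].
  exact: (height_principal AB dE p1 p2 p3 k12 k13).
have frF : frame_on U' F.
  split; last by move=> u /pointwise[t [e2 [e3 []]]].
  apply: all5; rewrite /F /=.
  - by apply: sub; exact: smooth_foot.
  - by apply: sub; exact: smooth_conormal.
  - exact: Cz2.
  - exact: Cz3.
  - exact: smooth_cst.
have [CF onF] := frF.
have F4 u : U' u -> F ord_max u = d_x5 by [].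
pose l u := k2 u * (slope N u)^-1; pose m u := k3 u * (slope N u)^-1.
have Cis : smooth_on U' (fun u => (slope N u)^-1) by apply: sub; exact: smooth_inv_slope.
have Cl : smooth_on U l by move=> k; exact: class_CM oU (Ck2 k) (smooth_inv_slope k).
have Cm : smooth_on U m by move=> k; exact: class_CM oU (Ck3 k) (smooth_inv_slope k).
have Fl : follows U (height X) l := followsM Ck2 smooth_inv_slope Fk2 follows_inv_slope.
have Fm : follows U (height X) m := followsM Ck3 smooth_inv_slope Fk3 follows_inv_slope.
have DXE v u : U u -> 'D_v X u = 'd X u v.
  by move=> Uu; exact: (deriveE v (differentiable_class_C Uu CX)).
have DNE v u : U u -> 'D_v N u = 'd N u v.
  by move=> Uu; exact: (deriveE v (differentiable_class_C Uu CN)).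
have DhE v u : U u -> 'D_v (height X) u = dot ('d X u v) d_x5.
  by move=> Uu; apply: etrans (derive_height v Uu CX) _; rewrite DXE.
(* The horizontal part n of X has the differential of X as its own, up to d_x5. *)
have c0 j v u : U' u -> dot (F j u) d_x5 = 0 ->
    connection F ord0 j v u = dot ('d X u v) (F j u).
  move=> U'u Fd; have Uu := U'U u U'u; rewrite connectionE.
  apply: etrans (congr1 (fun w => dot w (F j u)) (derive_foot v oU Uu CX)) _.
  rewrite dotBl dotZl (dotC d_x5) Fd mulr0 subr0.
  by congr (dot _ _); exact: DXE.
have Fd2 u : U' u -> dot (F o2 u) d_x5 = 0 by move=> /onF /(_ o2 ord_max).
have Fd3 u : U' u -> dot (F o3 u) d_x5 = 0 by move=> /onF /(_ o3 ord_max).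
have slope0 u : U u -> (slope N u)^-1 != 0.
  by move=> Uu; rewrite invr_eq0 gt_eqF// sqrtr_gt0 slope2_gt0.
have NF j u : U' u -> dot (F o1 u) (F j u) = 0 -> dot (F j u) d_x5 = 0 ->
    dot (N u) (F j u) = 0.
  move=> U'u n1 nd; have := etrans (esym (dotZl _ _ _)) n1.
  rewrite dotBl dotZl (dotC d_x5) nd mulr0 subr0 => /eqP.
  by rewrite mulf_eq0 (negbTE (slope0 u (U'U u U'u))) => /eqP.
have c1 j k v u : U' u -> dot (F o1 u) (F j u) = 0 -> dot (F j u) d_x5 = 0 ->
    dot ('d N u v) (F j u) = - k * dot ('d X u v) (F j u) ->
    connection F o1 j v u = - (k * (slope N u)^-1) * connection F ord0 j v u.
  move=> U'u n1 nd E; have Uu := U'U u U'u; rewrite (c0 j v u U'u nd) connectionE.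
  have dF : dot d_x5 (F j u) = 0 by rewrite dotC.
  apply: etrans (derive_conormal_dot v Uu (NF j u U'u n1 nd) dF) _.
  have alg (a x y : R) : x = - k * y -> a * x = - (k * a) * y by move=> ->; ring.
  apply: alg; exact: etrans (congr1 (fun w => dot w (F j u)) (DNE v u Uu)) E.
have H2 u v : U' u -> connection F o1 o2 v u = - l u * connection F ord0 o2 v u.
  move=> U'u; have [t [e2 [e3 [on B2 _ _ _]]]] := pointwise u U'u.
  exact: c1 U'u (on o1 o2) (Fd2 u U'u) (B2 v).
have H3 u v : U' u -> connection F o1 o3 v u = - m u * connection F ord0 o3 v u.
  move=> U'u; have [t [e2 [e3 [on _ B3 _ _]]]] := pointwise u U'u.
  exact: c1 U'u (on o1 o3) (Fd3 u U'u) (B3 v).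
have H01 u v : U' u -> connection F ord0 o1 v u =
    - (angle N u * (slope N u)^-1) * 'D_v (height X) u.
  move=> U'u; have Uu := U'U u U'u; rewrite (c0 o1 v u U'u); last exact: (onF u U'u o1 ord_max).
  have [_ [_ XN _] _ _] := shape_datum_at LH Uu.
  rewrite (DhE v u Uu) [F o1 u]/(conormal N u) dotZr dotBr dotZr XN sub0r.
  by rewrite mulrN mulrA [(slope _ _)^-1 * _]mulrC mulNr.
have lm u : U' u -> l u != m u.
  move=> U'u; have Uu := U'U u U'u; have [_ _ k23 _] := LP Uu.
  by rewrite (inj_eq (mulIf (slope0 u Uu))).
pose dh u v := 'D_v (height X) u.
have A1 u : U' u -> exists r, forall v, connection F ord0 o1 v u = r * dh u v.
  by move=> U'u; eexists => v; exact: H01.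
have A2 u : U' u -> exists r, forall v, 'D_v l u = r * dh u v by move=> /U'U; exact: Fl.
have A3 u : U' u -> exists r, forall v, 'D_v m u = r * dh u v by move=> /U'U; exact: Fm.
have A4 u : U' u -> exists t e2 e3,
    [/\ dh u e2 = 0 /\ dh u e3 = 0,
        connection F ord0 o2 t u = 0 /\ connection F ord0 o2 e3 u = 0,
        connection F ord0 o3 t u = 0 /\ connection F ord0 o3 e2 u = 0,
        connection F ord0 o2 e2 u != 0 /\ connection F ord0 o3 e3 u != 0 &
        forall v, exists a b c, v = a *: t + b *: e2 + c *: e3].
  move=> U'a; have Ua := U'U u U'a.
  have [t [e2 [e3 [on _ _ [[t2 e32 t3 e23] e22 e33 span] [h2 h3]]]]] := pointwise u U'a.
  exists t, e2, e3.
  rewrite !(c0 o2 _ u U'a (Fd2 u U'a)) !(c0 o3 _ u U'a (Fd3 u U'a)).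
  split; [split|by split|by split|by split|exact: span].
    by apply: etrans (DhE e2 u Ua) _.
  by apply: etrans (DhE e3 u Ua) _.
have C := cartan_identity oU' frF (sub _ _ Cl) (sub _ _ Cm) F4 lm H2 H3 A1 A2 A3 A4.
exists U', F; split; [by split|exact: frF|by []|exact: sub Cm|].
move=> u U'u.
have [] := C u U'u.
move=> C23 _ Dm lmu; split; [exact: F4|move=> v|move=> v|exact: lmu|move=> v].
- by split; [exact: H2|exact: H3].
- by split; [exact: C23|exact: Dm].
- exact: H01.
Qed.

End Frame.

(** * Torus coordinates *)

Section LocalCoordinates.
Context {R : realType} {V : normedModType R}.
Implicit Types (U : set V) (X N : V -> 'rV[R]_5).

(** The functions th, v, w describe the horizontal part of X in the orthonormal
    basis p by a pair of circles of radii cos th and sin th.  The formula for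
    the differential of th gives the profile curve unit speed in [arc_length_chart]. *)
Definition torus_coordinates X N u0 r p (th v w : V -> R) :=
  [/\ orthonormal_family p, p ord_max = d_x5 :> 'rV[R]_5,
      [/\ smooth_on (ball u0 r) th, smooth_on (ball u0 r) v & smooth_on (ball u0 r) w] &
   forall u, ball u0 r u ->
    [/\ 0 < cos (th u), 0 < sin (th u),
      forall x, 'D_x th u = angle N u * (slope N u)^-1 * 'D_x (height X) u &
      forall i, dot (X u) (p i) =
        [:: cos (th u) * cos (v u); cos (th u) * sin (v u);
            sin (th u) * cos (w u); sin (th u) * sin (w u); height X u]`_i]].

Lemma local_principal_sub U U' X N k1 k2 k3 : U' `<=` U ->
  local_principal U X N k1 k2 k3 -> local_principal U' X N k1 k2 k3.
Proof. by move=> UU' LP u /UU'; exact: LP. Qed.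

Lemma local_principal_swap U X N k1 k2 k3 :
  local_principal U X N k1 k2 k3 -> local_principal U X N k1 k3 k2.
Proof.
move=> LP u Uu; have [k12 k13 k23 [t [e2 [e3 [s [dE [t0 e20 e30] p1 p2 p3]]]]]] := LP u Uu.
by split=> //; [rewrite eq_sym|exists t, e3, e2, s].
Qed.

(** If k2 is positive then l is positive, and l m = - 1 makes m negative; this
    puts the angle atan (- m) in the first quadrant. *)
Lemma torus_coordinates_pos U X N k1 k2 k3 u0 :
  local_hypersurface U X N -> local_principal U X N k1 k2 k3 -> U u0 ->
  smooth_on U k2 -> smooth_on U k3 ->
  follows U (height X) k2 -> follows U (height X) k3 -> 0 < k2 u0 ->
  exists r p th v w, [/\ 0 < r, ball u0 r `<=` U & torus_coordinates X N u0 r p th v w].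
Proof.
move=> LH LP Uu0 C2 C3 F2 F3 k20.
have [U' [F [[oU' U'u0 U'U] frF F0 Cm H]]] := local_frame LH LP C2 C3 F2 F3 Uu0.
set l := fun u => k2 u * (slope N u)^-1; set m := fun u => k3 u * (slope N u)^-1.
have m0 : m u0 < 0.
  have [_ _ _ lm _] := H u0 U'u0; rewrite ltNge; apply/negP => m0.
  have l0 : 0 < l u0 by rewrite mulr_gt0// invr_gt0 sqrtr_gt0 (slope2_gt0 LH LP).
  by have := mulr_ge0 (ltW l0) m0; rewrite lm; lra.
pose U'' := U' `&` m @^-1` [set x | x < 0].
have oU'' : open U''.
  by apply: open_preimage => [//| |a U'a]; [exact: open_lt|exact: (Cm 0%N a U'a)].
have U''U' : U'' `<=` U' by move=> u [].
have [||||||||||r [p [th [v [w [r0 rU onp p4 [Cth Cv Cw Hr]]]]]]] :=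
  @adapted_coordinates R V U'' F l m u0 oU''.
- by split.
- exact: frame_on_sub frF.
- exact: smooth_sub Cm.
- by move=> u /U''U' /H[].
- by move=> u v /U''U' /H[_ /(_ v)[]].
- by move=> u v /U''U' /H[_ /(_ v)[]].
- by move=> u v /U''U' /H[_ _ /(_ v)[]].
- by move=> u /U''U' /H[].
- by move=> u [].
- by move=> u v /U''U' /H[_ _ /(_ v)[]].
exists r, p, th, v, w; split=> //; first by move=> u /rU /U''U' /U'U.
split=> // u bu; have [cth sth Dth E] := Hr u bu.
have [_ _ _ _ H01] := H u (U''U' u (rU u bu)).
split=> // [x|i]; first by rewrite Dth H01 mulNr opprK.
have -> : X u = F ord0 u + height X u *: d_x5 by rewrite F0 subrK.
rewrite dotDl dotZl -p4 onp; move: i (E i); apply: all5 => /= ->;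
  rewrite ?mulr0 ?addr0// ?mulr1 ?add0r//.
Qed.

(** The function f is smooth along the range of k1, hence agrees there with a
    smooth function on an open set. *)
Lemma smooth_relation U X (k1 k : V -> R) (A : set R) f u0 :
  open U -> U u0 -> smooth_on U k1 -> follows U (height X) k1 ->
  (forall u, U u -> A (k1 u)) -> smooth_along A f -> (forall u, U u -> k u = f (k1 u)) ->
  exists U', [/\ open U', U' u0, U' `<=` U, smooth_on U' k & follows U' (height X) k].
Proof.
move=> oU Uu0 C1 F1 UA Cf kE; have [W [G [oW Wk CG GE]]] := Cf _ (UA u0 Uu0).
pose U' := U `&` k1 @^-1` W.
have oU' : open U' by apply: open_preimage => // a Ua; exact: (C1 0%N a Ua).
have U'U : U' `<=` U by move=> u [].
have E u : U' u -> G (k1 u) = k u.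
  by move=> [Uu Wu]; rewrite kE// GE//; exact: UA.
have U'W u : U' u -> W (k1 u) by move=> [].
have C1' := smooth_sub U'U C1.
have F1' : follows U' (height X) k1 by move=> u /U'U; exact: F1.
exists U'; split=> //.
  move=> n; exact: (class_C_eq oU' E (class_C_comp1 oU' U'W (C1' n) (CG n))).
exact: (follows_eq oU' E (follows_comp1 U'W C1' CG F1')).
Qed.

(** By l m = - 1, exactly one of k2 and k3 is positive; if it is k3, the two
    principal curvatures are exchanged. *)
Lemma torus_coordinates_exist U X N k1 k2 k3 (A : set R) f1 f2 u0 :
  local_hypersurface U X N -> local_principal U X N k1 k2 k3 -> U u0 ->
  (forall u, U u -> A (k1 u)) -> smooth_along A f1 -> smooth_along A f2 ->
  (forall u, U u -> k2 u = f1 (k1 u)) -> (forall u, U u -> k3 u = f2 (k1 u)) ->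
  exists r p th v w, [/\ 0 < r, ball u0 r `<=` U & torus_coordinates X N u0 r p th v w].
Proof.
move=> LH LP Uu0 UA Cf1 Cf2 E2 E3.
have [U1 [oU1 U1u0 U1U C1 F1]] := smooth_k1 LH LP Uu0.
have [|u /U1U|U2 [oU2 U2u0 U2U1 C2 F2]] :=
  smooth_relation oU1 U1u0 C1 F1 _ Cf1 (k := k2).
- by move=> u /U1U; exact: UA.
- exact: E2.
have [|u /U1U|U3 [oU3 U3u0 U3U1 C3 F3]] :=
  smooth_relation oU1 U1u0 C1 F1 _ Cf2 (k := k3).
- by move=> u /U1U; exact: UA.
- exact: E3.
pose U4 := U2 `&` U3; have oU4 : open U4 by exact: openI.
have U4u0 : U4 u0 by split.
have U42 : U4 `<=` U2 by move=> u [].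
have U43 : U4 `<=` U3 by move=> u [].
have U4U : U4 `<=` U by move=> u /U42 /U2U1 /U1U.
have {}LH := local_hypersurface_sub oU4 U4U LH.
have {}LP := local_principal_sub U4U LP.
have {}C2 := smooth_sub U42 C2; have {}C3 := smooth_sub U43 C3.
have {}F2 : follows U4 (height X) k2 by move=> u /U42; exact: F2.
have {}F3 : follows U4 (height X) k3 by move=> u /U43; exact: F3.
have sub4 r : ball u0 r `<=` U4 -> ball u0 r `<=` U by move=> b u /b /U4U.
have [U' [F [[oU' U'u0 U'U] frF F0 Cm H]]] := local_frame LH LP C2 C3 F2 F3 U4u0.
have [_ _ _ lm _] := H u0 U'u0.
have is0 : 0 < (slope N u0)^-1 by rewrite invr_gt0 sqrtr_gt0 (slope2_gt0 LH LP).
have [k20|k20] := ltP 0 (k2 u0).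
  have [r [p [th [v [w [r0 rU T]]]]]] := torus_coordinates_pos LH LP U4u0 C2 C3 F2 F3 k20.
  by exists r, p, th, v, w; split=> //; exact: sub4.
have k30 : 0 < k3 u0.
  rewrite ltNge; apply/negP => k30.
  have := mulr_le0 k20 k30; have := mulr_gt0 is0 is0; move: lm.
  move: (slope N u0)^-1 (k2 u0) (k3 u0) => s x y lm ss xy.
  have := mulr_ge0 (ltW ss) xy; nra.
have [r [p [th [v [w [r0 rU T]]]]]] :=
  torus_coordinates_pos LH (local_principal_swap LP) U4u0 C3 C2 F3 F2 k30.
by exists r, p, th, v, w; split=> //; exact: sub4.
Qed.

End LocalCoordinates.

(** * Functions of one coordinate *)

Section Primitive.
Context {R : realType}.

(** The primitive is the integral from the left end of the closed interval of
    radius e / 2, on which g is integrable because it is continuous on the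
    larger ball. *)
Lemma primitive_exists (g : R -> R) (x0 e : R) : 0 < e ->
  (forall x, ball x0 e x -> {for x, continuous g}) ->
  exists S : R -> R, forall x, ball x0 (e / 2) x -> is_derive x (1 : R) S (g x).
Proof.
move=> e0 cg; pose a := x0 - e / 2; pose b := x0 + e / 2.
have sub x : x \in `[a, b] -> ball x0 e x.
  by rewrite in_itv/= ball_itv/= in_itv/= /a /b => /andP[ax xb]; apply/andP; split; lra.
have int : lebesgue_measure.-integrable `[a, b]%classic (EFin \o g).
  apply: continuous_compact_integrable; first exact: segment_compact.
  by apply: continuous_in_subspaceT => x /[!inE] xab; apply/cg/sub.
exists (fun x => \int[lebesgue_measure]_(t in `[a, x]) g t) => x.
rewrite ball_itv/= in_itv/= => /andP[ax xb].
have xab : x \in `[a, b] by rewrite in_itv/= !ltW.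
have [dS ES] := continuous_FTC1_closed xb int ax (cg x (sub x xab)).
by apply: DeriveDef; [exact: dS|exact: etrans (esym (derive1E _ _)) ES].
Qed.

End Primitive.

Section FunctionsOfFirstCoordinate.
Context {R : realType} {n : nat}.
Implicit Types (O : set 'rV[R]_n.+1) (Phi Xi : 'rV[R]_n.+1 -> 'rV[R]_n.+1).

Definition first_line (b : 'rV[R]_n.+1) (x : R) : 'rV[R]_n.+1 :=
  b + (x - b 0 0) *: delta_mx 0 0.

Lemma first_line00 b x : first_line b x 0 0 = x.
Proof. by rewrite !mxE !eqxx mulr1 addrC subrK. Qed.

Lemma first_line_ball (b : 'rV[R]_n.+1) e x : ball (b 0 0) e x -> ball b e (first_line b x).
Proof.
rewrite -!ball_normE /= => bx; rewrite /first_line opprD addNKr normrN.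
rewrite (le_lt_trans _ bx)// normrZ distrC ler_piMr//.
by apply: normM_le => // i j; rewrite mxE; case: (_ && _); rewrite ?normr1 ?normr0.
Qed.

Lemma coord_ball (b y : 'rV[R]_n.+1) e i : ball b e y -> ball (b 0 i) e (y 0 i : R).
Proof.
rewrite -!ball_normE /= => /(le_lt_trans (normM_coord (b - y) 0 i)).
by rewrite !mxE.
Qed.

Context (O : set 'rV[R]_n.+1) (Phi Xi : 'rV[R]_n.+1 -> 'rV[R]_n.+1).
Context (b : 'rV[R]_n.+1) (e : R) (q : 'rV[R]_n.+1 -> R) (rho : 'rV[R]_n.+1 -> R).
Hypothesis inv : local_inverse Phi O b e Xi.
Hypotheses (CPhi : smooth_on O Phi) (Cq : smooth_on O q) (oO : open O).
Hypothesis Dq : forall u, O u -> forall d,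
  'D_d q u = rho u * 'D_d (fun a => Phi a 0 0) u.

Lemma smooth_comp_inverse : smooth_on (ball b e) (q \o Xi).
Proof.
have [_ _ XiP CXi] := inv; move=> k.
have oB : open (ball b e) by exact: ball_open.
by apply: (class_C_comp_rV oB _ (CXi k) (Cq k)) => y /XiP[].
Qed.

Lemma derive_comp_inverse y d : ball b e y ->
  'D_d (q \o Xi) y = rho (Xi y) * d 0 0.
Proof.
move=> yb; have [_ _ XiP CXi] := inv; have [OXi PXi] := XiP y yb.
have oB : open (ball b e) by exact: ball_open.
have dXi := differentiable_class_C yb CXi.
have dq := differentiable_class_C OXi Cq.
have CP0 : smooth_on O (fun a => Phi a 0 0).
  by move=> k; exact: class_C_coord 0 0 oO (CPhi k).
have dP := differentiable_class_C OXi CP0.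
apply: etrans (derive_comp d dXi dq) _; apply: etrans (Dq OXi _) _.
congr (_ * _); apply: etrans (esym (derive_comp d dXi dP)) _.
have E : 'D_d ((fun a => Phi a 0 0) \o Xi) y = 'D_d (fun a : 'rV[R]_n.+1 => a 0 0) y.
  apply: near_eq_derive; apply: filterS (near_open oB yb) => z zb /=.
  by have [_ ->] := XiP z zb.
apply: etrans E _.
apply: etrans (esym (@derive_mx_coord R _ _ _ id y d 0 0 _)) _; first exact: ex_diff.
by rewrite derive_id.
Qed.

(** If dq is proportional to the differential of the first component of Phi,
    then q is a function of that component: in the coordinates Phi its
    derivative vanishes along the segment joining points of equal first
    coordinate, which stays in the ball. *)
Lemma comp_inverse_eq y y' : ball b e y -> ball b e y' -> y 0 0 = y' 0 0 ->
  q (Xi y) = q (Xi y').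
Proof.
move=> yb yb' E; have C := smooth_comp_inverse.
have [t t01] := @mean_value R _ (q \o Xi) y (y' - y) (fun t t01 =>
  differentiable_class_C (ball_segment t01 yb yb') C).
rewrite (addrC y) subrK derive_comp_inverse; last exact: ball_segment.
by rewrite !mxE E subrr mulr0 => /eqP; rewrite subr_eq0 => /eqP.
Qed.

Let a x := q (Xi (first_line b x)).

(** The function of one variable is the restriction of q, in the coordinates
    Phi, to the line through the centre of the ball. *)
Lemma comp_inverse_first y : ball b e y -> q (Xi y) = a (y 0 0).
Proof.
move=> yb; apply: comp_inverse_eq => //; last by rewrite first_line00.
by apply: first_line_ball; exact: coord_ball.
Qed.

Lemma smooth_first_line : smooth_on setT (first_line b).
Proof.
move=> k; apply: class_CD; [exact: openT|exact: class_C_cst|].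
apply: class_CZl; first exact: openT.
apply: class_CB; [exact: openT| |exact: class_C_cst].
by apply: (@class_C_lin _ k R R _ idfun) => x; exact: cvg_id.
Qed.

Lemma smooth_first : smooth_on (ball (b 0 0) e) a.
Proof.
move=> k; have oB : open (ball (b 0 0) e) by exact: ball_open.
apply: (class_C_comp_rV (U' := ball b e) (f := first_line b) (g := q \o Xi) oB).
- exact: first_line_ball.
- exact: class_C_sub (smooth_first_line k).
- exact: smooth_comp_inverse.
Qed.

Lemma derive_first x : ball (b 0 0) e x -> derive1 a x = rho (Xi (first_line b x)).
Proof.
move=> bx; have yb := first_line_ball bx; rewrite derive1E.
have dl : differentiable (first_line b) x := differentiable_class_C (I : setT x) smooth_first_line.
have dc := differentiable_class_C yb smooth_comp_inverse.
have E0 : 'D_1 a x = 'D_('D_1 (first_line b) x) (q \o Xi) (first_line b x).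
  exact: (derive_comp (1 : R) dl dc).
rewrite E0; have E := derive_comp_inverse ('D_1 (first_line b) x) yb.
rewrite E.
suff -> : 'D_1 (first_line b) x = delta_mx 0 0 by rewrite mxE !eqxx mulr1.
have H : is_diff x (first_line b) (fun s => s *: delta_mx 0 0).
  have dsub : is_diff x (fun s : R => s - b 0 0) id.
    by have := is_diffB (is_diff_id x) (is_diff_cst (b 0 0) x); rewrite subr0.
  have dsc : is_diff (x - b 0 0) ( *:%R ^~ (delta_mx 0 0 : 'rV[R]_n.+1))
      ( *:%R ^~ (delta_mx 0 0 : 'rV[R]_n.+1)).
    exact: is_diff_scalel.
  have := is_diffD (is_diff_cst b x) (is_diff_comp dsub dsc).
  by rewrite add0r.
by rewrite (derive_is_diff (1 : R) H) scale1r.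
Qed.

End FunctionsOfFirstCoordinate.

(** * Arc length along the profile curve *)

Section ArcLength.
Context {R : realType}.

Definition triple (V : Type) (f g h : V -> R) (u : V) : 'rV[R]_3 :=
  \row_j [:: f u; g u; h u]`_j.

Lemma all3 (P : 'I_3 -> Prop) : P 0 -> P 1 -> P 2%:R -> forall i, P i.
Proof.
move=> P0 P1 P2 [[|[|[|//]]] i].
- by rewrite (_ : Ordinal i = 0)//; apply: val_inj.
- by rewrite (_ : Ordinal i = 1)//; apply: val_inj.
- by rewrite (_ : Ordinal i = 2%:R)//; apply: val_inj.
Qed.

Lemma smooth_triple (V : normedModType R) (U : set V) (f g h : V -> R) : open U ->
  smooth_on U f -> smooth_on U g -> smooth_on U h -> smooth_on U (triple f g h).
Proof.
move=> oU Cf Cg Ch k; apply: class_C_mx => // i; rewrite ord1; apply: all3.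
- by apply: class_C_eq (Cf k) => // a _; rewrite mxE.
- by apply: class_C_eq (Cg k) => // a _; rewrite mxE.
- by apply: class_C_eq (Ch k) => // a _; rewrite mxE.
Qed.

Lemma derive_triple_eq0 (V : normedModType R) (U : set V) (f g h : V -> R) u d :
  open U -> U u -> smooth_on U f -> smooth_on U g -> smooth_on U h ->
  'D_d (triple f g h) u = 0 -> [/\ 'D_d f u = 0, 'D_d g u = 0 & 'D_d h u = 0].
Proof.
move=> oU Uu Cf Cg Ch E.
have dT := differentiable_class_C Uu (smooth_triple oU Cf Cg Ch).
have c j : 'D_d (fun a => triple f g h a 0 j) u = 0.
  by apply: etrans (esym (derive_mx_coord d 0 j dT)) _; rewrite E mxE.
by split; [have := c 0|have := c 1|have := c 2%:R]; apply: etrans;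
  congr ('D_d _ u); apply/funext => a; rewrite mxE.
Qed.

Lemma jacobian_unit n (f : 'rV[R]_n -> 'rV[R]_n) u : differentiable f u ->
  (forall d, 'D_d f u = 0 -> d = 0) -> jacobian f u \in unitmx.
Proof.
move=> df inj; rewrite -row_free_unit; apply: inj_row_free => d E; apply: inj.
by rewrite deriveEjacobian.
Qed.

Lemma derive_mul_eq0 (V : normedModType R) (U : set V) (f g : V -> R) u d : U u ->
  smooth_on U f -> smooth_on U g -> 'D_d f u = 0 -> 'D_d g u = 0 ->
  'D_d (fun a => f a * g a) u = 0.
Proof.
move=> Uu Cf Cg Df Dg.
have df := @diff_derivable _ _ _ _ _ d (differentiable_class_C Uu Cf).
have dg := @diff_derivable _ _ _ _ _ d (differentiable_class_C Uu Cg).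
by apply: etrans (deriveM df dg) _; rewrite Df Dg !scaler0 addr0.
Qed.

(** A tangent vector on which dh, dv and dw vanish is annihilated by d th, which
    is proportional to dh, and hence by dX.  As X is an immersion, h, v, w
    are therefore local coordinates. *)
Lemma torus_coordinates_injective (V : normedModType R) X N (u0 : V) r p th v w u d :
  smooth_on (ball u0 r) X -> torus_coordinates X N u0 r p th v w -> ball u0 r u ->
  'D_d (height X) u = 0 -> 'D_d v u = 0 -> 'D_d w u = 0 -> 'D_d X u = 0.
Proof.
move=> CX [onp p4 [Cth Cv Cw] H] bu Dh Dv Dw.
have oB : open (ball u0 r) by exact: ball_open.
have [_ _ Dth _] := H u bu; have {}Dth : 'D_d th u = 0 by rewrite Dth Dh mulr0.
have Dcos f : smooth_on (ball u0 r) f -> 'D_d f u = 0 -> 'D_d (fun a => cos (f a)) u = 0.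
  by move=> Cf Df; rewrite (derive_cos_comp d bu Cf) Df mul0r.
have Dsin f : smooth_on (ball u0 r) f -> 'D_d f u = 0 -> 'D_d (fun a => sin (f a)) u = 0.
  by move=> Cf Df; rewrite (derive_sin_comp d bu Cf) Df mul0r.
have Cc f : smooth_on (ball u0 r) f -> smooth_on (ball u0 r) (fun a => cos (f a)).
  exact: smooth_cos_comp.
have Cs f : smooth_on (ball u0 r) f -> smooth_on (ball u0 r) (fun a => sin (f a)).
  exact: smooth_sin_comp.
suff c i : dot ('D_d X u) (p i) = 0.
  by rewrite (orthonormal_expansion ('D_d X u) onp) big1// => i _; rewrite c scale0r.
apply: etrans (esym (derive_dot_cst (p i) d bu CX)) _.
have E G : (forall a, ball u0 r a -> dot (X a) (p i) = G a) -> 'D_d G u = 0 ->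
    'D_d (fun a => dot (X a) (p i)) u = 0.
  move=> EG <-; apply: near_eq_derive.
  by apply: filterS (near_open oB bu) => a /EG.
move: i E; apply: all5 => E.
- apply: (E (fun a => cos (th a) * cos (v a))); first by move=> a /H[_ _ _ ->].
  exact: (derive_mul_eq0 bu (Cc _ Cth) (Cc _ Cv) (Dcos _ Cth Dth) (Dcos _ Cv Dv)).
- apply: (E (fun a => cos (th a) * sin (v a))); first by move=> a /H[_ _ _ ->].
  exact: (derive_mul_eq0 bu (Cc _ Cth) (Cs _ Cv) (Dcos _ Cth Dth) (Dsin _ Cv Dv)).
- apply: (E (fun a => sin (th a) * cos (w a))); first by move=> a /H[_ _ _ ->].
  exact: (derive_mul_eq0 bu (Cs _ Cth) (Cc _ Cw) (Dsin _ Cth Dth) (Dcos _ Cw Dw)).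
- apply: (E (fun a => sin (th a) * sin (w a))); first by move=> a /H[_ _ _ ->].
  exact: (derive_mul_eq0 bu (Cs _ Cth) (Cs _ Cw) (Dsin _ Cth Dth) (Dsin _ Cw Dw)).
- by apply: (E (height X)) => // a /H[_ _ _ ->].
Qed.

Lemma follows_ratio (V : normedModType R) (U : set V) (h f : V -> R) : follows U h f ->
  exists rho, forall u, U u -> forall v, 'D_v f u = rho u * 'D_v h u.
Proof.
move=> H; exists (fun u => xget 0 [set r | forall v, 'D_v f u = r * 'D_v h u]).
move=> u Uu; have [r E] := H u Uu.
by case: xgetP => [s _ //|/(_ r)].
Qed.

(** In the coordinates (h, v, w) the function 1 / tau depends on h alone, so it
    has a primitive s as a function of h.  In the coordinates (s, v, w) one has
    dh = tau ds and d th = sigma ds, so that h and th depend on s alone and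
    the profile curve has unit speed. *)
Lemma arc_length_chart (U : set 'rV[R]_3) X N k1 k2 k3 u0 r p th v w :
  local_hypersurface U X N -> local_principal U X N k1 k2 k3 ->
  0 < r -> ball u0 r `<=` U -> torus_coordinates X N u0 r p th v w ->
  exists (O : set 'rV[R]_3) e Phi Xi a1 a2,
    [/\ [/\ open O, O u0, O `<=` ball u0 r & 0 < e], smooth_on O Phi,
        local_inverse Phi O (Phi u0) e Xi,
        profile (Phi u0 0 0 - e) (Phi u0 0 0 + e) a1 a2 &
     forall y, ball (Phi u0) e y ->
       [/\ th (Xi y) = a1 (y 0 0), height X (Xi y) = a2 (y 0 0),
           v (Xi y) = y 0 1 & w (Xi y) = y 0 2%:R]].
Proof.
move=> LH LP r0 bU T; have [onp p4 [Cth Cv Cw] HT] := T.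
set B := ball u0 r in bU Cth Cv Cw HT *.
have oB : open B by exact: ball_open.
have Bu0 : B u0 by exact: ballxx.
have LHB := local_hypersurface_sub oB bU LH.
have LPB := local_principal_sub bU LP.
have [_ CX CN HX] := LHB.
have Ch : smooth_on B (height X) by exact: smooth_height.
have imm u d : B u -> 'D_d X u = 0 -> d = 0 by move=> /HX[_ _ _ _]; exact.
pose is_ u := (slope N u)^-1.
have Cis : smooth_on B is_ := smooth_inv_slope LHB LPB.
have slope0 u : B u -> slope N u != 0.
  by move=> Bu; rewrite gt_eqF// sqrtr_gt0 (slope2_gt0 LHB LPB).
pose Phi1 := triple (height X) v w.
have C1 : smooth_on B Phi1 by exact: smooth_triple.
have J1 : jacobian Phi1 u0 \in unitmx.
  apply: jacobian_unit; first exact: (differentiable_class_C Bu0 C1).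
  move=> d /(derive_triple_eq0 oB Bu0 Ch Cv Cw)[D1 D2 D3].
  by apply: (imm _ _ Bu0); exact: (torus_coordinates_injective CX T Bu0).
have [ O1 [r1 [Xi1 [oO1 O1u0 O1B r10 inv1]]]] := inverse_function oB Bu0 C1 J1.
have [rho Hrho] := follows_ratio (follows_inv_slope LHB LPB).
have Phi10 : (fun a => Phi1 a 0 0) = height X by apply/funext => a; rewrite mxE.
have Dis u : O1 u -> forall d, 'D_d is_ u = rho u * 'D_d (fun a => Phi1 a 0 0) u.
  by move=> /O1B Bu d; rewrite Phi10; exact: Hrho.
have C1' := smooth_sub O1B C1; have Cis' := smooth_sub O1B Cis.
pose g x := is_ (Xi1 (first_line (Phi1 u0) x)).
have Cg : smooth_on (ball (Phi1 u0 0 0) r1) g := smooth_first inv1 Cis'.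
have gE u : O1 u -> is_ u = g (height X u).
  move=> O1u; have [Xi1P Phi1P _ _] := inv1.
  rewrite -{1}(Xi1P u O1u) (comp_inverse_first inv1 C1' Cis' oO1 Dis (Phi1P u O1u)).
  by rewrite /g mxE.
have h0E : Phi1 u0 0 0 = height X u0 by rewrite mxE.
have [S dS] := primitive_exists r10 (Cg 0%N).
rewrite h0E in Cg dS.
set I := ball (height X u0) (r1 / 2) in dS.
have oI : open I by exact: ball_open.
have II : I `<=` ball (height X u0) r1.
  by move=> x; apply: le_ball; rewrite ler_pdivrMr// ler_pMr// ler1n.
have CS : smooth_on I S.
  by apply: (smooth_is_derive1 oI dS); exact: smooth_sub Cg.
pose O2 := O1 `&` height X @^-1` I.
have O2O1 : O2 `<=` O1 by move=> u [].
have O2B : O2 `<=` B by move=> u /O2O1 /O1B.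
have oO2 : open O2.
  by apply: open_preimage => // a /O1B Ba; exact: (Ch 0%N a Ba).
have O2u0 : O2 u0 by split=> //; apply: ballxx; rewrite divr_gt0.
pose s u := S (height X u).
have O2I u : O2 u -> I (height X u) by move=> [].
have Cs : smooth_on O2 s.
  by move=> k; exact: (class_C_comp1 oO2 O2I (smooth_sub O2B Ch k) (CS k)).
have Ds u d : O2 u -> 'D_d s u = is_ u * 'D_d (height X) u.
  move=> O2u; have dh := differentiable_class_C (O2B u O2u) Ch.
  have dSu := differentiable_class_C (O2I u O2u) CS.
  apply: etrans (derive_comp d dh dSu) _; rewrite (derive_R _ dSu) mulrC.
  by rewrite gE; [congr (_ * _); have [_ ->] := dS _ (O2I u O2u)|exact: O2O1].
pose Phi := triple s v w.
have [Cv2 Cw2] := (smooth_sub O2B Cv, smooth_sub O2B Cw).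
have CPhi : smooth_on O2 Phi by exact: smooth_triple.
have is0 u : B u -> is_ u != 0 by move=> Bu; rewrite invr_eq0 slope0.
have J2 : jacobian Phi u0 \in unitmx.
  apply: jacobian_unit; first exact: (differentiable_class_C O2u0 CPhi).
  move=> d /(derive_triple_eq0 oO2 O2u0 Cs Cv2 Cw2)[D1 D2 D3].
  apply: (imm _ _ Bu0); apply: (torus_coordinates_injective CX T Bu0) => //.
  by move: D1; rewrite Ds// => /eqP; rewrite mulf_eq0 (negbTE (is0 _ Bu0)) => /eqP.
have [ O [e [Xi [oO Ou0 OO2 e0 inv]]]] := inverse_function oO2 O2u0 CPhi J2.
have OB : O `<=` B by move=> u /OO2 /O2B.
have CPhiO := smooth_sub OO2 CPhi.
have Phi0 : (fun a => Phi a 0 0) = s by apply/funext => a; rewrite mxE.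
have ChO := smooth_sub OB Ch; have CthO := smooth_sub OB Cth.
have Dh u : O u -> forall d, 'D_d (height X) u = slope N u * 'D_d (fun a => Phi a 0 0) u.
  move=> Ou d; rewrite Phi0 Ds; last exact: OO2.
  by rewrite mulrA mulfV ?mul1r// slope0//; exact: OB.
have Dth u : O u -> forall d, 'D_d th u = angle N u * 'D_d (fun a => Phi a 0 0) u.
  move=> Ou d; have [_ _ -> _] := HT u (OB u Ou).
  by rewrite Phi0 Ds ?mulrA//; exact: OO2.
have [XiP PhiP ballP _] := inv.
set b := Phi u0 in inv PhiP ballP *.
exists O, e, Phi, Xi, (fun x => th (Xi (first_line b x))),
  (fun x => height X (Xi (first_line b x))).
split=> //.
- have bE : ball (b 0 0) e = `]b 0 0 - e, b 0 0 + e[%classic by exact: ball_itv.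
  split; rewrite -?bE; [exact: smooth_first inv CthO|exact: smooth_first inv ChO|].
  move=> x xb; have {}xb : ball (b 0 0) e x by rewrite bE /= in_itv.
  have [Ox _] := ballP _ (first_line_ball xb).
  have [cth sth _ _] := HT _ (OB _ Ox).
  split=> //.
  rewrite (derive_first inv CPhiO CthO oO Dth xb) (derive_first inv CPhiO ChO oO Dh xb).
  rewrite sqr_sqrtr; last by rewrite ltW// (slope2_gt0 LHB LPB)//; exact: OB.
  by rewrite addrC subrK.
move=> y yb; have [Oy PXy] := ballP y yb.
split.
- exact: (comp_inverse_first inv CPhiO CthO oO Dth).
- exact: (comp_inverse_first inv CPhiO ChO oO Dh).
- by rewrite -[in RHS]PXy mxE.
- by rewrite -[in RHS]PXy mxE.
Qed.

End ArcLength.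

(** * Isometries and changes of charts *)

Section Isometry.
Context {R : realType}.
Implicit Types q u v : 'rV[R]_5.

Lemma S3R_dot q : S3R q <-> dot q q - q 0 ord_max ^+ 2 = 1.
Proof.
have -> : dot q q = q 0 ord_max ^+ 2 + \sum_(i < 5 | i != ord_max) q 0 i ^+ 2.
  by rewrite dotS (bigD1 ord_max)//= -expr2; congr (_ + _).
by rewrite /S3R /= addrAC subrr add0r.
Qed.

Lemma S3R_normal_dot q : S3R q -> dot (S3R_normal q) (S3R_normal q) = 1.
Proof.
move=> /S3R_dot <-; rewrite /S3R_normal dotBl !dotBr !dotZl !dotZr.
by rewrite dot_d_x5_d_x5 (dotC d_x5) dot_d_x5; ring.
Qed.

Lemma smooth_mulmxr (B : 'M[R]_5) (U : set 'rV[R]_5) :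
  smooth_on U (mulmxr B : 'rV[R]_5 -> 'rV[R]_5).
Proof. by move=> k; apply: class_C_lin; exact: continuous_mulmxr. Qed.

(** The orthogonal change of basis fixes the coordinate x_5, hence preserves
    S^3 x R. *)
Lemma linear_isometry (p : 'I_5 -> 'rV[R]_5) : orthonormal_family p ->
  p ord_max = d_x5 ->
  S3R_isometry (fun q => \row_i dot q (p i)).
Proof.
move=> onp p4; pose C : 'M[R]_5 := \matrix_i p i.
have phiE : (fun q => \row_i dot q (p i)) = mulmxr C^T.
  apply/funext => q; apply/rowP => i; rewrite !mxE dotS.
  by apply: eq_bigr => j _; rewrite !mxE.
have CCT : C *m C^T = 1%:M.
  apply/matrixP => i j; rewrite !mxE -onp dotS.
  by apply: eq_bigr => k _; rewrite !mxE.
have CTC := mulmx1C CCT.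
rewrite phiE; set phi := mulmxr C^T; pose psi := mulmxr C : 'rV[R]_5 -> 'rV[R]_5.
have phiK q : psi (phi q) = q by rewrite /phi /psi /= -mulmxA CTC mulmx1.
have psiK q : phi (psi q) = q by rewrite /phi /psi /= -mulmxA CCT mulmx1.
have dotphi u v : dot (phi u) (phi v) = dot u v.
  by rewrite /phi /= dot_mulmx trmxK -mulmxA CTC mulmx1.
have phi4 q : phi q 0 ord_max = q 0 ord_max.
  by rewrite -[phi q]/(mulmxr C^T q) -phiE mxE p4 dot_d_x5.
have phiS q : S3R (phi q) <-> S3R q by rewrite !S3R_dot dotphi phi4.
have ext (B : 'M[R]_5) : smooth_along (@S3R R) (mulmxr B : 'rV[R]_5 -> 'rV[R]_5).
  move=> q _; exists setT, (mulmxr B); split=> //; first exact: openT.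
  exact: smooth_mulmxr.
split.
- split=> [q /phiS //|q q' _ _ E|q Sq]; first by rewrite -(phiK q) E phiK.
  by exists (psi q); [apply/phiS; rewrite psiK|exact: psiK].
- exact: ext.
- by exists psi; split; [exact: ext|move=> q _; exact: phiK].
move=> q _; exists setT, phi; split.
  by split=> //; [exact: openT|exact: smooth_mulmxr].
move=> u v _ _; rewrite diff_lin; last exact: continuous_mulmxr.
exact: dotphi.
Qed.

End Isometry.

(* The coordinate map of a chart, not the coordinates of a vector in a basis. *)
Local Notation coord := Defs.coord.

Section Charts.
Context {R : realType} {n : nat}.

Lemma within_open (T W : topologicalType) (A : set T) (f : T -> W) a : open A -> A a ->
  {within A, continuous f} -> {for a, continuous f}.
Proof.
move=> oA Aa; rewrite continuous_open_subspace// => /(_ a); apply.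
by rewrite inE.
Qed.

Lemma param_continuous_at (M : topologicalType) (c : chart R n M) u :
  codom_chart c u -> {for u, continuous (param c)}.
Proof. by move=> cu; exact: (within_open (@open_codom _ _ _ c) cu (@param_continuous _ _ _ c)). Qed.

Lemma coord_continuous_at (M : topologicalType) (c : chart R n M) p :
  dom c p -> {for p, continuous (coord c)}.
Proof.
by move=> cp; exact: (within_open (@open_dom _ _ _ c) cp (@Defs.coord_continuous _ _ _ c)).
Qed.

Lemma open_coord_image (M : topologicalType) (c : chart R n M) (A : set M) :
  open A -> A `<=` dom c -> open (coord c @` A).
Proof.
move=> oA Ac.
have -> : coord c @` A = codom_chart c `&` param c @^-1` A.
  apply/seteqP; split=> [_ [p Ap <-]|u [[p cp <-] /=]].
    by split; [exists p => //; exact: Ac|rewrite /= coordK//; exact: Ac].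
  by rewrite coordK// => Ap; exists p.
apply: open_preimage => //; first exact: open_codom.
by move=> u; exact: param_continuous_at.
Qed.

Lemma smooth_transition (M : manifold R n) (p q : M) :
  smooth_on (coord (chart_at p) @` (dom (chart_at p) `&` dom (chart_at q)))
            (coord (chart_at q) \o param (chart_at p)).
Proof. by have [] := chart_at_compatible p q. Qed.

(** The differential at q is taken in the chart attached to q, whereas the whole
    argument takes place in the chart attached to p.  The two differ by the
    Jacobian matrix of the change of charts, which is the same for all maps. *)
Lemma jacobian_transition (M : manifold R n) (p q : M) :
  dom (chart_at p) q -> exists2 J : 'M[R]_n, J \in unitmx &
  forall m (F : M -> 'rV[R]_m), smooth_map F ->
    forall v, 'D_v (F \o param (chart_at p)) (coord (chart_at p) q) =
              v *m J *m differential F q.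
Proof.
set c := chart_at p; set d := chart_at q => cq; set u := coord c q.
have dq : dom d q := mem_chart_at q.
pose A := coord c @` (dom c `&` dom d).
have oA : open A.
  by apply: open_coord_image => [|a []//]; apply: openI; exact: open_dom.
have Au : A u by exists q.
pose A' := coord d @` (dom d `&` dom c).
have oA' : open A'.
  by apply: open_coord_image => [|a []//]; apply: openI; exact: open_dom.
pose tau := coord d \o param c; pose tau' := coord c \o param d.
have Ct : smooth_on A tau := smooth_transition p q.
have Ct' : smooth_on A' tau' := smooth_transition q p.
have tauu : tau u = coord d q by rewrite /tau /= coordK.
have A't : A' (tau u) by rewrite tauu; exists q.
have dt := differentiable_class_C Au Ct.
have dt' := differentiable_class_C A't Ct'.
have [J JE] : exists J : 'M[R]_n, forall v, 'D_v tau u = v *m J.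
  by exists (jacobian tau u) => v; exact: deriveEjacobian.
have [J' JE'] : exists J' : 'M[R]_n, forall v, 'D_v tau' (tau u) = v *m J'.
  by exists (jacobian tau' (tau u)) => v; exact: deriveEjacobian.
have tauK v : 'D_v (tau' \o tau) u = v.
  rewrite -[RHS](derive_id u); apply: near_eq_derive.
  apply: filterS (near_open oA Au) => _ [q' [cq' dq'] <-].
  by rewrite /= /tau' /tau /= coordK// coordK.
have JJ'v (v : 'rV[R]_n) : v *m J *m J' = v.
  have E : 'D_v (tau' \o tau) u = 'D_('D_v tau u) tau' (tau u) by exact: derive_comp.
  by rewrite -[RHS]tauK E JE JE'.
have JJ' : J *m J' = 1%:M.
  by apply/row_matrixP => i; rewrite !rowE mulmxA mulmx1 JJ'v.
exists J; first by have [uJ _] := mulmx1_unit JJ'.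
move=> m F CF v; have Cd := CF q.
have du : codom_chart d (tau u) by rewrite tauu; exists q.
have dF := differentiable_class_C du Cd.
have E : 'D_v (F \o param c) u = 'D_v ((F \o param d) \o tau) u.
  apply: near_eq_derive; apply: filterS (near_open oA Au) => _ [q' [cq' dq'] <-].
  by rewrite /= /tau /= coordK// coordK.
apply: etrans E _; apply: etrans (derive_comp v dt dF) _.
by rewrite JE (deriveEjacobian _ dF) tauu.
Qed.

(** Composing a chart with a local diffeomorphism of its target gives a chart
    whose transition maps are smooth in both directions. *)
Lemma chart_reparametrization (M : manifold R n) (p : M) (O : set 'rV[R]_n) Phi b e Xi :
  open O -> O `<=` codom_chart (chart_at p) -> O (coord (chart_at p) p) ->
  smooth_on O Phi -> local_inverse Phi O b e Xi ->
  exists c : chart R n M, [/\ in_maximal_atlas c, dom c p,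
    codom_chart c `<=` ball b e & param c = param (chart_at p) \o Xi /\
    (forall y, codom_chart c y -> O (Xi y))].
Proof.
set c0 := chart_at p => oO Oc0 Op CPhi [XiP PhiP ballP CXi].
pose D := dom c0 `&` coord c0 @^-1` O.
have oD : open D.
  by apply: open_preimage => //; [exact: open_dom|move=> q; exact: coord_continuous_at].
have oB : open (ball b e) by exact: ball_open.
pose f := Phi \o coord c0; pose g := param c0 \o Xi.
have fD : f @` D = ball b e.
  apply/seteqP; split=> [_ [q [cq Oq] <-]|y yb]; first exact: PhiP.
  have [OXi PXi] := ballP y yb; have [q cq E] := Oc0 _ OXi.
  by exists q; [split=> //=; rewrite E|rewrite /f /= E].
have ofD : open (f @` D) by rewrite fD.
have gK q : D q -> g (f q) = q by move=> [cq Oq]; rewrite /g /f /= XiP// coordK.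
have cf : {within D, continuous f}.
  rewrite continuous_open_subspace// => q /[!inE] -[cq Oq].
  by apply: continuous_comp; [exact: coord_continuous_at|exact: (CPhi 0%N)].
have cg : {within f @` D, continuous g}.
  rewrite fD continuous_open_subspace// => y /[!inE] yb.
  have [OXi _] := ballP y yb.
  by apply: continuous_comp; [exact: (CXi 0%N)|exact/param_continuous_at/Oc0].
exists (Chart oD ofD gK cf cg); split.
- move=> q; set d := chart_at q; split=> k /=.
    have oW : open (f @` (D `&` dom d)).
      apply: (@open_coord_image M (Chart oD ofD gK cf cg)) => [|a []//].
      by apply: openI => //; exact: open_dom.
    have oW' : open (coord c0 @` (dom c0 `&` dom d)).
      by apply: open_coord_image => [|a []//]; apply: openI; exact: open_dom.
    apply: (class_C_comp_rV_mx (U' := coord c0 @` (dom c0 `&` dom d)) (f := Xi)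
      (g := coord d \o param c0) oW oW').
    + by move=> _ [a [[ca Oa] da] <-]; exists a => //; rewrite /f /= XiP.
    + apply: class_C_sub (CXi k) => _ [a [[ca Oa] da] <-]; exact: PhiP.
    + exact: smooth_transition.
  have oW : open (coord d @` (D `&` dom d)).
    by apply: open_coord_image => [|a []//]; apply: openI => //; exact: open_dom.
  apply: (class_C_comp_rV_mx (U' := O) (f := coord c0 \o param d) (g := Phi) oW oO).
  + by move=> _ [a [[ca Oa] da] <-]; rewrite /= coordK.
  + apply: (class_C_sub _ (smooth_transition q p k)).
    by move=> _ [a [[ca Oa] da] <-]; exists a.
  + exact: CPhi.
- by split=> //; exact: mem_chart_at.
- by move=> y yc; rewrite -fD.
- by split=> // y yc; have /ballP[] : ball b e y by rewrite -fD.
Qed.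

End Charts.

(** * From the manifold to a chart *)

Lemma principal_intro {R : realType} {V : lmodType R} (A B : {linear V -> 'rV[R]_5})
    (n n' : 'rV[R]_5) k e a b : A e = a -> B e = b -> n = n' ->
  k *: a = - (b *m (1%:M - n'^T *m n')) -> principal A B n k e.
Proof. by move=> Aa Bb -> E; rewrite /principal Aa Bb scaleNr E opprK. Qed.

Section ToLocal.
Context {R : realType} {M : manifold R 3}.
Variables (x N : M -> 'rV[R]_5) (p : M).
Hypotheses (Hx : hypersurface x) (HN : unit_normal x N).

Let U := codom_chart (chart_at p).
Let X := x \o param (chart_at p).
Let N' := N \o param (chart_at p).

Lemma chart_hypersurface : local_hypersurface U X N'.
Proof.
have [[Cx imm] Sx] := Hx; have [CN tN nN NN] := HN.
split; [exact: open_codom|exact: Cx|exact: CN|].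
move=> _ [q cq <-]; have [J uJ HJ] := jacobian_transition cq.
have XE : X (coord (chart_at p) q) = x q by rewrite /X /= coordK.
have NE : N' (coord (chart_at p) q) = N q by rewrite /N' /= coordK.
have fE : foot X (coord (chart_at p) q) = S3R_normal (x q).
  by rewrite /foot /height XE dot_d_x5.
rewrite fE NE; split.
- exact/S3R_normal_dot/Sx.
- by move=> v; rewrite (HJ _ x Cx) nN.
- exact: tN.
- exact: NN.
move=> v; rewrite (HJ _ x Cx) => /eqP; rewrite mulmx_free_eq0; last exact: imm.
by move=> /eqP E; rewrite -[v](mulmxK uJ) E mul0mx.
Qed.

Lemma chart_principal (S : M -> 'M[R]_3) (T : M -> 'rV[R]_3) (sigma : M -> R)
    (k1 k2 k3 : M -> R) :
  shape_operator x N S -> d_x5_decomposition x N T sigma -> (forall q, T q != 0) ->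
  (forall q, [/\ eigenvalue (S q) (k1 q), eigenvalue (S q) (k2 q)
               & eigenvalue (S q) (k3 q)]) ->
  (forall q, [/\ k1 q != k2 q, k1 q != k3 q & k2 q != k3 q]) ->
  (forall q, T q *m S q = k1 q *: T q) ->
  local_principal U X N' (k1 \o param (chart_at p)) (k2 \o param (chart_at p))
    (k3 \o param (chart_at p)).
Proof.
move=> HS HT T0 Hk kk TS _ [q cq <-]; have [J uJ HJ] := jacobian_transition cq.
have [[Cx imm] Sx] := Hx; have [CN tN nN NN] := HN.
have Uq : U (coord (chart_at p) q) by exists q.
have [_ CX CN' _] := chart_hypersurface.
have dX := differentiable_class_C Uq CX; have dN := differentiable_class_C Uq CN'.
have XE : X (coord (chart_at p) q) = x q by rewrite /X /= coordK.
have NE : N' (coord (chart_at p) q) = N q by rewrite /N' /= coordK.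
have fE : foot X (coord (chart_at p) q) = S3R_normal (x q).
  by rewrite /foot /height XE dot_d_x5.
rewrite /= coordK//; have [k12 k13 k23] := kk q; have [_ ev2 ev3] := Hk q.
split=> //.
have dXE v : 'd X (coord (chart_at p) q) (v *m invmx J) = v *m differential x q.
  by apply: etrans (esym (deriveE _ dX)) _; rewrite (HJ _ x Cx) mulmxKV.
have dNE v : 'd N' (coord (chart_at p) q) (v *m invmx J) = v *m differential N q.
  by apply: etrans (esym (deriveE _ dN)) _; rewrite (HJ _ N CN) mulmxKV.
have pr k v : v *m S q = k *: v ->
    principal_at X N' (coord (chart_at p) q) k (v *m invmx J).
  move=> Sv; have E := HS q v; rewrite Sv -scalemxAl /levi_civita mulmxA in E.
  exact: (principal_intro (dXE v) (dNE v) fE E).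
have nz v : v != 0 -> v *m invmx J != 0.
  by apply: contra_neq => E; rewrite -[v](mulmxKV uJ) E mul0mx.
have [v2 Sv2 v20] := eigenvalueP ev2; have [v3 Sv3 v30] := eigenvalueP ev3.
exists (T q *m invmx J), (v2 *m invmx J), (v3 *m invmx J), (sigma q).
split; [|by split; exact: nz|exact: pr|exact: pr|exact: pr].
by rewrite dXE NE; exact: HT.
Qed.

End ToLocal.

Theorem theorem3p7 (R : realType) (M : manifold R 3)
    (x N : M -> 'rV[R]_5) (S : M -> 'M[R]_3)
    (T : M -> 'rV[R]_3) (sigma : M -> R)
    (k1 k2 k3 : M -> R) (f1 f2 : R -> R) :
  hypersurface x ->
  unit_normal x N ->
  shape_operator x N S ->
  d_x5_decomposition x N T sigma ->
  (forall p, T p != 0) ->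
  (forall p, [/\ eigenvalue (S p) (k1 p), eigenvalue (S p) (k2 p)
               & eigenvalue (S p) (k3 p)]) ->
  (forall p, [/\ k1 p != k2 p, k1 p != k3 p & k2 p != k3 p]) ->
  (forall p, T p *m S p = k1 p *: T p) ->
  smooth_along (range k1) f1 ->
  smooth_along (range k1) f2 ->
  (forall p, k2 p = f1 (k1 p)) ->
  (forall p, k3 p = f2 (k1 p)) ->
  locally_congruent_to_model x.
Proof.
move=> Hx HN HS HT T0 Hk kk TS Cf1 Cf2 k2E k3E p.
set c0 := chart_at p.
have LH := chart_hypersurface p Hx HN.
have LP := chart_principal (p := p) Hx HN HS HT T0 Hk kk TS.
set u0 := coord c0 p.
have Uu0 : codom_chart c0 u0 by exists p => //; exact: mem_chart_at.
have [] := @torus_coordinates_exist R _ _ _ _ _ _ _ (range k1) f1 f2 u0 LH LP Uu0 _ Cf1 Cf2.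
- by move=> u _; exists (param c0 u).
- by move=> u _; exact: k2E.
- by move=> u _; exact: k3E.
move=> r [P [th [v [w [r0 bU Tor]]]]].
have [ O [e [Phi [Xi [a1 [a2 [[oO Ou0 OB e0] CPhi inv prof Hy]]]]]]] :=
  arc_length_chart LH LP r0 bU Tor.
have OU : O `<=` codom_chart c0 by move=> u /OB /bU.
have [c [cmax cp cB [paramE cO]]] := chart_reparametrization oO OU Ou0 CPhi inv.
have [onP P4 _ HTor] := Tor.
exists (fun q => \row_i dot q (P i)), c, (Phi u0 0 0 - e), (Phi u0 0 0 + e), a1, a2.
split=> //; first exact: linear_isometry.
move=> y cy; have yb := cB y cy; have Oy := cO y cy.
split; first by have := coord_ball 0 yb; rewrite ball_itv /= in_itv.
have [E1 E2 E3 E4] := Hy y yb; have [_ _ _ HX] := HTor _ (OB _ Oy).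
apply/rowP => i; rewrite !mxE paramE /=.
by apply: etrans (HX i) _; rewrite E1 E2 E3 E4.
Qed.
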